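(* In the weighted Indian buffet model described in the context, suppose $\beta\in[0,1)$ and, for some constant $r$, \[ \overline{R}_n:=\frac1n\sum_{i=1}^nR_i\longrightarrow r\ \text{ a.s.}\qquad\text{and}\qquad \frac{\sum_{j=1}^n j^{\beta-1}E|\overline{R}_j-r|}{\sqrt{a_n(\beta)}}\longrightarrow0. \] Let $L_n=\mathrm{card}(S_n)$. Then \[ \sqrt{a_n(\beta)}\Bigl\{\frac{L_n}{a_n(\beta)}-\lambda(\beta)\Bigr\}\longrightarrow\mathcal{N}\bigl(0,\lambda(\beta)\bigr)\quad\text{stably}, \] where $a_n(\beta)=\log n$ and $\lambda(\beta)=\alpha c/r$ if $\beta=0$, while $a_n(\beta)=n^\beta$ and $\lambda(\beta)=\frac{\alpha\Gamma(c+1)}{\Gamma(c+\beta)}\frac{1}{\beta r^{1-\beta}}$ if $\beta\in(0,1)$.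
   Context: Let $\mathcal{X}$ be a separable metric space with Borel $\sigma$-field $\mathcal{B}$, and let $\mathcal{M}$ be the set of finite positive measures on $\mathcal{B}$; $\mu\in\mathcal{M}$ is diffuse if $\mu\{x\}=0$ for all $x$. All random quantities live on a probability space $(\Omega,\mathcal{A},P)$. A random measure (r.m.) is a map $M:\Omega\to\mathcal{M}$ such that $\omega\mapsto M(\omega)(B)$ is measurable for each $B\in\mathcal{B}$. A Poisson r.m. with intensity $\nu\in\mathcal{M}$ is an r.m. $M$ with $M(B_1),\dots,M(B_k)$ independent for pairwise disjoint $B_j$ and $M(B)\sim\mathrm{Poi}(\nu(B))$ for all $B$ (with $\mathrm{Poi}(0)=\delta_0$). Each $\nu\in\mathcal{M}$ is uniquely $\nu=\nu_c+\nu_d$, $\nu_c$ diffuse, $\nu_d=\sum_j\gamma_j\delta_{x_j}$. $M\sim\mathrm{BeP}(\nu)$ (Bernoulli r.m. with hazard measure $\nu$) means $M=M_1+M_2$ with $M_1,M_2$ independent, $M_1$ Poisson with intensity $\nu_c$, $M_2=\sum_jV_j\delta_{x_j}$ with independent indicators $V_j$, $P(V_j=1)=\gamma_j$. ''$X\mid\mathcal{G}\sim Y\mid\mathcal{G}$'' means $P(X\in A\mid\mathcal{G})=P(Y\in A\mid\mathcal{G})$ a.s. for all measurable $A$. Model: fix a diffuse probability measure $m$ on $\mathcal{B}$ and reals $\alpha>0$, $\beta<1$, $c>-\beta$. $(M_n)_{n\ge1}$ are r.m.'s and $(R_n)_{n\ge1}$ real random variables such that for each $n\ge1$, $R_n$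 is independent of $(M_1,\dots,M_n,R_1,\dots,R_{n-1})$ and $R_n\ge u$ for a constant $u>\max(\beta,0)$; and $M_{n+1}\mid\mathcal{F}_n\sim\mathrm{BeP}(\nu_n)$ for all $n\ge0$, where $\mathcal{F}_0=\{\varnothing,\Omega\}$, $\mathcal{F}_n=\sigma(M_1,\dots,M_n,R_1,\dots,R_n)$, $S_n=\{x: M_i\{x\}=1\text{ for some } i\le n\}$, $\nu_0=\alpha m$ and for $n\ge1$ \[ \nu_n=\sum_{x\in S_n}\frac{\sum_{i=1}^nR_iM_i\{x\}-\beta}{\sum_{i=1}^nR_i+c}\,\delta_x+\Lambda_n\, m,\qquad \Lambda_0=\alpha,\ \ \Lambda_n=\alpha\frac{\Gamma(c+1)\Gamma(c+\beta+\sum_{i=1}^nR_i)}{\Gamma(c+\beta)\Gamma(c+1+\sum_{i=1}^nR_i)}. \] Stable convergence: a kernel is an r.m. $K$ with $K(\omega)(\mathbb{R})=1$ for all $\omega$ (here on $\mathbb R$). Real random variables $X_n$ converge stably to $K$ if $E\{K(f)\mid H\}=\lim_nE\{f(X_n)\mid H\}$ for all $H\in\mathcal{A}$ with $P(H)>0$ and all bounded continuous $f$, where $K(f)=\int f\,dK$. $\mathcal{N}(0,a)$ denotes the Gaussian law with mean $0$ and variance $a\ge0$ (with $\mathcal N(0,0)=\delta_0$), viewed as a constant kernel. *)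

(* Defs.v *)
From HB Require Import structures.
From mathcomp Require Import all_boot all_order all_algebra.
From mathcomp Require Import all_classical all_reals all_analysis.
From mathcomp Require Import measurable_realfun normal_distribution.
Set Implicit Arguments. Unset Strict Implicit. Unset Printing Implicit Defensive.
Import Order.TTheory GRing.Theory Num.Def Num.Theory.
Import numFieldTopology.Exports.
Local Open Scope classical_set_scope.
Local Open Scope ring_scope.

Section WIBP.
Context {R : realType}.

Definition Gamma (x : R) : R :=
  Rintegral lebesgue_measure `[0%R, +oo[%classic (fun t => t `^ (x - 1) * expR (- t)).

Definition borel_sets (X : topologicalType) : set (set X) := <<s [set U | open U] >>.

Definition separable_space (X : topologicalType) :=
  exists D : set X, countable D /\ closure D = setT.

Definition finite_measure_on {X : choiceType} (B : set (set X)) (mu : set X -> \bar R) :=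
  [/\ mu set0 = 0%E,
      (forall A, B A -> (0 <= mu A)%E),
      (forall F : (set X)^nat, (forall i, B (F i)) -> trivIset setT F ->
          (fun n => \sum_(0 <= i < n) mu (F i))%E @ \oo --> mu (\bigcup_i F i)) &
      (mu setT < +oo)%E].

Definition diffuse {X : choiceType} (mu : set X -> \bar R) := forall x, mu [set x] = 0%E.

Definition atoms {X : choiceType} (nu : set X -> \bar R) := [set x | (0 < nu [set x])%E].
Definition nu_d {X : choiceType} (nu : set X -> \bar R) (A : set X) : \bar R :=
  \esum_(x in atoms nu `&` A) nu [set x].
Definition nu_c {X : choiceType} (nu : set X -> \bar R) (A : set X) : \bar R :=
  (nu A - nu_d nu A)%E.

Definition ev_sigma {X : choiceType} (B : set (set X)) : set (set (set X -> \bar R)) :=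
  <<s [set E | exists A (U : set (\bar R)), [/\ B A, measurable U &
                E = [set mu | U (mu A)]]] >>.

Definition indep2 {d} {O : measurableType d} (Q : probability O R)
    (F G : set (set O)) :=
  forall E1 E2, F E1 -> G E2 -> Q (E1 `&` E2) = (Q E1 * Q E2)%E.

Definition mutual_indep_events {d} {O : measurableType d} (Q : probability O R)
    {I : Type} (I0 : set I) (E : I -> set O) :=
  forall (n : nat) (k : 'I_n -> I), injective k -> (forall j, I0 (k j)) ->
    Q (\big[setI/setT]_(j < n) E (k j)) = \big[*%E/1%E]_(j < n) Q (E (k j)).

Definition mutual_indep_rvs {d} {O : measurableType d} (Q : probability O R)
    (n : nat) (Y : 'I_n -> O -> \bar R) :=
  forall U : 'I_n -> set (\bar R), (forall j, measurable (U j)) ->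
    Q (\big[setI/setT]_(j < n) (Y j @^-1` U j)) = \big[*%E/1%E]_(j < n) Q (Y j @^-1` U j).

Definition random_measure {X : choiceType} (B : set (set X)) {d} {O : measurableType d}
    (Q : probability O R) (M : O -> set X -> \bar R) :=
  (forall w, finite_measure_on B (M w)) /\
  (forall A, B A -> measurable_fun setT (fun w => M w A)).

Definition sigma_rm {X : choiceType} (B : set (set X)) {d} {O : measurableType d}
    (M : O -> set X -> \bar R) : set (set O) :=
  <<s [set E | exists A (U : set (\bar R)), [/\ B A, measurable U &
                 E = (fun w => M w A) @^-1` U]] >>.

Definition poisson_rm {X : choiceType} (B : set (set X)) {d} {O : measurableType d}
    (Q : probability O R) (M : O -> set X -> \bar R) (nu : set X -> \bar R) :=
  random_measure B Q M /\
  (forall (n : nat) (Bs : 'I_n -> set X), (forall j, B (Bs j)) ->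
     (forall i j, i != j -> Bs i `&` Bs j = set0) ->
     mutual_indep_rvs Q (fun j w => M w (Bs j))) /\
  (forall A, B A -> forall k : nat,
     Q [set w | M w A = (k%:R)%:E] =
       (expR (- fine (nu A)) * fine (nu A) ^+ k / (k`!)%:R)%:E).

(** K is the law (on ev_sigma B) of a Bernoulli random measure BeP(nu):
    the law of M1 + M2, M1 Poisson(nu_c) independent of
    M2 = sum_j V_j delta_{x_j}, V_j independent indicators with
    P(V_j = 1) = gamma_j = nu{x_j}. *)
Definition BeP_law {X : choiceType} (B : set (set X)) (nu : set X -> \bar R)
    (K : set (set X -> \bar R) -> \bar R) :=
  finite_measure_on B nu /\
  exists d (O : measurableType d) (Q : probability O R)
         (M1 : O -> set X -> \bar R) (V : X -> O -> bool),
    [/\ poisson_rm B Q M1 (nu_c nu),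
        (forall x, atoms nu x -> measurable [set w | V x w]),
        (forall x, atoms nu x -> Q [set w | V x w] = nu [set x]),
        mutual_indep_events Q (atoms nu) (fun x => [set w | V x w]) &
        indep2 Q (sigma_rm B M1)
          (<<s [set E | exists x, atoms nu x /\ E = [set w | V x w]] >>)] /\
    forall A, ev_sigma B A ->
      K A = Q ((fun w => (M1 w \+
                 (fun C => \esum_(x in atoms nu `&` C) ((V x w)%:R)%:E))%E) @^-1` A).

Definition stable_conv {d} {O : measurableType d} (P : probability O R)
    (Z : nat -> O -> R) (K : probability (measurableTypeR R) R) :=
  forall H, measurable H -> (0 < P H)%E ->
  forall f : R -> R, continuous f -> (exists k, forall x, `|f x| <= k) ->
    (fun n => (\int[P]_(w in H) (f (Z n w))%:E) * ((fine (P H))^-1)%:E)%E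
      @ \oo --> (\int[K]_x (f x)%:E)%E.

Section model.
Context {X : choiceType} (B : set (set X)) {d} {Omega : measurableType d}
  (M : nat -> Omega -> set X -> \bar R) (Rv : nat -> Omega -> R).

Definition Fgen (nM nR : nat) : set (set Omega) :=
  <<s [set E | exists i, (1 <= i <= nM)%N /\ exists A (U : set (\bar R)),
                 [/\ B A, measurable U & E = (fun w => M i w A) @^-1` U]] `|`
      [set E | exists i, (1 <= i <= nR)%N /\ exists U : set R,
                 measurable U /\ E = Rv i @^-1` U] >>.

Definition Fn (n : nat) := Fgen n n.

Definition sumR (n : nat) (w : Omega) : R := \sum_(1 <= i < n.+1) Rv i w.

Definition Sn (n : nat) (w : Omega) : set X :=
  [set x | exists i, (1 <= i <= n)%N /\ M i w [set x] = 1%E].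

Definition Lambda (alpha beta c : R) (n : nat) (w : Omega) : R :=
  alpha * (Gamma (c + 1) * Gamma (c + beta + sumR n w)) /
          (Gamma (c + beta) * Gamma (c + 1 + sumR n w)).

Definition nu_n (m : set X -> \bar R) (alpha beta c : R) (n : nat) (w : Omega)
    (A : set X) : \bar R :=
  (\esum_(x in Sn n w `&` A)
     (((\sum_(1 <= i < n.+1) Rv i w * fine (M i w [set x])) - beta) /
        (sumR n w + c))%:E
   + (Lambda alpha beta c n w)%:E * m A)%E.

Definition Rbar (n : nat) (w : Omega) : R := sumR n w / n%:R.

(** L_n = card(S_n) (as a real number; S_n is a.s. finite). *)
Definition Ln (n : nat) (w : Omega) : R := fine (\esum_(x in Sn n w) 1%E).

End model.

Definition a_n (beta : R) (n : nat) : R :=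
  if beta == 0 then ln n%:R else n%:R `^ beta.

Definition lambda_beta (alpha beta c r : R) : R :=
  if beta == 0 then alpha * c / r
  else alpha * Gamma (c + 1) / Gamma (c + beta) / (beta * r `^ (1 - beta)).

End WIBP.
Arguments borel_sets : clear implicits.

(* Main.v *)
Require Import Defs.
From HB Require Import structures.
From mathcomp Require Import all_boot all_order all_algebra.
From mathcomp Require Import all_classical all_reals all_analysis.
From mathcomp Require Import measurable_realfun normal_distribution.
From mathcomp Require Import ring lra.
Import Order.TTheory GRing.Theory Num.Def Num.Theory.
Import numFieldTopology.Exports.
Local Open Scope classical_set_scope.
Local Open Scope ring_scope.
Set Implicit Arguments.
Unset Strict Implicit.
Unset Printing Implicit Defensive.


(** Let [N_n] be the number of points of [M_(n+1)] outside [S_n].  Given [F_n] it is Poisson with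
    the [F_n]-measurable parameter [Lambda_n], because [m] is diffuse, and [L_n = N_0 + ... + N_(n-1)]
    almost surely.  Bounds on Gamma quotients give [Lambda_n = kappa (n r)^(beta-1)] up to
    [O(n^(beta-1) |Rbar_n - r| + n^(beta-2))], so the rate hypothesis says that replacing the random
    rates by deterministic ones costs [o(sqrt a_n)] in total.  The replacement is carried out one
    step at a time on [E (phi (L_m) f ((L_n - lambda a_n) / sqrt a_n))], using the semigroup property
    of Poisson expectations; the Poisson central limit theorem, by Stein's method, then identifies
    the limit as [E (phi (L_m)) * N(0, lambda)(f)].  Taking for [phi (L_m)] an earlier term of the
    same sequence, Renyi's mixing criterion turns this into convergence conditionally on every
    event, which is stable convergence since the limit kernel is constant. *)


(** * Poisson expectations *)

(** The conditional law of [M n.+1] speaks of masses of fixed Borel sets, while a new point is a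
    random location outside the random set [Sn]; neither the existence of such points nor the
    measurability of their number is given. The bridge is a countable base: [untouched n i] is an
    event of the past on which [G i] holds no old point, so that there the masses of subsets of
    [G i] are Poisson. Cut [G i] into cells of small [m]-mass: a cell receives two or more points
    with probability quadratic in its mass, so that almost surely, at arbitrarily fine levels, all
    cells have mass zero or one, and since base sets separate points these masses are unit atoms.

    The rates depend on the past, so the count is not itself Poisson. The interpolation follows the
    true process up to time [j] and a deterministic Poisson tail afterwards; the test function of
    the count then has increments at most [K / sqrt a_n], which is where the normalisation of the
    rate hypothesis enters. This asks for Lipschitz test functions; bounded continuous ones are
    recovered by infimal convolution. *)

Section poisson_expectation.
Context {R : realType}.
Implicit Types (l m : R) (k : nat) (f h : nat -> \bar R).

Definition pois l k : R := expR (- l) * l ^+ k / k`!%:R.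

Lemma pois_ge0 l k : 0 <= l -> 0 <= pois l k.
Proof. by move=> l0; rewrite /pois !mulr_ge0 ?expR_ge0// exprn_ge0. Qed.

Lemma poisS l k : pois l k.+1 * k.+1%:R = l * pois l k.
Proof.
rewrite /pois factS natrM exprS invfM.
have k0 : k.+1%:R != 0 :> R by rewrite pnatr_eq0.
have f0 : k`!%:R != 0 :> R by rewrite pnatr_eq0 -lt0n fact_gt0.
by move: (k.+1%:R) (k`!%:R) k0 f0 => a b a0 b0; field; rewrite a0 b0.
Qed.

Lemma measurable_pois k : measurable_fun setT (fun l => pois l k).
Proof.
apply: measurable_funM => //; apply: measurable_funM.
  by apply: measurableT_comp => //; exact: measurable_funN.
exact: measurable_funX.
Qed.

Lemma cvg_sum_pois l : (fun n => \sum_(0 <= k < n) pois l k) @ \oo --> (1 : R).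
Proof.
have -> : (fun n => \sum_(0 <= k < n) pois l k) =
    (fun n => expR (- l) * series (exp_coeff l) n).
  apply/funext => n; rewrite /series/= mulr_sumr; apply: eq_bigr => i _.
  by rewrite /pois /exp_coeff /= mulrA.
have -> : 1 = expR (- l) * expR l by rewrite -expRD addNr expR0.
by apply: cvgMr; exact: is_cvg_series_exp_coeff.
Qed.

Lemma pois_sum_le1 l n : 0 <= l -> \sum_(0 <= k < n) pois l k <= 1.
Proof.
move=> l0; have := @cvg_sum_pois l => /[dup] c /(@cvg_lim _ _) <-//.
apply: nondecreasing_cvgn_le; last by apply/cvg_ex; exists 1.
apply/nondecreasing_seqP => i; rewrite big_nat_recr//= lerDl; exact: pois_ge0.
Qed.

Lemma cvg_pois0 l : pois l n @[n --> \oo] --> (0 : R).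
Proof.
rewrite (_ : pois l = (fun n => expR (- l) * exp_coeff l n)); last first.
  by apply/funext => n; rewrite /pois/exp_coeff/= mulrA.
rewrite -[X in _ --> X](mulr0 (expR (- l))).
by apply: cvgMr; exact: cvg_exp_coeff.
Qed.

Local Open Scope ereal_scope.

(** An extended-real series, so that rearrangements rest on nonnegativity of [l] and [f] without
    summability conditions; for the same reason later estimates come as pairs of inequalities
    instead of bounds on a difference. *)
Definition poisE l f : \bar R := \sum_(0 <= k <oo) (pois l k)%:E * f k.

Lemma poisE_ge0 l f : (0 <= l)%R -> (forall k, 0 <= f k) -> 0 <= poisE l f.
Proof.
by move=> l0 f0; apply: nneseries_ge0 => k _ _; rewrite mule_ge0// lee_fin pois_ge0.
Qed.

Lemma le_poisE l f h : (0 <= l)%R -> (forall k, 0 <= f k) ->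
  (forall k, f k <= h k) -> poisE l f <= poisE l h.
Proof.
move=> l0 f0 fh; apply: lee_nneseries => k ?; first by rewrite mule_ge0// lee_fin pois_ge0.
by rewrite lee_wpmul2l// lee_fin pois_ge0.
Qed.

Lemma poisED l f h : (0 <= l)%R -> (forall k, 0 <= f k) -> (forall k, 0 <= h k) ->
  poisE l (fun k => f k + h k) = poisE l f + poisE l h.
Proof.
move=> l0 f0 h0; rewrite /poisE -nneseriesD; last 2 first.
  by move=> k _ _; rewrite mule_ge0// lee_fin pois_ge0.
  by move=> k _ _; rewrite mule_ge0// lee_fin pois_ge0.
by apply: eq_eseriesr => k _; rewrite ge0_muleDr.
Qed.

Lemma poisEZ l (c : R) f : (0 <= l)%R -> (0 <= c)%R -> (forall k, 0 <= f k) ->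
  poisE l (fun k => c%:E * f k) = c%:E * poisE l f.
Proof.
move=> l0 c0 f0; rewrite /poisE -nneseriesZl; last first.
  by move=> k _; rewrite mule_ge0// lee_fin pois_ge0.
by apply: eq_eseriesr => k _; rewrite muleCA.
Qed.

Lemma poisE1 l : poisE l (fun=> 1) = 1.
Proof.
rewrite /poisE; under eq_eseriesr do rewrite mule1.
have h := cvg_lim (@Rhausdorff R) (@cvg_sum_pois l).
rewrite -[RHS]/(1%R%:E) -h.
rewrite -EFin_lim; last by apply/cvg_ex; exists 1%R; exact: cvg_sum_pois.
by congr (limn _); apply/funext => n /=; rewrite -sumEFin.
Qed.

Lemma poisE_cst l (c : R) : (0 <= l)%R -> (0 <= c)%R -> poisE l (fun=> c%:E) = c%:E.
Proof.
move=> l0 c0; rewrite -[RHS]mule1 -(poisE1 l) -poisEZ//.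
by rewrite /poisE; apply: eq_eseriesr => k _; rewrite mule1.
Qed.

(** Term by term this is [poisS], the Poisson counterpart of Gaussian integration by parts; the term
    [k = 0] vanishes. The first two moments follow from it. *)
Lemma poisE_shift l f : (0 <= l)%R -> (forall k, 0 <= f k) ->
  poisE l (fun k => (k%:R)%:E * f k) = l%:E * poisE l (fun k => f k.+1).
Proof.
move=> l0 f0; rewrite /poisE nneseries_recl//; last first.
  by move=> k _; rewrite !mule_ge0// lee_fin ?pois_ge0.
rewrite mul0e mule0 add0e -nneseries_addn; last first.
  by move=> k; rewrite !mule_ge0// lee_fin ?pois_ge0.
rewrite -nneseriesZl; last by move=> k _; rewrite mule_ge0// lee_fin ?pois_ge0.
by apply: eq_eseriesr => k _; rewrite addn1 muleA -EFinM poisS EFinM muleA.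
Qed.

Lemma poisE_id l : (0 <= l)%R -> poisE l (fun k => (k%:R)%:E) = l%:E.
Proof.
move=> l0; have := poisE_shift l0 (fun=> lee01).
rewrite poisE1 mule1 => <-; congr poisE; apply/funext => k; by rewrite mule1.
Qed.

Lemma poisE_sqr l : (0 <= l)%R -> poisE l (fun k => ((k%:R - l) ^+ 2)%:E) = l%:E.
Proof.
move=> l0.
have Esq : poisE l (fun k => (k%:R * k%:R)%:E) = (l ^+ 2 + l)%:E.
  have := @poisE_shift l (fun k => (k%:R)%:E) l0 (fun k => ltac:(by rewrite lee_fin)).
  have -> : (fun k => (k%:R)%:E * (k%:R)%:E) = (fun k => (k%:R * k%:R)%:E) :> (nat -> \bar R).
    by apply/funext => k; rewrite EFinM.
  move=> ->.
  have -> : (fun k => (k.+1%:R)%:E) = (fun k => (k%:R)%:E + 1) :> (nat -> \bar R).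
    by apply/funext => k; rewrite -EFinD natr1.
  rewrite poisED//.
  by rewrite poisE_id// poisE1 -EFinD -EFinM; congr EFin; ring.
(* Additivity of [poisE] is available for nonnegative functions only, so the cross term of the
   square is moved to the left-hand side. *)
have : poisE l (fun k => ((k%:R - l) ^+ 2)%:E + (2 * l)%:E * (k%:R)%:E) =
    poisE l (fun k => (k%:R * k%:R)%:E + (l ^+ 2)%:E).
  congr poisE; apply/funext => k; rewrite -EFinM -!EFinD; congr EFin; ring.
rewrite poisED//; last 2 first.
  by move=> k; rewrite lee_fin sqr_ge0.
  by move=> k; rewrite mule_ge0 ?lee_fin ?mulr_ge0.
rewrite poisED//; last by move=> k; rewrite lee_fin sqr_ge0.
rewrite poisE_cst ?sqr_ge0// poisEZ ?mulr_ge0//.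
rewrite poisE_id// Esq -EFinM -EFinD.
move: (poisE _ _) => [x| |]//; rewrite -EFinD => -[xE]; congr EFin.
by apply: (addIr (2 * l * l)%R); rewrite xE; ring.
Qed.

Lemma pois_convolution l m n :
  (\sum_(i < n.+1) pois l i * pois m (n - i) = pois (l + m) n)%R.
Proof.
rewrite /pois addrC exprDn mulr_sumr mulr_suml; apply: eq_bigr => i _.
have i_n : (i <= n)%N by rewrite -ltnS.
have /(congr1 (fun x => x%:R : R)) := bin_fact i_n.
rewrite !natrM => nE; rewrite -[(_ *+ 'C(_, _))%R]mulr_natr.
have a0 : (i`!%:R != 0 :> R)%R by rewrite pnatr_eq0 -lt0n fact_gt0.
have b0 : ((n - i)`!%:R != 0 :> R)%R by rewrite pnatr_eq0 -lt0n fact_gt0.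
have c0 : ('C(n, i)%:R != 0 :> R)%R by rewrite pnatr_eq0 -lt0n bin_gt0.
rewrite -nE opprD expRD.
move: (i`!%:R) ((n - i)`!%:R) a0 b0. move: ('C(n, i)%:R) c0 => c c0 a b a0 b0.
by field; rewrite a0 b0 c0.
Qed.

Lemma pois_sum_le_poisE l (h : nat -> R) n : (0 <= l)%R -> (forall k, 0 <= h k)%R ->
  (\sum_(0 <= k < n) pois l k * h k)%:E <= poisE l (fun k => (h k)%:E).
Proof.
move=> l0 h0; rewrite -sumEFin /poisE.
under eq_bigr do rewrite EFinM.
by apply: nneseries_lim_ge => k _ _; rewrite mule_ge0// lee_fin ?pois_ge0.
Qed.

Lemma poisE_cvg l (h : nat -> R) (C : R) : (0 <= l)%R -> (forall k, 0 <= h k <= C)%R ->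
  poisE l (fun k => (h k)%:E) \is a fin_num /\
  (\sum_(0 <= k < n) pois l k * h k)%R @[n --> \oo] --> fine (poisE l (fun k => (h k)%:E)).
Proof.
move=> l0 h0; have h0' k : (0 <= h k)%R by have /andP[] := h0 k.
have C0 : (0 <= C)%R by have /andP[/le_trans a /a] := h0 0%N.
have fn : poisE l (fun k => (h k)%:E) \is a fin_num.
  rewrite ge0_fin_numE; last by apply: poisE_ge0 => // k; rewrite lee_fin.
  apply: (@le_lt_trans _ _ (poisE l (fun=> C%:E))).
    by apply: le_poisE => // k; rewrite lee_fin//; have /andP[] := h0 k.
  by rewrite poisE_cst// ltry.
split=> //.
have : (fun n => \sum_(0 <= k < n) (pois l k)%:E * (h k)%:E) @ \oo -->
    poisE l (fun k => (h k)%:E).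
  by apply: is_cvg_nneseries => k _ _; rewrite mule_ge0// lee_fin ?pois_ge0.
rewrite -[X in _ --> X -> _](fineK fn) => /fine_cvg; apply: cvg_trans.
apply: near_eq_cvg; apply: nearW => n /=.
by rewrite -[RHS]/(fine (_)%:E) -sumEFin; congr fine; apply: eq_bigr => k _; rewrite EFinM.
Qed.

Lemma poisE_semigroup l m f : (0 <= l)%R -> (0 <= m)%R -> (forall k, 0 <= f k) ->
  poisE l (fun a => poisE m (fun b => f (a + b)%N)) = poisE (l + m) f.
Proof.
move=> l0 m0 f0.
(* Indexing the double series by the total [k = a + b], with zero entries for [k < a], lets Tonelli
   interchange the sums; the sum over [a] is then the finite one of [pois_convolution]. *)
pose F a k := if (a <= k)%N then (pois l a * pois m (k - a))%:E * f k else 0.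
have F0 a k : 0 <= F a k.
  by rewrite /F; case: ifP => // _; rewrite mule_ge0// lee_fin mulr_ge0 ?pois_ge0.
transitivity (\sum_(0 <= a <oo) \sum_(0 <= k <oo) F a k).
  apply: eq_eseriesr => a _; rewrite (nneseries_split 0 a)//.
  rewrite add0n big_nat big1 ?add0e; last first.
    by move=> i /andP[_ ia]; rewrite /F leqNgt ia.
  rewrite -nneseries_addn// /poisE -nneseriesZl; last first.
    by move=> k _; rewrite mule_ge0// lee_fin pois_ge0.
  apply: eq_eseriesr => k _.
  by rewrite /F leq_addl addnK addnC EFinM muleA.
rewrite nneseries_interchange//.
apply: eq_eseriesr => k _.
rewrite (nneseries_split 0 k.+1)// add0n.
rewrite [X in _ + X]eseries0 ?adde0; last first.
  by move=> i ki _; rewrite /F leqNgt ki.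
rewrite -(pois_convolution l m k) -sumEFin ge0_sume_distrl; last first.
  by move=> i _; rewrite lee_fin mulr_ge0 ?pois_ge0.
rewrite big_mkord; apply: eq_bigr => i _.
by rewrite /F -ltnS ltn_ord.
Qed.

Lemma poisE_lip l (h : nat -> R) (D : R) : (0 <= l)%R -> (0 <= D)%R ->
  (forall k, 0 <= h k)%R -> (forall k, `|h k.+1 - h k| <= D)%R ->
  poisE l (fun k => (h k)%:E) <= (h 0%N + D * l)%:E /\
  (h 0%N)%:E <= poisE l (fun k => (h k)%:E) + (D * l)%:E.
Proof.
move=> l0 D0 h0 hD.
have hk k : (`|h k - h 0%N| <= D * k%:R)%R.
  elim: k => [|k IH]; first by rewrite subrr normr0 mulr0.
  rewrite -(subrKA (h k)) (le_trans (ler_normD _ _))//.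
  by rewrite -natr1 mulrDr mulr1 addrC lerD.
have Dk k : 0 <= D%:E * (k%:R)%:E by rewrite mule_ge0// lee_fin.
have E1 : poisE l (fun k => D%:E * (k%:R)%:E) = (D * l)%:E.
  by rewrite poisEZ// poisE_id.
split.
- have -> : (h 0%N + D * l)%:E = poisE l (fun=> (h 0%N)%:E) +
      poisE l (fun k => D%:E * (k%:R)%:E) by rewrite E1 poisE_cst.
  rewrite -poisED//; last by move=> _; rewrite lee_fin.
  apply: le_poisE => // k; rewrite -EFinM -EFinD !lee_fin//.
  by rewrite -lerBlDl (le_trans (ler_norm _)).
- apply: (@le_trans _ _ (poisE l (fun k => (h k)%:E + D%:E * (k%:R)%:E))).
    rewrite -[X in X <= _](@poisE_cst l)//.
    apply: le_poisE => // k; first by rewrite lee_fin.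
    rewrite -EFinM -EFinD !lee_fin//.
    by rewrite -lerBlDl (le_trans (ler_norm _))// distrC.
  by rewrite poisED// E1.
Qed.

(** By [poisE_semigroup] the larger rate is the smaller one plus an independent excess, whose effect
    on the shifted [h] is bounded by [poisE_lip]. In coupling terms, the two Poisson variables
    differ by one of mean [|l - m|]. *)
Lemma poisE_rate l m (h : nat -> R) (D : R) : (0 <= l)%R -> (0 <= m)%R -> (0 <= D)%R ->
  (forall k, 0 <= h k)%R -> (forall k, `|h k.+1 - h k| <= D)%R ->
  poisE l (fun k => (h k)%:E) <= poisE m (fun k => (h k)%:E) + (D * `|l - m|)%:E.
Proof.
move=> l0 m0 D0 h0 hD.
have h0E k : 0 <= (h k)%:E by rewrite lee_fin.
have hD' k j : (`|h (k + j.+1)%N - h (k + j)%N| <= D)%R by rewrite addnS.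
have [lm|/ltW ml] := leP l m.
- have -> : m = (l + (m - l))%R by lra.
  have ml0 : (0 <= m - l)%R by rewrite subr_ge0.
  rewrite -poisE_semigroup//.
  have -> : (D * `|l - (l + (m - l))| = D * (m - l))%R.
    by rewrite ler0_norm ?opprB; [congr (_ * _)%R; lra|lra].
  rewrite -[X in _ + X](@poisE_cst l) ?mulr_ge0// -poisED//; last 2 first.
    by move=> k; exact: poisE_ge0.
    by move=> k; rewrite lee_fin mulr_ge0.
  apply: le_poisE => // k.
  have [_] := poisE_lip ml0 D0 (fun j => h0 (k + j)%N)
     (fun j => hD' k j).
  by rewrite addn0.
- have -> : l = (m + (l - m))%R by lra.
  have ml0 : (0 <= l - m)%R by rewrite subr_ge0.
  rewrite -poisE_semigroup//.
  have -> : (D * `|m + (l - m) - m| = D * (l - m))%R.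
    by rewrite ger0_norm; [congr (_ * _)%R; lra|lra].
  rewrite -[X in _ + X](@poisE_cst m) ?mulr_ge0// -poisED//; last first.
    by move=> k; rewrite lee_fin mulr_ge0.
  apply: le_poisE => // k; first exact: poisE_ge0.
  have [+ _] := poisE_lip ml0 D0 (fun j => h0 (k + j)%N)
     (fun j => hD' k j).
  by rewrite addn0.
Qed.

End poisson_expectation.

(** * Stein's method for the Poisson central limit theorem *)

Section gaussian_stein.
Context {R : realType}.
Local Notation mu := (@lebesgue_measure R).
Variables (sigma : R) (f : R -> R) (C : R).
Hypotheses (s0 : 0 < sigma) (cf : continuous f) (f0C : forall x, 0 <= f x <= C).

Local Notation q := (normal_pdf 0 sigma).

Let sn0 : sigma != 0. Proof. by rewrite gt_eqF. Qed.

Let mf : measurable_fun setT f.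
Proof. exact: continuous_measurable_fun. Qed.

Lemma integral_normal_prob_continuous :
  (\int[normal_prob 0 sigma]_x (f x)%:E = \int[mu]_x (f x * q x)%:E)%E.
Proof.
have ifn : (normal_prob 0 sigma).-integrable setT (EFin \o f).
  apply: (@le_integrable _ _ _ _ _ _ _ (cst C%:E)) => //.
  - exact/measurable_EFinP.
  - move=> x _ /=; rewrite lee_fin; have /andP[f0 fC] := f0C x.
    by rewrite !ger0_norm// (le_trans f0).
  - by apply: finite_measure_integrable_cst.
rewrite -(Radon_Nikodym_change_of_variables (normal_prob_dominates 0 sigma))//=.
under [RHS]eq_integral do rewrite EFinM.
apply: ae_eq_integral => //.
- apply: emeasurable_funM => //; first exact/measurable_EFinP.
  apply: (measurable_int mu).
  apply: (integrableS _ _ (@subsetT _ _)) => //=.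
  by apply: Radon_Nikodym_integrable; exact: normal_prob_dominates.
- apply: emeasurable_funM => //; first exact/measurable_EFinP.
  by apply/measurable_EFinP; exact: measurable_normal_pdf.
- apply: ae_eqe_mul2l => /=.
  apply: integral_ae_eq => //=.
  + by apply: Radon_Nikodym_integrable; exact: normal_prob_dominates.
  + by apply/measurable_EFinP; exact: measurable_normal_pdf.
  + move=> E _ mE; rewrite -Radon_Nikodym_integral//=.
    exact: normal_prob_dominates.
Qed.

Let v := sigma ^+ 2.
Let v0 : 0 < v. Proof. by rewrite exprn_gt0. Qed.
Let w (x : R) := expR (- (x ^+ 2 / (2 * v))).
Let w0 x : 0 < w x. Proof. exact: expR_gt0. Qed.

Let qE : q = (fun x => normal_peak sigma * w x).
Proof.
rewrite normal_pdfE//; apply/funext => x; rewrite /normal_fun /w subr0 mulNr.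
by rewrite -[v *+ 2]mulr_natl.
Qed.

Let peak0 : 0 < normal_peak sigma. Proof. exact: normal_peak_gt0. Qed.

Let dw (x : R) : is_derive x 1 w (- (x / v) * w x).
Proof.
have -> : w = expR \o (fun x => - (2 * v)^-1 * x ^+ 2).
  by apply/funext => y /=; rewrite /w mulrC mulNr.
apply: is_derive_eq.
rewrite /= /GRing.scale/= mulrC; congr (_ * _).
by field; rewrite gt_eqF.
Qed.

Let cw : continuous w.
Proof.
by move=> x; apply: differentiable_continuous; apply/derivable1_diffP; apply: ex_derive.
Qed.

Let iw : mu.-integrable setT (EFin \o w).
Proof.
have -> : EFin \o w = (fun x => ((normal_peak sigma)^-1)%:E * (q x)%:E)%E.
  by apply/funext => x /=; rewrite qE -EFinM mulrA mulVf ?mul1r ?gt_eqF.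
by apply: integrableZl => //; exact: integrable_normal_pdf.
Qed.

Let mw : measurable_fun setT w.
Proof. by move/measurable_int : iw => /measurable_EFinP. Qed.

Let Iw : \int[mu]_x w x = (normal_peak sigma)^-1.
Proof.
have := integral_normal_pdf 0 sigma; rewrite qE.
under eq_integral do rewrite EFinM.
rewrite integralZl//= => /(congr1 fine).
rewrite fineM//= ?integrable_fin_num// => h.
by apply: (mulfI (lt0r_neq0 peak0)); rewrite divff ?gt_eqF.
Qed.

Let tail (x : R) : 0 <= x -> (\int[mu]_(y in `[x, +oo[) (y / v * w y)%:E = (w x)%:E)%E.
Proof.
move=> x0.
have dw' (y : R) : is_derive y 1 (fun z => - w z) (y / v * w y).
  by have := is_deriveN (dw y); rewrite mulNr opprK.
rewrite (@ge0_continuous_FTC2y _ _ (fun y => - w y) x 0).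
- by rewrite sub0e -EFinN opprK.
- move=> y xy; apply: mulr_ge0; last exact: ltW.
  by apply: divr_ge0; [exact: le_trans xy|exact: ltW].
- apply: continuous_subspaceT => y.
  apply: cvgM; last exact: cw.
  by apply: cvgM; [exact: cvg_id|exact: cvg_cst].
- rewrite -oppr0; apply: cvgN.
  apply: (cvg_comp (fun x => x ^+ 2 / (2 * v)) (fun x => expR (- x))).
    apply: gt0_cvgMly; last exact: cvgr_expr2.
    by rewrite invr_gt0 mulr_gt0.
  exact: cvgr_expR.
- by move=> y _; apply: ex_derive.
- by apply: cvg_at_right_filter; apply: cvgN; exact: cw.
- by move=> y _; rewrite derive1E; apply: derive_val.
Qed.

(** Mills' ratio bound: on the tail [1 <= y / x], and [y / v * w y] has the exact primitive
    [- w y]. *)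
Let tail_w (x : R) : 0 < x -> \int[mu]_(y in `[x, +oo[) w y <= v / x * w x.
Proof.
move=> x0.
have h : (\int[mu]_(y in `[x, +oo[) (w y)%:E <= (v / x * w x)%:E)%E.
  rewrite EFinM -(tail (ltW x0)) -ge0_integralZl//=; last 3 first.
  - apply/measurable_EFinP/measurable_funM; last exact: measurable_funTS.
    by apply: measurable_funM => //; exact: measurable_id.
  - move=> y; rewrite in_itv/= andbT => xy.
    rewrite lee_fin; apply: mulr_ge0; last exact: ltW.
    by apply: divr_ge0; [exact: le_trans (ltW x0) xy|exact: ltW].
  - by rewrite lee_fin divr_ge0// ltW.
  apply: ge0_le_integral => //=.
  - by move=> y _; rewrite lee_fin ltW.
  - by apply/measurable_EFinP; exact: measurable_funTS.
  - apply/measurable_EFinP; apply: measurable_funM => //.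
    apply: measurable_funM; last exact: measurable_funTS.
    by apply: measurable_funM => //; exact: measurable_id.
  move=> y; rewrite in_itv/= andbT => xy.
  rewrite -EFinM lee_fin mulrA ler_peMl ?(ltW (w0 _))//.
  have -> : v / x * (y / v) = y / x by field; rewrite !gt_eqF.
  by rewrite ler_pdivlMr// mul1r.
rewrite -lee_fin; apply: le_trans h; rewrite /Rintegral fineK//.
apply: integrable_fin_num => //.
by apply: integrableS iw.
Qed.

Let wN x : w (- x) = w x.
Proof. by rewrite /w sqrrN. Qed.

Let tail_wN (x : R) : 0 < x -> \int[mu]_(y in `]-oo, - x]) w y <= v / x * w x.
Proof.
move=> x0; apply: le_trans (tail_w x0).
rewrite /Rintegral ge0_integration_by_substitutionNy.
- by have -> : w \o -%R = w by apply/funext => y; exact: wN.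
- by apply: continuous_subspaceT; exact: cw.
- by move=> y _; rewrite ltW.
Qed.

Let c := \int[normal_prob 0 sigma]_x f x.

Let cE : c = normal_peak sigma * \int[mu]_x (f x * w x).
Proof.
rewrite /c /Rintegral integral_normal_prob_continuous// qE.
have ifw : mu.-integrable setT (fun x => (f x * w x)%:E).
  apply: (le_integrable measurableT _ _ (integrableZl measurableT C iw)).
  - by apply/measurable_EFinP; exact: measurable_funM.
  - move=> x _ /=; rewrite lee_fin; have /andP[f0 fC] := f0C x.
    rewrite !ger0_norm ?mulr_ge0 ?(ltW (w0 _)) ?(le_trans f0)//.
    by rewrite ler_wpM2r// ltW.
have -> : (fun x => (f x * (normal_peak sigma * w x))%:E) =
    (fun x => (normal_peak sigma)%:E * (f x * w x)%:E)%E.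
  by apply/funext => x; rewrite mulrCA EFinM.
by rewrite integralZl// fineM// integrable_fin_num.
Qed.

Lemma normal_mean_bounds : 0 <= c <= C.
Proof.
have mfn : measurable_fun setT (f : measurableTypeR R -> R) by [].
have ifn : (normal_prob 0 sigma).-integrable setT (EFin \o f).
  apply: (@le_integrable _ _ _ _ _ _ _ (cst C%:E)) => //.
  - exact/measurable_EFinP.
  - move=> x _ /=; rewrite lee_fin; have /andP[f0 fC] := f0C x.
    by rewrite !ger0_norm// (le_trans f0).
  - by apply: finite_measure_integrable_cst.
apply/andP; split; first by apply: Rintegral_ge0 => x _; have /andP[] := f0C x.
have -> : C = \int[normal_prob 0 sigma]_x (cst C x).
  have pT : normal_prob 0 sigma setT = 1%E := probability_setT _.
  by rewrite Rintegral_cst//= pT mulr1.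
apply: le_Rintegral => //.
  by apply: finite_measure_integrable_cst.
by move=> x _; have /andP[] := f0C x.
Qed.

Let k x := (f x - c) * w x.

Let fc x : `|f x - c| <= C.
Proof.
have /andP[a b] := f0C x; have /andP[a' b'] := normal_mean_bounds.
by rewrite ler_norml; apply/andP; split; lra.
Qed.

Let ck : continuous k.
Proof.
by move=> x; apply: cvgM; [apply: cvgB; [exact: cf|exact: cvg_cst]|exact: cw].
Qed.

Let ik : mu.-integrable setT (EFin \o k).
Proof.
apply: (le_integrable measurableT _ _ (integrableZl measurableT C iw)).
  by apply/measurable_EFinP; exact: continuous_measurable_fun.
move=> x _ /=; rewrite lee_fin /k !normrM ler_wpM2r// (le_trans (fc x))//.
exact: ler_norm.
Qed.

Let ifw : mu.-integrable setT (EFin \o (fun x => f x * w x)).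
Proof.
apply: (le_integrable measurableT _ _ (integrableZl measurableT C iw)).
  by apply/measurable_EFinP; exact: measurable_funM.
move=> x _ /=; rewrite lee_fin; have /andP[f0 fC] := f0C x.
rewrite !ger0_norm ?mulr_ge0 ?(ltW (w0 _)) ?(le_trans f0)//.
by rewrite ler_wpM2r// ltW.
Qed.

Let Ik : \int[mu]_x k x = 0.
Proof.
transitivity (\int[mu]_x (f x * w x - c * w x)).
  by apply: eq_Rintegral => x _; rewrite /k mulrBl.
have icw : mu.-integrable setT (EFin \o (fun x => c * w x)).
  by have := integrableZl measurableT c iw; apply: eq_integrable.
rewrite RintegralB//.
rewrite RintegralZl// Iw cE mulrAC divff ?gt_eqF// mul1r subrr//.
Qed.

Let K (x : R) := \int[mu]_(y in `]-oo, x]) k y.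

Let dK (x : R) : is_derive x 1 K (k x).
Proof.
have xx1 : x < x + 1 by rewrite ltrDl.
have ik1 : mu.-integrable `]-oo, x + 1] (EFin \o k) by apply: (integrableS _ _ _ ik).
have [dK EK] := continuous_FTC1 xx1 ik1 (ltNyr _) (@ck x).
apply: DeriveDef; first exact: dK.
by rewrite -derive1E EK.
Qed.

Let bnd (A : set (measurableTypeR R)) : measurable A ->
  `|\int[mu]_(y in A) k y| <= C * \int[mu]_(y in A) w y.
Proof.
move=> mA.
have ikA : mu.-integrable A (EFin \o k) by apply: (integrableS _ _ _ ik).
have iwA : mu.-integrable A (EFin \o w) by apply: (integrableS _ _ _ iw).
apply: le_trans; first exact: le_normr_Rintegral.
rewrite -RintegralZl//; apply: le_Rintegral => //.
- exact: integrable_norm.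
- have := integrableZl mA C iwA; apply: eq_integrable; first exact: mA.
  by move=> y _; rewrite /= EFinM.
- by move=> x _; rewrite /k normrM (ger0_norm (ltW (w0 x))); apply: ler_wpM2r; [exact: ltW|exact: fc].
Qed.

(** Since [k] has total integral zero, [K] can be evaluated from whichever tail is small: the left
    one for [x < 0], the right one for [x > 0]. The bound on [x * stein_sol x] depends on this. *)
Let KN x : K x = - \int[mu]_(y in `]x, +oo[) k y.
Proof.
have U : `]-oo, x]%classic `|` `]x, +oo[%classic = [set: R].
  apply/seteqP; split => // y _ /=; rewrite !in_itv/= andbT.
  by have [yx|yx] := leP y x; [left|right].
apply/eqP; rewrite -addr_eq0 -Rintegral_setU//.
- by rewrite U Ik.
- by rewrite U.
- by apply/disj_setPS => y [/=]; rewrite !in_itv/= andbT leNgt => /negP.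
Qed.

(** The bounded solution of [v * g' - x * g = f - c]: the integrating factor [w] turns the equation
    into [(v * w * g)' = k], and [K] is the primitive of [k] that vanishes at minus infinity. *)
Definition stein_sol x := K x / (v * w x).

Let xg_le x : `|x * stein_sol x| <= C.
Proof.
have C0 : 0 <= C by have /andP[/le_trans]:= f0C 0; apply.
have [x0|x0|->] := ltgtP x 0; last by rewrite mul0r normr0.
- have h : `|K x| <= C * (v / - x * w x).
    apply: (le_trans (bnd _)) => //; rewrite ler_wpM2l//.
    by rewrite -[X in `]-oo, X]]opprK -(wN x) tail_wN// oppr_gt0.
  rewrite /stein_sol normrM normrM normfV (ltr0_norm x0) (gtr0_norm (mulr_gt0 v0 (w0 x))).
  rewrite mulrA ler_pdivrMr ?mulr_gt0//.
  apply: (@le_trans _ _ (- x * (C * (v / - x * w x)))).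
    by rewrite ler_wpM2l// oppr_ge0 ltW.
  by rewrite le_eqVlt; apply/orP; left; apply/eqP; field; rewrite lt_eqF.
- have h : `|K x| <= C * (v / x * w x).
    rewrite KN normrN Rintegral_itv_obnd_cbnd; last by apply: (integrableS _ _ _ ik).
    by apply: (le_trans (bnd _)) => //; rewrite ler_wpM2l// tail_w.
  rewrite /stein_sol normrM normrM normfV (gtr0_norm x0) (gtr0_norm (mulr_gt0 v0 (w0 x))).
  rewrite mulrA ler_pdivrMr ?mulr_gt0//.
  apply: (@le_trans _ _ (x * (C * (v / x * w x)))).
    by rewrite ler_wpM2l// ltW.
  by rewrite le_eqVlt; apply/orP; left; apply/eqP; field; rewrite gt_eqF.
Qed.

(** For [|x| >= 1] this follows from [xg_le]. For [|x| < 1] the numerator is at most [C] times the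
    total mass of [w], the inverse of [normal_peak sigma], and [w x] is at least
    [expR (- (1 / (2 * v)))]. *)
Let g_le x : `|stein_sol x| <= C + C / normal_peak sigma / v * expR (1 / (2 * v)).
Proof.
have C0 : 0 <= C by have /andP[/le_trans]:= f0C 0; apply.
have [x1|x1] := leP 1 `|x|.
  apply: (@le_trans _ _ C); last first.
    by rewrite lerDl !mulr_ge0 ?expR_ge0 ?invr_ge0 ?(ltW peak0) ?(ltW v0).
  by apply: le_trans (xg_le x); rewrite (normrM x) ler_peMl.
apply: (@le_trans _ _ (C / normal_peak sigma / v * expR (1 / (2 * v)))); last by rewrite lerDr.
rewrite /stein_sol normrM normfV (gtr0_norm (mulr_gt0 v0 (w0 x))) invfM mulrA.
have wx : (w x)^-1 <= expR (1 / (2 * v)).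
  have x21 : x ^+ 2 <= 1 by rewrite -[x ^+ 2]real_normK ?num_real// expr_le1// ltW.
  rewrite /w -expRN opprK ler_expR; apply: ler_wpM2r => //.
  by rewrite invr_ge0 mulr_ge0// ltW.
apply: ler_pM => //; rewrite ?divr_ge0 ?invr_ge0 ?(ltW v0) ?(ltW (w0 _))//.
rewrite ler_wpM2r ?invr_ge0 ?(ltW v0)//.
apply: (le_trans (bnd _)) => //; rewrite ler_wpM2l// -Iw.
have iwA : mu.-integrable `]-oo, x] (EFin \o w) by apply: (integrableS _ _ _ iw).
apply: fine_le; [exact: integrable_fin_num|exact: integrable_fin_num|].
apply: ge0_subset_integral => //; first exact/measurable_EFinP.
by move=> y _; rewrite lee_fin ltW.
Qed.

Lemma stein_equation : exists (g : R -> R) (G : R),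
  [/\ forall x : R, is_derive x 1 g ((x * g x + (f x - c)) / v),
      forall x, `|x * g x| <= C, forall x, `|g x| <= G &
      forall x, `|f x - c| <= C].
Proof.
exists stein_sol; eexists; split; [|exact: xg_le|exact: g_le|exact: fc].
move=> x; rewrite /stein_sol.
have wx : v * w x != 0 by rewrite mulf_neq0// gt_eqF.
have v_neq0 : v != 0 by rewrite gt_eqF.
have w_neq0 : w x != 0 by rewrite gt_eqF.
have dvw : is_derive x 1 (fun x => v * w x) (v * (- (x / v) * w x)).
  by have := is_deriveZ v (dw x).
have dv : is_derive x 1 (fun x => (v * w x)^-1) (x / v * (v * w x)^-1).
  have -> : x / v * (v * w x)^-1 = - (v * w x) ^- 2 *: (v * (- (x / v) * w x)).
    move: (w x) w_neq0 {wx dvw} => W W0; rewrite /GRing.scale/=.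
    by field; rewrite v_neq0 W0.
  exact: (@is_deriveV R (fun x => v * w x) x _ 1 wx dvw).
have -> : (x * (K x / (v * w x)) + (f x - c)) / v =
    K x *: (x / v * (v * w x)^-1) + (v * w x)^-1 *: k x.
  rewrite /k /GRing.scale/=.
  by move: (w x) (K x) w_neq0 {wx dvw dv} => W Kx W0; field; rewrite v_neq0 W0.
exact: (is_deriveM (f := K) (g := fun x => (v * w x)^-1) (dK x) dv).
Qed.

End gaussian_stein.

Section poisson_clt.
Context {R : realType}.

(** Stein's method. With [y b] the standardised value, the equation writes [f (y b) - c] as
    [v * g' - y b * g]; the identity [poisS] exchanges the last term for [l / s] times an increment
    of [g]. By the mean value theorem what remains is [v - t] times [g'] plus [t] times a variation
    of [g'] over a step [1 / s], where [t = l / s ^+ 2]. *)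
Lemma poisson_clt_bound (sigma : R) (f : R -> R) (C K : R) :
  0 < sigma -> continuous f -> (forall x, 0 <= f x <= C) ->
  (forall x y, `|f x - f y| <= K * `|x - y|) ->
  exists A : R, forall l s, 0 <= l -> 0 < s ->
    `| fine (poisE l (fun b => (f ((b%:R - l) / s))%:E))
       - \int[normal_prob 0 sigma]_x f x |
    <= A * (`|sigma ^+ 2 - l / s ^+ 2| + l / s ^+ 2 / s * (2 + l / s ^+ 2)).
Proof.
move=> s0 cf f0C lipf.
have [g [G [dg xg_le g_le fc]]] := stein_equation s0 cf f0C.
set c := Rintegral _ _ _ in dg fc *; set v := sigma ^+ 2 in dg *.
have v0 : 0 < v by rewrite exprn_gt0.
have C0 : 0 <= C by have /andP[/le_trans] := f0C 0; apply.
have G0 : 0 <= G by apply: le_trans (g_le 0).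
have K0 : 0 <= K.
  by have := lipf 1 0; rewrite subr0 normr1 mulr1; apply: le_trans.
pose D := (C + C) / v.
have D0 : 0 <= D by rewrite divr_ge0 ?addr_ge0// ltW.
pose g' x := (x * g x + (f x - c)) / v.
have g'D x : `|g' x| <= D.
  rewrite /g' normrM normfV (gtr0_norm v0) ler_wpM2r ?invr_ge0 ?(ltW v0)//.
  by rewrite (le_trans (ler_normD _ _))// lerD.
have cg : continuous g.
  move=> x; apply: differentiable_continuous; apply/derivable1_diffP.
  by have := dg x => -[].
have mvt x h : 0 < h -> exists2 xi, x <= xi <= x + h & g (x + h) - g x = g' xi * h.
  move=> h0.
  have xh : x <= x + h by rewrite lerDl ltW.
  have wc : {within `[x, x + h], continuous g} by apply: continuous_subspaceT => y; exact: cg.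
  have [xi xixh ->] := MVT_segment xh (fun y _ => dg y) wc.
  by exists xi; [move: xixh; rewrite in_itv|congr (_ * _); ring].
(* [f] is only Lipschitz, so [g] need not have a second derivative; the variation of [g'] is read
   off the Stein equation itself. The factor [|x|] is why the first absolute moment [y1] is
   needed. *)
have var_g' x xi h : 0 < h -> x <= xi <= x + h ->
    `|g' x - g' xi| <= (`|x| * D + G + K) * h / v.
  move=> h0 /andP[x_xi xi_xh].
  have xih : `|xi - x| <= h by rewrite ger0_norm ?subr_ge0// lerBlDl.
  have -> : g' x - g' xi = (x * (g x - g xi) + (x - xi) * g xi + (f x - f xi)) / v.
    by rewrite /g'; field; rewrite gt_eqF.
  rewrite normrM normfV (gtr0_norm v0) ler_wpM2r ?invr_ge0 ?(ltW v0)//.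
  have -> : (`|x| * D + G + K) * h = `|x| * (D * h) + h * G + K * h by ring.
  rewrite (le_trans (ler_normD _ _))// lerD//; last first.
    by rewrite (le_trans (lipf _ _))// ler_wpM2l// distrC.
  rewrite (le_trans (ler_normD _ _))// lerD//; last first.
    by rewrite normrM ler_pM// distrC.
  rewrite normrM ler_wpM2l//.
  move: x_xi; rewrite le_eqVlt => /predU1P[->|x_xi].
    by rewrite subrr normr0 mulr_ge0// ltW.
  have xix0 : 0 < xi - x by rewrite subr_gt0.
  have [z _] := mvt x _ xix0; rewrite subrKC distrC => ->.
  by rewrite normrM ler_pM.
exists (D + (D + G + K) / v) => l s l0 s_gt0.
pose y (b : nat) := (b%:R - l) / s.
pose t := l / s ^+ 2.
have t0 : 0 <= t by rewrite divr_ge0// exprn_ge0// ltW.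
have yS b : y b.+1 = y b + s^-1 by rewrite /y -natr1; ring.
pose F b := f (y b) - c.
pose St b := v * g' (y b) - l / s * (g (y b.+1) - g (y b)).
have StE b : `|St b| <= `|v - t| * D + t / s / v * (`|y b| * D + G + K).
  have s10 : 0 < s^-1 by rewrite invr_gt0.
  have [xi xi_b gxi] := mvt (y b) _ s10.
  have -> : St b = (v - t) * g' (y b) + t * (g' (y b) - g' xi).
    rewrite /St yS gxi /t; field; rewrite gt_eqF//.
  apply: (le_trans (ler_normD _ _)); rewrite (normrM (v - t)) (normrM t).
  apply: lerD; first by rewrite ler_wpM2l.
  have -> : t / s / v * (`|y b| * D + G + K) = t * ((`|y b| * D + G + K) / s / v) by ring.
  by rewrite (ger0_norm t0); apply: ler_wpM2l => //; exact: var_g'.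
(* Boundary term of a summation by parts over [b < n]; partial sums are used because the summands
   are signed. It vanishes in the limit, as [g] is bounded and [pois l n] tends to zero. *)
pose A b := b%:R / s * pois l b * g (y b).
have AS n : A n.+1 = l / s * pois l n * g (y n.+1).
  rewrite /A (_ : _ / s * _ = pois l n.+1 * n.+1%:R / s); last by ring.
  by rewrite poisS; ring.
have teleE n : \sum_(0 <= b < n) pois l b * F b = \sum_(0 <= b < n) pois l b * St b + A n.
  elim: n => [|n IH]; first by rewrite !big_nil /A !mul0r addr0.
  rewrite !big_nat_recr//= IH -!addrA; congr (_ + _).
  rewrite AS /A.
  have bE : n%:R / s = y n + l / s by rewrite /y; ring.
  have -> : F n = v * g' (y n) - y n * g (y n).
    by rewrite /g' /F mulrC divfK ?gt_eqF//; ring.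
  by rewrite /St bE; ring.
have y2 n : \sum_(0 <= b < n) pois l b * y b ^+ 2 <= t.
  have := @pois_sum_le_poisE R l (fun k => (k%:R - l) ^+ 2) n l0 (fun=> sqr_ge0 _).
  rewrite poisE_sqr// lee_fin => h.
  rewrite /t ler_pdivlMr ?exprn_gt0// mulr_suml; apply: le_trans h.
  rewrite le_eqVlt; apply/orP; left; apply/eqP; apply: eq_bigr => b _.
  by rewrite /y; field; rewrite gt_eqF.
(* From [|y| <= 1 + y ^+ 2]; the second moment is the Poisson variance divided by [s ^+ 2]. *)
have y1 n : \sum_(0 <= b < n) pois l b * `|y b| <= 1 + t.
  apply: (@le_trans _ _ (\sum_(0 <= b < n) (pois l b + pois l b * y b ^+ 2))).
    apply: ler_sum => b _; rewrite -[X in X + _]mulr1 -mulrDr ler_wpM2l ?pois_ge0//.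
    rewrite -[y b ^+ 2]real_normK ?num_real//.
    have := sqr_ge0 (`|y b| - 1); have := normr_ge0 (y b); nra.
  by rewrite big_split/=; apply: lerD; [exact: pois_sum_le1|exact: y2].
pose B := `|v - t| * D + t / s / v * ((1 + t) * D + G + K).
have Stle n : `|\sum_(0 <= b < n) pois l b * St b| <= B.
  rewrite (le_trans (ler_norm_sum _ _ _))//.
  apply: (@le_trans _ _ (\sum_(0 <= b < n) (pois l b * (`|v - t| * D + t / s / v * (G + K))
     + (pois l b * `|y b|) * (t / s / v * D)))).
    apply: ler_sum => b _; rewrite normrM (ger0_norm (pois_ge0 _ l0)).
    apply: (le_trans (ler_wpM2l (pois_ge0 _ l0) (StE b))).
    by rewrite le_eqVlt; apply/orP; left; apply/eqP; ring.
  rewrite big_split/= -!mulr_suml.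
  have tsv : 0 <= t / s / v by apply: divr_ge0; [apply: divr_ge0 => //; exact: ltW|exact: ltW].
  apply: (@le_trans _ _ (1 * (`|v - t| * D + t / s / v * (G + K))
     + (1 + t) * (t / s / v * D))).
    apply: lerD; apply: ler_wpM2r; rewrite ?y1 ?pois_sum_le1//.
    - by apply: addr_ge0; apply: mulr_ge0 => //; exact: addr_ge0.
    - exact: mulr_ge0.
  by rewrite /B le_eqVlt; apply/orP; left; apply/eqP; ring.
have A0 : A n @[n --> \oo] --> (0 : R).
  rewrite -(cvg_shiftS A).
  apply: norm_cvg0.
  apply: (@squeeze_cvgr _ _ _ _ (fun=> 0) (fun n => l / s * G * pois l n)).
  - apply: nearW => n; rewrite normr_ge0/= AS.
    have lsp : 0 <= l / s * pois l n.
      by apply: mulr_ge0; [apply: divr_ge0 => //; exact: ltW|exact: pois_ge0].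
    by rewrite normrM (ger0_norm lsp) [leRHS]mulrAC; apply: ler_wpM2l.
  - exact: cvg_cst.
  - by rewrite -[X in _ --> X](mulr0 (l / s * G)); apply: cvgMr; exact: cvg_pois0.
have [_ cE] := @poisE_cvg R l (fun b => f (y b)) C l0 (fun=> f0C _).
set E := fine _ in cE *.
have cF : (\sum_(0 <= b < n) pois l b * F b) @[n --> \oo] --> E - c.
  have -> : (fun n => \sum_(0 <= b < n) pois l b * F b) =
      (fun n => \sum_(0 <= b < n) pois l b * f (y b) - c * \sum_(0 <= b < n) pois l b).
    apply/funext => n; rewrite mulr_sumr -sumrB; apply: eq_bigr => b _.
    by rewrite /F; ring.
  rewrite -[X in _ --> _ - X]mulr1; apply: cvgB; first exact: cE.
  by apply: cvgMr; exact: cvg_sum_pois.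
have ub : `|E - c| <= B.
  have : (\sum_(0 <= b < n) pois l b * F b - A n) @[n --> \oo] --> E - c.
    by rewrite -[X in _ --> X]subr0; apply: cvgB.
  move=> /cvg_norm h; apply: (cvgr_to_le h); apply: nearW => n.
  by rewrite teleE addrK.
apply: (le_trans ub); rewrite /B -/t.
have w0 : 0 <= `|v - t| by [].
have z0 : 0 <= t / s by rewrite divr_ge0// ltW.
have q0 : 0 <= (D + G + K) / v by rewrite divr_ge0 ?addr_ge0// ltW.
apply: (@le_trans _ _ (D * `|v - t| + (D + G + K) / v * (t / s * (2 + t)))); last first.
  rewrite (mulrDr (D + _)); apply: lerD; apply: ler_wpM2r; rewrite ?lerDl ?lerDr//.
  by rewrite mulr_ge0// addr_ge0.
rewrite (mulrC D) lerD2l.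
have -> : (D + G + K) / v * (t / s * (2 + t)) = t / s / v * ((D + G + K) * (2 + t)) by ring.
apply: ler_wpM2l; first by apply: divr_ge0; [apply: divr_ge0 => //; exact: ltW|exact: ltW].
nra.
Qed.

Lemma poisson_clt (sigma : R) (f : R -> R) (C K : R) (l s : nat -> R) :
  0 < sigma -> continuous f -> (forall x, 0 <= f x <= C) ->
  (forall x y, `|f x - f y| <= K * `|x - y|) ->
  (forall n, 0 <= l n) -> (\forall n \near \oo, 0 < s n) ->
  (s n)^-1 @[n --> \oo] --> (0 : R) ->
  l n / s n ^+ 2 @[n --> \oo] --> sigma ^+ 2 ->
  fine (poisE (l n) (fun b => (f ((b%:R - l n) / s n))%:E)) @[n --> \oo] -->
    \int[normal_prob 0 sigma]_x f x.
Proof.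
move=> s0 cf f0C lipf l0 sn0 s_cvg ls_cvg.
have [A bA] := poisson_clt_bound s0 cf f0C lipf.
apply/subr_cvg0; apply: norm_cvg0.
apply: (@squeeze_cvgr _ _ _ _ (fun=> 0) (fun n =>
  A * (`|sigma ^+ 2 - l n / s n ^+ 2| + l n / s n ^+ 2 / s n * (2 + l n / s n ^+ 2)))).
- by near=> n; rewrite normr_ge0/= bA//; near: n.
- exact: cvg_cst.
- rewrite -[X in _ --> X](mulr0 A); apply: cvgMr.
  rewrite -[X in _ --> X]addr0; apply: cvgD.
    rewrite -[X in _ --> X](normr0 R); apply: cvg_norm.
    by rewrite -(subrr (sigma ^+ 2)); apply: cvgB => //; exact: cvg_cst.
  rewrite -[X in _ --> X](mul0r (2 + sigma ^+ 2)); apply: cvgM.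
    by rewrite -(mulr0 (sigma ^+ 2)); apply: cvgM.
  by apply: cvgD => //; exact: cvg_cst.
Unshelve. all: by end_near. Qed.

End poisson_clt.

(** * Sums of conditionally Poisson counts *)

Section fibers.
Context {R : realType} d {Omega : measurableType d} (P : {measure set Omega -> \bar R}).
Local Open Scope ereal_scope.

Lemma integral_fibers (E : set Omega) (X : Omega -> nat) (F : nat -> Omega -> \bar R) :
  measurable E -> (forall a, measurable [set w | X w = a]) ->
  (forall a, measurable_fun setT (F a)) -> (forall a w, 0 <= F a w) ->
  \int[P]_(w in E) F (X w) w =
  \sum_(0 <= a <oo) \int[P]_(w in E `&` [set w | X w = a]) F a w.
Proof.
move=> mE mX mF F0.
have EE : E = \bigcup_a (E `&` [set w | X w = a]).
  apply/seteqP; split=> [w Ew|w [a _ []]//]; by exists (X w).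
have mEX a : measurable (E `&` [set w | X w = a]) by exact: measurableI.
have mFX : measurable_fun setT (fun w => F (X w) w).
  move=> _ U mU; rewrite setTI.
  rewrite (_ : _ @^-1` _ = \bigcup_a ([set w | X w = a] `&` (F a @^-1` U))).
    apply: bigcup_measurable => a _; apply: measurableI => //.
    by rewrite -[X in measurable X]setTI; exact: mF.
  apply/seteqP; split=> [w /= UF|w [a _ [/= <-]]//]; by exists (X w).
rewrite {1}EE ge0_integral_bigcup//; last 2 first.
- exact: measurable_funTS.
- by move=> i j _ _ [w [[_ <-] [_ <-]]].
apply: eq_eseriesr => a _; apply: eq_integral => w.
by rewrite inE => -[_ /= ->].
Qed.

End fibers.

Section cond_poisson.
Context {R : realType} d {Omega : measurableType d} (P : probability Omega R).
Variables (N : nat -> Omega -> nat) (Lam : nat -> Omega -> R).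
Hypotheses (mN : forall i a, measurable [set w | N i w = a])
  (mLam : forall i, measurable_fun setT (Lam i)) (Lam0 : forall i w, 0 <= Lam i w).

Definition partial_count n (w : Omega) : nat := (\sum_(i < n) N i w)%N.

Local Notation L := partial_count.

(** The past enters through [L n], the argument of the test function, and through an earlier [L m],
    the argument of the mixing weight; conditioning on these two values is what the interpolation
    uses. *)
Hypothesis cond : forall m n v1 v2 b, (m <= n)%N ->
  P ([set w | L m w = v1] `&` [set w | L n w = v2] `&` [set w | N n w = b]) =
  (\int[P]_(w in [set w | L m w = v1] `&` [set w | L n w = v2]) (pois (Lam n w) b)%:E)%E.

Lemma partial_countS n w : L n.+1 w = (L n w + N n w)%N.
Proof. by rewrite /partial_count big_ord_recr. Qed.

Lemma measurable_partial_count n a : measurable [set w | L n w = a].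
Proof.
elim: n a => [|n IH] a.
  have [->|a0] := eqVneq a 0%N.
    by rewrite (_ : [set _ | _] = setT)//; apply/seteqP; split=> // w _ /=; rewrite /partial_count big_ord0.
  rewrite (_ : [set _ | _] = set0)//; apply/seteqP; split=> // w /=.
  by rewrite /partial_count big_ord0 => /eqP; rewrite eq_sym (negbTE a0).
rewrite (_ : [set _ | _] = \bigcup_b ([set w | L n w = b] `&`
    \bigcup_(k in [set k | (b + k)%N = a]) [set w | N n w = k])).
  apply: bigcup_measurable => b _; apply: measurableI => //.
  by apply: bigcup_measurable.
apply/seteqP; split=> w /=; rewrite partial_countS.
  by move=> <-; exists (L n w) => //; split=> //; exists (N n w).
by move=> [b _ [-> [k /= bk ->]]].
Qed.

Local Open Scope ereal_scope.

Lemma measurable_poisE (h : nat -> \bar R) (l : Omega -> R) :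
  measurable_fun setT l -> (forall w, 0 <= l w)%R -> (forall k, 0 <= h k) ->
  measurable_fun setT (fun w => poisE (l w) h).
Proof.
move=> ml l0 h0; apply: ge0_emeasurable_sum => k.
  by move=> w _ _; rewrite mule_ge0// lee_fin pois_ge0.
move=> _; apply: emeasurable_funM; last exact: measurable_cst.
by apply/measurable_EFinP; exact: (measurableT_comp (measurable_pois k)).
Qed.

Lemma measurable_comp_nat (X : Omega -> nat) (h : nat -> \bar R) :
  (forall a, measurable [set w | X w = a]) -> measurable_fun setT (fun w => h (X w)).
Proof.
move=> mX _ U mU; rewrite setTI.
rewrite (_ : _ @^-1` _ = \bigcup_(a in h @^-1` U) [set w | X w = a]).
  by apply: bigcup_measurable.
apply/seteqP; split=> [w /= UX|w [a /= Ua Xa]]; last by rewrite /= Xa.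
by exists (X w).
Qed.

Lemma measurable_poisE_shift (Y : Omega -> nat) (h : nat -> \bar R) (l : Omega -> R) :
  (forall a, measurable [set w | Y w = a]) ->
  measurable_fun setT l -> (forall w, 0 <= l w)%R -> (forall k, 0 <= h k) ->
  measurable_fun setT (fun w => poisE (l w) (fun b => h (Y w + b)%N)).
Proof.
move=> mY ml l0 h0; apply: ge0_emeasurable_sum => k.
  by move=> w _ _; rewrite mule_ge0 ?lee_fin ?pois_ge0.
move=> _; apply: emeasurable_funM; last first.
  exact: (@measurable_comp_nat Y (fun b => h (b + k)%N)).
by apply/measurable_EFinP; exact: (measurableT_comp (measurable_pois k)).
Qed.

(** Disintegrating over the values of [L m], [L n] and [N n] reduces the claim to [cond]; the sum
    over the values of [N n] is then moved back under the integral, where it is a Poisson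
    expectation with random rate. *)
Lemma cond_poisson_integral m n (phi : nat -> R) (h : nat -> \bar R) : (m <= n)%N ->
  (forall k, 0 <= phi k)%R -> (forall k, 0 <= h k) ->
  \int[P]_w ((phi (L m w))%:E * h (L n.+1 w)) =
  \int[P]_w ((phi (L m w))%:E * poisE (Lam n w) (fun b => h (L n w + b)%N)).
Proof.
move=> mn phi0 h0; have mL := measurable_partial_count.
have h0' a k : 0 <= h (a + k)%N by [].
have mpE a : measurable_fun setT (fun w => poisE (Lam n w) (fun b => h (a + b)%N)).
  exact: measurable_poisE.
have pE0 a w : 0 <= poisE (Lam n w) (fun b => h (a + b)%N) by exact: poisE_ge0.
have mhN a : measurable_fun setT (fun w => h (a + N n w)%N).
  exact: (@measurable_comp_nat (N n) (fun b => h (a + b)%N)).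
rewrite (@integral_fibers _ _ _ P setT (L m) (fun v w => (phi v)%:E * h (L n.+1 w)))//; last 2 first.
- by move=> a; apply: emeasurable_funM => //; apply: measurable_comp_nat.
- by move=> a w; rewrite mule_ge0 ?lee_fin.
rewrite (@integral_fibers _ _ _ P setT (L m) (fun v w =>
    (phi v)%:E * poisE (Lam n w) (fun b => h (L n w + b)%N)))//; last 2 first.
- by move=> a; apply: emeasurable_funM => //; exact: measurable_poisE_shift.
- by move=> a w; rewrite mule_ge0 ?lee_fin.
apply: eq_eseriesr => v _; rewrite setTI.
have mLv : measurable [set w | L m w = v] by exact: mL.
rewrite (_ : (fun w => (phi v)%:E * h (L n.+1 w)) = (fun w => (phi v)%:E * h (L n w + N n w)%N)); last first.
  by apply/funext => w; rewrite partial_countS.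
rewrite (@integral_fibers _ _ _ P _ (L n) (fun u w => (phi v)%:E * h (u + N n w)%N))//; last 2 first.
- by move=> a; apply: emeasurable_funM.
- by move=> a w; rewrite mule_ge0 ?lee_fin.
rewrite (@integral_fibers _ _ _ P _ (L n) (fun u w =>
    (phi v)%:E * poisE (Lam n w) (fun b => h (u + b)%N)))//; last 2 first.
- by move=> a; apply: emeasurable_funM.
- by move=> a w; rewrite mule_ge0 ?lee_fin.
apply: eq_eseriesr => u _.
set E := _ `&` _; have mE : measurable E by apply: measurableI => //; exact: mL.
rewrite (@integral_fibers _ _ _ P _ (N n) (fun b w => (phi v)%:E * h (u + b)%N))//; last first.
  by move=> a w; rewrite mule_ge0 ?lee_fin.
transitivity (\sum_(0 <= b <oo) \int[P]_(w in E) (((phi v)%:E * h (u + b)%N) * (pois (Lam n w) b)%:E)).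
  apply: eq_eseriesr => b _.
  transitivity (((phi v)%:E * h (u + b)%N) * P (E `&` [set w | N n w = b])).
    by rewrite integral_cst//; exact: measurableI.
  rewrite (cond v u b mn) -/E -ge0_integralZl//.
  - by apply/measurable_EFinP/measurable_funTS; exact: (measurableT_comp (measurable_pois b)).
  - by move=> w _; rewrite lee_fin pois_ge0.
  - by rewrite mule_ge0 ?lee_fin.
rewrite -integral_nneseries//; last 2 first.
- move=> b; apply: emeasurable_funM => //.
  by apply/measurable_EFinP/measurable_funTS; exact: (measurableT_comp (measurable_pois b)).
- by move=> b w _; rewrite !mule_ge0 ?lee_fin ?pois_ge0.
apply: eq_integral => w _; rewrite /poisE -nneseriesZl; last first.
  by move=> b _; rewrite mule_ge0 ?lee_fin ?pois_ge0.
by apply: eq_eseriesr => b _; rewrite -muleA [X in _ * X]muleC.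
Qed.

Lemma integral_poisE_rate (X Y : Omega -> nat) (phi h : nat -> R) (l1 l2 : Omega -> R) (D : R) :
  (forall a, measurable [set w | X w = a]) -> (forall a, measurable [set w | Y w = a]) ->
  measurable_fun setT l1 -> (forall w, 0 <= l1 w)%R ->
  measurable_fun setT l2 -> (forall w, 0 <= l2 w)%R ->
  (forall k, 0 <= phi k <= 1)%R -> (forall k, 0 <= h k)%R -> (0 <= D)%R ->
  (forall k, `|h k.+1 - h k| <= D)%R ->
  \int[P]_w ((phi (X w))%:E * poisE (l1 w) (fun b => (h (Y w + b)%N)%:E)) <=
  \int[P]_w ((phi (X w))%:E * poisE (l2 w) (fun b => (h (Y w + b)%N)%:E)) +
  D%:E * \int[P]_w `|l1 w - l2 w|%:E.
Proof.
move=> mX mY ml1 l10 ml2 l20 phi01 h0 D0 hD.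
have phi0 k : (0 <= phi k)%R by have /andP[] := phi01 k.
have hE k : 0 <= (h k)%:E by rewrite lee_fin.
have mphi : measurable_fun setT (fun w => (phi (X w))%:E).
  exact: (@measurable_comp_nat X (fun k => (phi k)%:E)).
have mp1 := @measurable_poisE_shift Y (fun k => (h k)%:E) l1 mY ml1 l10 hE.
have mp2 := @measurable_poisE_shift Y (fun k => (h k)%:E) l2 mY ml2 l20 hE.
have ml12 : measurable_fun setT (fun w => `|l1 w - l2 w|%:E).
  by apply/measurable_EFinP; apply: measurableT_comp => //; exact: measurable_funB.
have p1 w : 0 <= poisE (l1 w) (fun b => (h (Y w + b)%N)%:E) by exact: poisE_ge0.
have p2 w : 0 <= poisE (l2 w) (fun b => (h (Y w + b)%N)%:E) by exact: poisE_ge0.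
rewrite -ge0_integralZl// -ge0_integralD//; last 4 first.
- by move=> w _; rewrite mule_ge0 ?lee_fin.
- exact: emeasurable_funM.
- by move=> w _; rewrite mule_ge0 ?lee_fin.
- exact: emeasurable_funM.
apply: ge0_le_integral => //.
- by move=> w _; rewrite mule_ge0 ?lee_fin.
- exact: emeasurable_funM.
- by apply: emeasurable_funD; exact: emeasurable_funM.
move=> w _; have /andP[f0 f1] := phi01 (X w).
apply: (@le_trans _ _ ((phi (X w))%:E * (poisE (l2 w) (fun b => (h (Y w + b)%N)%:E) +
    (D * `|l1 w - l2 w|)%:E))).
  apply: lee_wpmul2l; first by rewrite lee_fin.
  apply: (@poisE_rate _ _ _ (fun b => h (Y w + b)%N)) => // k.
  by rewrite addnS.
rewrite ge0_muleDr//; last by rewrite lee_fin mulr_ge0.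
by rewrite leeD2l// -!EFinM lee_fin ler_piMl// mulr_ge0.
Qed.

(* The random rates are replaced by [lam] one at a time: the error of each step is Lipschitz in the
   rate, since Poisson expectations form a semigroup. *)
Lemma telescoping (lam e : nat -> R) m n (phi h : nat -> R) (D : R) :
  (forall i, 0 <= lam i)%R ->
  (forall i, \int[P]_w `|Lam i w - lam i|%:E <= (e i)%:E) ->
  (m <= n)%N -> (forall k, 0 <= phi k <= 1)%R -> (forall k, 0 <= h k)%R -> (0 <= D)%R ->
  (forall k, `|h k.+1 - h k| <= D)%R ->
  let A j := \int[P]_w ((phi (L m w))%:E *
      poisE (\sum_(j <= k < n) lam k)%R (fun b => (h (L j w + b)%N)%:E)) in
  A n <= A m + (D * \sum_(m <= k < n) e k)%:E /\
  A m <= A n + (D * \sum_(m <= k < n) e k)%:E.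
Proof.
move=> lam0 he mn phi01 h0 D0 hD A; have mL := measurable_partial_count.
have hE k : 0 <= (h k)%:E by rewrite lee_fin.
have phi0 k : (0 <= phi k)%R by have /andP[] := phi01 k.
have mu0 j : (0 <= \sum_(j <= k < n) lam k)%R by exact: sumr_ge0.
have step j : (m <= j)%N -> (j < n)%N ->
    A j.+1 <= A j + (D * e j)%:E /\ A j <= A j.+1 + (D * e j)%:E.
  (* The steps after [j] already have the deterministic total rate [mu]. The hybrid expectations at
     [j] and [j.+1] therefore differ only in whether step [j] runs at [lam j] or at [Lam j w]. *)
  move=> mj jn; pose mu := (\sum_(j.+1 <= k < n) lam k)%R.
  have -> : A j = \int[P]_w ((phi (L m w))%:E *
      poisE (lam j + mu) (fun b => (h (L j w + b)%N)%:E)).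
    by rewrite /A big_ltn.
  have -> : A j.+1 = \int[P]_w ((phi (L m w))%:E *
      poisE (Lam j w + mu) (fun b => (h (L j w + b)%N)%:E)).
    rewrite /A -/mu (@cond_poisson_integral m j phi
      (fun x => poisE mu (fun b => (h (x + b)%N)%:E)))//; last first.
      by move=> k; apply: poisE_ge0 => //; exact: mu0.
    apply: eq_integral => w _; congr (_ * _).
    rewrite -poisE_semigroup//; last exact: mu0.
    congr poisE; apply/funext => a; congr poisE; apply/funext => b.
    by rewrite addnA.
  have me : D%:E * \int[P]_w `|(Lam j w + mu) - (lam j + mu)|%:E <= (D * e j)%:E.
    rewrite EFinM; apply: lee_wpmul2l; first by rewrite lee_fin.
    apply: le_trans (he j); rewrite le_eqVlt; apply/orP; left; apply/eqP.
    by apply: eq_integral => w _; congr EFin; congr `|_|%R; ring.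
  have me' : D%:E * \int[P]_w `|(lam j + mu) - (Lam j w + mu)|%:E <= (D * e j)%:E.
    rewrite EFinM; apply: lee_wpmul2l; first by rewrite lee_fin.
    apply: le_trans (he j); rewrite le_eqVlt; apply/orP; left; apply/eqP.
    by apply: eq_integral => w _; congr EFin; rewrite distrC; congr `|_|%R; ring.
  have m1 : measurable_fun setT (fun w => Lam j w + mu)%R by exact: measurable_funD.
  have g1 w : (0 <= Lam j w + mu)%R by rewrite addr_ge0//; exact: mu0.
  have g2 : (0 <= lam j + mu)%R by rewrite addr_ge0//; exact: mu0.
  split.
    apply: (le_trans (@integral_poisE_rate (L m) (L j) phi h _ (fun=> (lam j + mu)%R) D
      (mL m) (mL j) m1 g1 _ (fun=> g2) phi01 h0 D0 hD)) => //.
    exact: leeD2l.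
  apply: (le_trans (@integral_poisE_rate (L m) (L j) phi h (fun=> (lam j + mu)%R) _ D
      (mL m) (mL j) _ (fun=> g2) m1 g1 phi01 h0 D0 hD)) => //.
  exact: leeD2l.
have main i : (m + i <= n)%N ->
    A (m + i)%N <= A m + (D * \sum_(m <= k < m + i) e k)%:E /\
    A m <= A (m + i)%N + (D * \sum_(m <= k < m + i) e k)%:E.
  elim: i => [|i IH] min.
    by rewrite addn0 big_geq// mulr0 adde0.
  rewrite addnS in min *; have [a1 a2] := IH (ltnW min).
  have [b1 b2] := step (m + i)%N (leq_addr _ _) min.
  rewrite big_nat_recr ?leq_addr//= mulrDr EFinD; split.
    by rewrite addeA; apply: (le_trans b1); exact: leeD2r.
  by rewrite [_%:E + _]addeC addeA; apply: (le_trans a2); exact: leeD2r.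
by have := main (n - m)%N; rewrite subnKC//; exact.
Qed.

End cond_poisson.

Section poisson_extra.
Context {R : realType}.
Implicit Types (l : R) (h : nat -> R).
Local Open Scope ereal_scope.

Lemma poisE_rate0 (f : nat -> \bar R) : (forall k, 0 <= f k) -> poisE 0 f = f 0%N.
Proof.
move=> f0; rewrite /poisE nneseries_recl//; last first.
  by move=> k _; rewrite mule_ge0// lee_fin pois_ge0.
rewrite eseries0 ?adde0; last first.
  by move=> [|k]// _ _; rewrite /pois exprS mul0r mulr0 mul0r mul0e.
by rewrite /pois oppr0 expR0 expr0 fact0 !mul1r invr1 mul1e.
Qed.

Lemma poisE_bounded l h (C : R) : (0 <= l)%R -> (forall k, 0 <= h k <= C)%R ->
  0 <= poisE l (fun k => (h k)%:E) <= C%:E.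
Proof.
move=> l0 h0C.
have C0 : (0 <= C)%R by have /andP[/le_trans a /a] := h0C 0%N.
apply/andP; split; first by apply: poisE_ge0 => // k; have /andP[] := h0C k.
rewrite -(poisE_cst l0 C0); apply: le_poisE => // k; have /andP[? ?] := h0C k;
  by rewrite lee_fin.
Qed.

(** Two perturbations of [poisson_clt] are absorbed, both of smaller order than [s n] and thus
    harmless for a Lipschitz [f]: the fixed starting value [x], and centring at
    [sigma ^+ 2 * s n ^+ 2] instead of at the mean [mu n]. *)
Lemma poisE_shift_cvg (sigma : R) (f : R -> R) (C K : R) (mu s : nat -> R) (x : nat) :
  (0 < sigma)%R -> continuous f -> (forall x, 0 <= f x <= C)%R ->
  (forall x y, `|f x - f y| <= K * `|x - y|)%R ->
  (forall n, 0 <= mu n)%R -> (\forall n \near \oo, 0 < s n)%R ->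
  ((s n)^-1)%R @[n --> \oo] --> (0%R : R) ->
  ((mu n - sigma ^+ 2 * s n ^+ 2) / s n)%R @[n --> \oo] --> (0%R : R) ->
  poisE (mu n) (fun b => (f (((x + b)%:R - sigma ^+ 2 * s n ^+ 2) / s n))%:E) @[n --> \oo] -->
    (\int[normal_prob 0 sigma]_x f x)%R%:E.
Proof.
move=> s0 cf f0C lipf mu0 sn0 s_cvg mus_cvg.
have mu2 : (mu n / s n ^+ 2)%R @[n --> \oo] --> (sigma ^+ 2)%R.
  have : ((mu n - sigma ^+ 2 * s n ^+ 2) / s n * (s n)^-1 + sigma ^+ 2)%R @[n --> \oo]
      --> (0 * 0 + sigma ^+ 2)%R.
    by apply: cvgD; [exact: cvgM|exact: cvg_cst].
  rewrite mulr0 add0r; apply: cvg_trans; apply: near_eq_cvg; near=> n.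
  have snp : (0 < s n)%R by near: n.
  by field; rewrite gt_eqF.
have clt := poisson_clt s0 cf f0C lipf mu0 sn0 s_cvg mu2.
have K0 : (0 <= K)%R.
  by have := lipf 1%R 0%R; rewrite subr0 normr1 mulr1; apply: le_trans.
have f0C' (y : nat -> R) b : (0 <= f (y b) <= C)%R by [].
pose G n := poisE (mu n) (fun b => (f ((b%:R - mu n) / s n))%:E).
pose H n := poisE (mu n) (fun b => (f (((x + b)%:R - sigma ^+ 2 * s n ^+ 2) / s n))%:E).
have Gfin n : G n \is a fin_num.
  have /andP[a b] := poisE_bounded (mu0 n) (f0C' (fun b => (b%:R - mu n) / s n)%R).
  by rewrite ge0_fin_numE// (le_lt_trans b)// ltry.
have Hfin n : H n \is a fin_num.
  have /andP[a b] := poisE_bounded (mu0 n)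
    (f0C' (fun b => ((x + b)%:R - sigma ^+ 2 * s n ^+ 2) / s n)%R).
  by rewrite ge0_fin_numE// (le_lt_trans b)// ltry.
apply/fine_cvgP; split; first by near=> n; exact: Hfin.
rewrite -[X in _ --> X]addr0.
have -> : fine \o H = (fun n => fine (G n) + (fine (H n) - fine (G n)))%R.
  by apply/funext => n /=; rewrite subrKC.
apply: cvgD; first exact: clt.
apply: norm_cvg0.
apply: (@squeeze_cvgr _ _ _ _ (fun=> 0%R)
  (fun n => K * `|x%:R / s n + (mu n - sigma ^+ 2 * s n ^+ 2) / s n|)%R).
- near=> n; rewrite normr_ge0/=.
  have snp : (0 < s n)%R by near: n.
  set del := (K * _)%R.
  have del0 : (0 <= del)%R by rewrite mulr_ge0.
  have dle b : (`|f (((x + b)%:R - sigma ^+ 2 * s n ^+ 2) / s n) - f ((b%:R - mu n) / s n)| <= del)%R.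
    apply: (le_trans (lipf _ _)); rewrite /del le_eqVlt; apply/orP; left; apply/eqP.
    by congr (_ * `|_|)%R; rewrite natrD; field; rewrite gt_eqF.
  have d1 : H n <= G n + del%:E.
    rewrite -[X in _ + X](poisE_cst (mu0 n) del0) -poisED//.
      apply: le_poisE => // b; have /andP[? _] := f0C' (fun b => (((x + b)%:R - sigma ^+ 2 * s n ^+ 2) / s n)%R) b.
        by rewrite lee_fin.
      rewrite -EFinD lee_fin -lerBlDl.
      by apply: le_trans (dle b); exact: ler_norm.
    by move=> b; have /andP[? _] := f0C' (fun b => ((b%:R - mu n) / s n)%R) b; rewrite lee_fin.
  have d2 : G n <= H n + del%:E.
    rewrite -[X in _ + X](poisE_cst (mu0 n) del0) -poisED//.
      apply: le_poisE => // b; have /andP[? _] := f0C' (fun b => ((b%:R - mu n) / s n)%R) b.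
        by rewrite lee_fin.
      rewrite -EFinD lee_fin -lerBlDl.
      by apply: le_trans (dle b); rewrite distrC; exact: ler_norm.
    by move=> b; have /andP[? _] := f0C' (fun b => (((x + b)%:R - sigma ^+ 2 * s n ^+ 2) / s n)%R) b; rewrite lee_fin.
  move: d1 d2; rewrite -(fineK (Hfin n)) -(fineK (Gfin n)) -!EFinD !lee_fin => d1 d2.
  by rewrite ler_norml; apply/andP; split; lra.
- exact: cvg_cst.
- rewrite -[X in _ --> X](mulr0 K); apply: cvgMr.
  rewrite -[X in _ --> X](normr0 R); apply: cvg_norm.
  rewrite -[X in _ --> X]addr0; apply: cvgD => //.
  by rewrite -(mulr0 (x%:R : R)); apply: cvgMr.
Unshelve. all: by end_near. Qed.

End poisson_extra.

Section mixing_limit.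
Context {R : realType} d {Omega : measurableType d} (P : probability Omega R).
Variables (N : nat -> Omega -> nat) (Lam : nat -> Omega -> R).
Hypotheses (mN : forall i a, measurable [set w | N i w = a])
  (mLam : forall i, measurable_fun setT (Lam i)) (Lam0 : forall i w, 0 <= Lam i w).

Local Notation L := (partial_count N).

Hypothesis cond : forall m n v1 v2 b, (m <= n)%N ->
  P ([set w | L m w = v1] `&` [set w | L n w = v2] `&` [set w | N n w = b]) =
  (\int[P]_(w in [set w | L m w = v1] `&` [set w | L n w = v2]) (pois (Lam n w) b)%:E)%E.

Variables (sigma : R) (lam e s : nat -> R).
Hypotheses (s0 : 0 < sigma) (lam0 : forall i, 0 <= lam i)
  (he : forall i, (\int[P]_w `|Lam i w - lam i|%:E <= (e i)%:E)%E)
  (sn0 : \forall n \near \oo, 0 < s n)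
  (s_cvg : (s n)^-1 @[n --> \oo] --> (0%R : R))
  (e_cvg : (\sum_(0 <= k < n) e k) / s n @[n --> \oo] --> (0%R : R))
  (lam_cvg : (\sum_(0 <= k < n) lam k - sigma ^+ 2 * s n ^+ 2) / s n @[n --> \oo] --> (0%R : R)).

(** For [s n] the square root of [a_n] and [sigma ^+ 2] the limit variance, this is the statistic of
    the theorem with the outer factor multiplied out. *)
Definition std_count n w := ((L n w)%:R - sigma ^+ 2 * s n ^+ 2) / s n.

Let e0 i : 0 <= e i.
Proof.
by rewrite -lee_fin; apply: le_trans (he i); apply: integral_ge0 => w _; rewrite lee_fin.
Qed.

Lemma measurable_natfun (X : Omega -> nat) (h : nat -> R) :
  (forall a, measurable [set w | X w = a]) -> measurable_fun setT (fun w => h (X w)).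
Proof.
by move=> mX; apply/measurable_EFinP; exact: (measurable_comp_nat (fun k => (h k)%:E) mX).
Qed.

Local Open Scope ereal_scope.

(** [T n] is the true expectation; in [B n] the process is true up to time [m] and runs at
    deterministic rates afterwards, so that the Poisson limit theorem applies for each value of
    [L m]. [telescoping] bounds their distance by [K / s n] times the sum of the errors [e k], which
    tends to zero by [e_cvg]. *)
Lemma std_count_mixing (f : R -> R) (C K : R) (m : nat) (phi : nat -> R) :
  continuous f -> (forall x, 0 <= f x <= C)%R ->
  (forall x y, `|f x - f y| <= K * `|x - y|)%R ->
  (forall k, 0 <= phi k <= 1)%R ->
  \int[P]_w (phi (L m w) * f (std_count n w))%:E @[n --> \oo] -->
  \int[P]_w (phi (L m w) * (\int[normal_prob 0 sigma]_x f x)%R)%:E.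
Proof.
move=> cf f0C lipf phi01; have mL := measurable_partial_count mN.
have K0 : (0 <= K)%R.
  by have := lipf 1%R 0%R; rewrite subr0 normr1 mulr1; apply: le_trans.
have f0 x : (0 <= f x)%R by have /andP[] := f0C x.
have fC x : (f x <= C)%R by have /andP[] := f0C x.
have phi0 k : (0 <= phi k)%R by have /andP[] := phi01 k.
pose mu n := (\sum_(m <= k < n) lam k)%R.
have mu0 n : (0 <= mu n)%R by exact: sumr_ge0.
pose h (n x : nat) := f ((x%:R - sigma ^+ 2 * s n ^+ 2) / s n)%R.
pose B n := \int[P]_w ((phi (L m w))%:E * poisE (mu n) (fun b => (h n (L m w + b)%N)%:E)).
have mphi : measurable_fun setT (fun w => (phi (L m w))%:E).
  by apply/measurable_EFinP; exact: measurable_natfun.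
have mB n : measurable_fun setT
    (fun w => (phi (L m w))%:E * poisE (mu n) (fun b => (h n (L m w + b)%N)%:E)).
  apply: emeasurable_funM => //.
  apply: (@measurable_poisE_shift _ _ _ (L m) (fun k => (h n k)%:E) (fun=> mu n)) => //.
  by move=> k; rewrite lee_fin /h.
have Bcvg : B n @[n --> \oo] --> \int[P]_w (phi (L m w) * (\int[normal_prob 0 sigma]_x f x)%R)%:E.
  have mus_cvg : ((mu n - sigma ^+ 2 * s n ^+ 2) / s n)%R @[n --> \oo] --> (0%R : R).
    have : ((\sum_(0 <= k < n) lam k - sigma ^+ 2 * s n ^+ 2) / s n -
        (\sum_(0 <= k < m) lam k) / s n)%R @[n --> \oo] --> (0 - (\sum_(0 <= k < m) lam k) * 0)%R.
      by apply: cvgB => //; apply: cvgMr.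
    rewrite mulr0 subr0; apply: cvg_trans; apply: near_eq_cvg; near=> n.
    have mn : (m <= n)%N by near: n; exact: nbhs_infty_ge.
    have -> : (\sum_(0 <= k < n) lam k = \sum_(0 <= k < m) lam k + mu n)%R.
      exact: big_cat_nat.
    by ring.
  have mlim : measurable_fun setT
      (fun w => (phi (L m w) * (\int[normal_prob 0 sigma]_x f x)%R)%:E).
    by apply/measurable_EFinP; apply: measurable_funM => //; exact: measurable_natfun.
  have iC : P.-integrable setT (cst C%:E) by exact: finite_measure_integrable_cst.
  have [||_ _] := dominated_convergence measurableT mB mlim _ iC _; last exact.
    apply: aeW => w _; rewrite EFinM; apply: cvgeZl => //.
    have := @poisE_shift_cvg _ _ _ _ _ _ _ (L m w) s0 cf f0C lipf mu0 sn0 s_cvg mus_cvg.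
    exact.
  apply: aeW => w n _; have /andP[p0 p1] := phi01 (L m w).
  have /andP[q0 qC] := @poisE_bounded _ (mu n) (fun b => h n (L m w + b)%N) C (mu0 n) (fun=> f0C _).
  rewrite gee0_abs; last by rewrite mule_ge0.
  by apply: le_trans qC; rewrite gee_pMl// ge0_fin_numE// (le_lt_trans qC)// ltry.
pose T n := \int[P]_w (phi (L m w) * f (std_count n w))%:E.
have bdd (g : Omega -> \bar R) : measurable_fun setT g -> (forall w, 0 <= g w <= C%:E) ->
    0 <= \int[P]_w g w <= C%:E.
  move=> mg g0C; apply/andP; split.
    by apply: integral_ge0 => w _; have /andP[] := g0C w.
  have -> : C%:E = \int[P]_w (cst C%:E w).
    have pT : P setT = 1 := probability_setT P.
    by rewrite integral_cst//= pT mule1.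
  by apply: ge0_le_integral => // w _; have /andP[] := g0C w.
have Bb n : 0 <= B n <= C%:E.
  apply: bdd; first exact: mB.
  move=> w; have /andP[p0 p1] := phi01 (L m w).
  have /andP[q0 qC] := @poisE_bounded _ (mu n) (fun b => h n (L m w + b)%N) C (mu0 n) (fun=> f0C _).
  rewrite mule_ge0//=.
  by apply: le_trans qC; rewrite gee_pMl// ge0_fin_numE// (le_lt_trans qC)// ltry.
have Tb n : 0 <= T n <= C%:E.
  apply: bdd.
    apply/measurable_EFinP; apply: measurable_funM; first exact: measurable_natfun.
    exact: (@measurable_natfun (L n) (h n)).
  move=> w; have /andP[p0 p1] := phi01 (L m w); rewrite !lee_fin mulr_ge0//=.
  by apply: (@le_trans _ _ (f (std_count n w))) => //; rewrite ler_piMl.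
have Bfin n : B n \is a fin_num.
  by have /andP[a b] := Bb n; rewrite ge0_fin_numE// (le_lt_trans b)// ltry.
have Tfin n : T n \is a fin_num.
  by have /andP[a b] := Tb n; rewrite ge0_fin_numE// (le_lt_trans b)// ltry.
have lfin : \int[P]_w (phi (L m w) * (\int[normal_prob 0 sigma]_x f x)%R)%:E \is a fin_num.
  have := cvg_lim (@ereal_hausdorff R) Bcvg => <-.
  have lim0 : 0 <= limn B by apply: lime_ge; [apply/cvg_ex; eexists; exact: Bcvg|apply: nearW => n; have /andP[] := Bb n].
  have limC : limn B <= C%:E by apply: lime_le; [apply/cvg_ex; eexists; exact: Bcvg|apply: nearW => n; have /andP[] := Bb n].
  by rewrite ge0_fin_numE// (le_lt_trans limC)// ltry.
rewrite -(fineK lfin); apply/fine_cvgP; split; first by apply: nearW => n; exact: Tfin.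
have bcvg : (fine \o B) n @[n --> \oo] -->
    fine (\int[P]_w (phi (L m w) * (\int[normal_prob 0 sigma]_x f x)%R)%:E).
  by apply/fine_cvg; rewrite fineK.
rewrite -[X in _ --> X]addr0.
have -> : fine \o T = (fun n => fine (B n) + (fine (T n) - fine (B n)))%R.
  by apply/funext => n /=; rewrite subrKC.
apply: cvgD; first exact: bcvg.
apply: norm_cvg0.
apply: (@squeeze_cvgr _ _ _ _ (fun=> 0%R)
  (fun n => K * ((\sum_(0 <= k < n) e k) / s n))%R).
- near=> n; rewrite normr_ge0/=.
  have snp : (0 < s n)%R by near: n.
  have mn : (m <= n)%N by near: n; exact: nbhs_infty_ge.
  have D0 : (0 <= K / s n)%R by rewrite divr_ge0// ltW.
  have hD k : (`|h n k.+1 - h n k| <= K / s n)%R.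
    apply: (le_trans (lipf _ _)); rewrite ler_wpM2l// -mulrBl.
    have -> : (k.+1%:R - sigma ^+ 2 * s n ^+ 2 - (k%:R - sigma ^+ 2 * s n ^+ 2) = 1 :> R)%R.
      by rewrite -natr1; ring.
    by rewrite mul1r ger0_norm// invr_ge0 ltW.
  have := @telescoping _ _ _ P N Lam mN mLam Lam0 cond lam e m n phi (h n) (K / s n)
    lam0 he mn phi01 (fun=> f0 _) D0 hD.
  rewrite /=.
  have -> : \int[P]_w ((phi (L m w))%:E * poisE (\sum_(n <= k < n) lam k)%R
      (fun b => (h n (L n w + b)%N)%:E)) = T n.
    apply: eq_integral => w _; rewrite big_geq// poisE_rate0 ?addn0 ?EFinM//.
    by move=> k; rewrite lee_fin f0.
  rewrite -/(mu n) -/(B n) -(fineK (Bfin n)) -(fineK (Tfin n)) -!EFinD !lee_fin => -[t1 t2].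
  have le1 : (K / s n * \sum_(m <= k < n) e k <= K * ((\sum_(0 <= k < n) e k) / s n))%R.
    rewrite mulrAC -mulrA ler_wpM2l// ler_wpM2r ?invr_ge0 ?(ltW snp)//.
    rewrite (_ : \sum_(0 <= k < n) e k = \sum_(0 <= k < m) e k + \sum_(m <= k < n) e k)%R.
      by rewrite lerDr; exact: sumr_ge0.
    exact: big_cat_nat.
  by rewrite ler_norml; apply/andP; split; lra.
- exact: cvg_cst.
- by rewrite -[X in _ --> X](mulr0 K); apply: cvgMr.
Unshelve. all: by end_near. Qed.

End mixing_limit.

(** * Mixing and stable convergence *)

Section bounded_measurable.
Context {R : realType} d {T : measurableType d} (mu : {finite_measure set T -> \bar R}).
Implicit Types X Y : T -> R.

Definition bdd_meas X := measurable_fun setT X /\ exists C, forall w, `|X w| <= C.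

Lemma bdd_meas_integrable X : bdd_meas X -> mu.-integrable setT (EFin \o X).
Proof.
move=> [mX [C XC]].
have iC : mu.-integrable setT (cst C%:E) by exact: finite_measure_integrable_cst.
apply: (le_integrable measurableT _ _ iC).
  exact/measurable_EFinP.
by move=> w _ /=; rewrite lee_fin (le_trans (XC w))// ler_norm.
Qed.

Lemma bdd_measD X Y : bdd_meas X -> bdd_meas Y -> bdd_meas (fun w => X w + Y w).
Proof.
move=> [mX [C XC]] [mY [D YD]]; split; first exact: measurable_funD.
by exists (C + D) => w; rewrite (le_trans (ler_normD _ _))// lerD.
Qed.

Lemma bdd_measM X Y : bdd_meas X -> bdd_meas Y -> bdd_meas (fun w => X w * Y w).
Proof.
move=> [mX [C XC]] [mY [D YD]]; split; first exact: measurable_funM.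
by exists (C * D) => w; rewrite normrM ler_pM.
Qed.

Lemma bdd_meas_cst (c : R) : bdd_meas (fun=> c).
Proof. by split=> //; exists `|c|. Qed.

Lemma bdd_meas_indic (H : set T) : measurable H -> bdd_meas \1_H.
Proof.
move=> mH; split; first exact: measurable_indic.
by exists 1 => w; rewrite indicE; case: (_ \in _); rewrite ?normr1 ?normr0.
Qed.

Lemma bdd_measE (E : set T) X : measurable E -> bdd_meas X ->
  \int[mu]_(w in E) X w = \int[mu]_w (X w * \1_E w).
Proof.
move=> mE _; rewrite Rintegral_mkcond; apply: eq_Rintegral => w _.
by rewrite patchE indicE; case: ifP => _; rewrite ?mulr1 ?mulr0.
Qed.

Local Notation E X := (\int[mu]_w X w).

Lemma bdd_meas_intD X Y : bdd_meas X -> bdd_meas Y -> E (fun w => X w + Y w) = E X + E Y.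
Proof. by move=> /bdd_meas_integrable iX /bdd_meas_integrable iY; rewrite RintegralD. Qed.

Lemma bdd_meas_intZ (c : R) X : bdd_meas X -> E (fun w => c * X w) = c * E X.
Proof. by move=> /bdd_meas_integrable iX; rewrite RintegralZl. Qed.

Lemma bdd_meas_le X Y : bdd_meas X -> bdd_meas Y -> (forall w, X w <= Y w) -> E X <= E Y.
Proof.
by move=> /bdd_meas_integrable iX /bdd_meas_integrable iY XY; apply: le_Rintegral.
Qed.

End bounded_measurable.

Ltac bdd := repeat first [ done | exact: bdd_meas_cst
  | apply: bdd_measD | apply: bdd_measM ].

Section renyi.
Context {R : realType} d {Omega : measurableType d} (P : probability Omega R).

Local Notation Ex X := (\int[P]_w X w).

(* Otherwise sums of [K] sparse, nearly orthogonal terms [+- X n] would have second moment [O(K)]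
   but a mean over [H] of at least [K eps]. *)
Lemma renyi_mixing (X : nat -> Omega -> R) (C : R) :
  (forall n, measurable_fun setT (X n)) -> (forall n w, `|X n w| <= C) ->
  (forall m, \int[P]_w (X m w * X n w) @[n --> \oo] --> (0 : R)) ->
  forall H, measurable H -> \int[P]_(w in H) X n w @[n --> \oo] --> (0 : R).
Proof.
move=> mX XC Xmix H mH.
have bX n : bdd_meas (X n) by split; [exact: mX|exists C].
pose I := (\1_H : Omega -> R).
have bI : bdd_meas I by exact: bdd_meas_indic.
have -> : (fun n => \int[P]_(w in H) X n w) = (fun n => \int[P]_w (X n w * I w)).
  by apply/funext => n; rewrite (bdd_measE P mH (bX n)).
have pT : P setT = 1%E := probability_setT P.
have Ecst (c : R) : Ex (fun=> c) = c by rewrite Rintegral_cst//= pT mulr1.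
have E0 (Y : Omega -> R) : Ex (fun w => 0 * Y w) = 0.
  rewrite -[RHS](Ecst 0); congr (Rintegral _ _ _); apply/funext => w.
  by rewrite mul0r.
apply: contrapT => /cvgrPdist_lt/existsNP[eps /not_implyP[eps0 neps]].
have often n0 : exists2 n, (n0 <= n)%N & eps <= `|Ex (fun w => X n w * I w)|.
  apply: contrapT => h; apply: neps; near=> n.
  rewrite sub0r normrN ltNge; apply/negP => h'; apply: h; exists n => //.
  by near: n; exact: nbhs_infty_ge.
(* Signed terms are added one at a time. The last clause lets the next index be taken so large that
   the new term is almost orthogonal to the sum so far: the cross term then costs at most [1] and
   the new square at most [C ^+ 2]. *)
have build (K : nat) : exists S : Omega -> R, [/\ bdd_meas S,
    K%:R * eps <= Ex (fun w => S w * I w),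
    Ex (fun w => S w * S w) <= K%:R * (C ^+ 2 + 1) &
    Ex (fun w => S w * X n w) @[n --> \oo] --> (0 : R)].
  elim: K => [|K [S [bS S1 S2 S3]]].
    exists (fun=> 0); split.
    - exact: bdd_meas_cst.
    - by rewrite /= mul0r (E0 I).
    - by have := E0 (fun=> 0); rewrite /= !mul0r => ->.
    - by rewrite (_ : (fun _ => _) = (fun=> 0)); [exact: cvg_cst|apply/funext => n; exact: E0].
  have half0 : 0 < 2^-1 :> R by rewrite invr_gt0.
  have /cvgrPdist_lt/(_ _ half0)[n0 _ Hn0] := S3.
  have [n n0n epsn] := often n0.
  have := Hn0 n n0n; rewrite /= sub0r normrN => Sn.
  pose sg : R := Num.sg (Ex (fun w => X n w * I w)).
  have sg1 : `|sg| <= 1 by rewrite normr_sg; case: (_ != _).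
  have bsX : bdd_meas (fun w => sg * X n w) by apply: bdd_measM => //; exact: bdd_meas_cst.
  exists (fun w => S w + sg * X n w); split.
  - exact: bdd_measD.
  - have -> : Ex (fun w => (S w + sg * X n w) * I w) =
        Ex (fun w => S w * I w) + `|Ex (fun w => X n w * I w)|.
      rewrite [X in _ + X]normrEsg -bdd_meas_intZ//; last exact: bdd_measM.
      rewrite -bdd_meas_intD; [|exact: bdd_measM|].
        by apply: eq_Rintegral => w _; rewrite mulrDl mulrA.
      by apply: bdd_measM; [exact: bdd_meas_cst|exact: bdd_measM].
    by rewrite -natr1 mulrDl mul1r lerD.
  - have -> : Ex (fun w => (S w + sg * X n w) * (S w + sg * X n w)) =
        Ex (fun w => S w * S w) + (2 * sg * Ex (fun w => S w * X n w) +
          sg ^+ 2 * Ex (fun w => X n w * X n w)).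
      rewrite -!bdd_meas_intZ; [|exact: bdd_measM|exact: bdd_measM].
      rewrite -!bdd_meas_intD.
      - by apply: eq_Rintegral => w _; ring.
      all: bdd.
    have -> : K.+1%:R * (C ^+ 2 + 1) = K%:R * (C ^+ 2 + 1) + (C ^+ 2 + 1) by rewrite -(natr1 K); ring.
    apply: lerD => //; rewrite addrC.
    have XX : 0 <= Ex (fun w => X n w * X n w) <= C ^+ 2.
      apply/andP; split; first by apply: Rintegral_ge0 => w _; rewrite -expr2 sqr_ge0.
      rewrite -[leRHS]Ecst; apply: bdd_meas_le; [exact: bdd_measM|exact: bdd_meas_cst|].
      move=> w; rewrite -expr2 -[X n w ^+ 2]real_normK ?num_real//.
      by rewrite ler_pXn2r ?nnegrE// (le_trans _ (XC n w)).
    have sg2 : sg ^+ 2 <= 1 by rewrite -[sg ^+ 2]real_normK ?num_real// expr_le1.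
    have a1 : 2 * sg * Ex (fun w => S w * X n w) <= 1.
      apply: (le_trans (ler_norm _)); rewrite normrM normrM (ger0_norm (ler0n _ 2)).
      have := normr_ge0 sg; have := normr_ge0 (Ex (fun w => S w * X n w)).
      move: Sn sg1; nra.
    apply: lerD; last exact: a1.
    by move: XX => /andP[x1 x2]; have := sqr_ge0 sg; move: sg2 x1 x2; nra.
  - have -> : (fun k => Ex (fun w => (S w + sg * X n w) * X k w)) =
        (fun k => Ex (fun w => S w * X k w) + sg * Ex (fun w => X n w * X k w)).
      apply/funext => k; rewrite -bdd_meas_intZ; last exact: bdd_measM.
      rewrite -bdd_meas_intD; [|exact: bdd_measM|].
        by apply: eq_Rintegral => w _; ring.
      by apply: bdd_measM; [exact: bdd_meas_cst|exact: bdd_measM].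
    rewrite -[X in _ --> X]addr0 -[X in _ --> _ + X](mulr0 sg).
    by apply: cvgD => //; apply: cvgMr.
pose K := (Num.truncn ((C ^+ 2 + 1) / eps ^+ 2)).+1.
have hK : (C ^+ 2 + 1) < K%:R * eps ^+ 2.
  by rewrite -ltr_pdivrMr ?exprn_gt0// truncnS_gt.
have [S [bS S1 S2 _]] := build K.
pose t := K%:R * eps.
(* On [H] this integrates [2 * t * S <= t ^+ 2 + S ^+ 2]. With [t = K * eps] it yields
   [2 * t ^+ 2 <= t ^+ 2 + K * (C ^+ 2 + 1)], which the choice of [K] excludes. *)
have : 2 * t * Ex (fun w => S w * I w) <= t ^+ 2 + Ex (fun w => S w * S w).
  rewrite -[t ^+ 2 in leRHS]Ecst -bdd_meas_intZ; last exact: bdd_measM.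
  rewrite -bdd_meas_intD; [|exact: bdd_meas_cst|exact: bdd_measM].
  apply: bdd_meas_le.
  - by apply: bdd_measM; [exact: bdd_meas_cst|exact: bdd_measM].
  - by apply: bdd_measD; [exact: bdd_meas_cst|exact: bdd_measM].
  - move=> w; rewrite /I indicE; case: (_ \in _); rewrite ?mulr1 ?mulr0.
      by have := sqr_ge0 (S w - t); lra.
    by rewrite addr_ge0 ?sqr_ge0// -expr2 sqr_ge0.
apply/negP; rewrite -ltNge.
have K0 : (0 : R) < K%:R by rewrite ltr0n.
have t0 : 0 < t by rewrite mulr_gt0.
apply: (@lt_le_trans _ _ (2 * t * t)); last by rewrite ler_pM2l ?mulr_gt0.
have : Ex (fun w => S w * S w) < t ^+ 2.
  apply: (le_lt_trans S2); rewrite /t exprMn expr2 -mulrA ltr_pM2l//.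
by rewrite expr2; lra.
Unshelve. all: by end_near. Qed.

End renyi.

(** * Lipschitz approximation from below *)

Section inf_convolution.
Context {R : realType}.
Variables (f : R -> R) (C : R).
Hypotheses (cf : continuous f) (f0C : forall x, 0 <= f x <= C).

Let f0 x : 0 <= f x. Proof. by have /andP[] := f0C x. Qed.
Let fC x : f x <= C. Proof. by have /andP[] := f0C x. Qed.

(* Increases to [f] with [j], and is [j]-Lipschitz. *)
Definition inf_conv (j : nat) (x : R) := inf (range (fun y => f y + j%:R * `|x - y|)).

Let hinf j x : has_inf (range (fun y => f y + j%:R * `|x - y|)).
Proof.
split; first by exists (f 0 + j%:R * `|x - 0|); exists 0.
by exists 0 => _ [y _ <-]; rewrite addr_ge0// mulr_ge0.
Qed.

Lemma inf_conv_le j x y : inf_conv j x <= f y + j%:R * `|x - y|.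
Proof. by apply: ge_inf; [have [] := hinf j x|exists y]. Qed.

Lemma inf_conv_ge j x a : (forall y, a <= f y + j%:R * `|x - y|) -> a <= inf_conv j x.
Proof. by move=> h; apply: lb_le_inf; [have [] := hinf j x|move=> _ [y _ <-]]. Qed.

Lemma inf_conv_bounds j x : 0 <= inf_conv j x <= C.
Proof.
apply/andP; split; first by apply: inf_conv_ge => y; rewrite addr_ge0// mulr_ge0.
by apply: (le_trans (inf_conv_le j x x)); rewrite subrr normr0 mulr0 addr0.
Qed.

Lemma inf_conv_le_id j x : inf_conv j x <= f x.
Proof. by have := inf_conv_le j x x; rewrite subrr normr0 mulr0 addr0. Qed.

Lemma inf_conv_lip j x y : `|inf_conv j x - inf_conv j y| <= j%:R * `|x - y|.
Proof.
have half z t : inf_conv j z - j%:R * `|z - t| <= inf_conv j t.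
  apply: inf_conv_ge => u; rewrite lerBlDr.
  apply: (le_trans (inf_conv_le j z u)); rewrite -addrA lerD2l -mulrDr ler_wpM2l//.
  have zu : z - t + (t - u) = z - u by ring.
  by have := ler_normD (z - t) (t - u); rewrite zu [leRHS]addrC.
have := half x y; have := half y x; rewrite (distrC y x) => h1 h2.
by rewrite ler_norml; apply/andP; split; lra.
Qed.

Lemma lip_continuous (g : R -> R) (K : R) :
  (forall x y, `|g x - g y| <= K * `|x - y|) -> continuous g.
Proof.
move=> gK x; apply/cvgrPdist_le => eps e0.
have K1 : 0 < `|K| + 1 by rewrite ltr_wpDl.
near=> y.
have xy : `|x - y| <= eps / (`|K| + 1).
  by near: y; apply: cvgr_dist_le; [exact: cvg_id|rewrite divr_gt0].
apply: (le_trans (gK x y)).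
apply: (@le_trans _ _ ((`|K| + 1) * `|x - y|)).
  by apply: ler_wpM2r => //; rewrite (le_trans (ler_norm _))// lerDl.
by rewrite mulrC -ler_pdivlMr.
Unshelve. all: by end_near. Qed.

Lemma inf_conv_continuous j : continuous (inf_conv j).
Proof. exact: lip_continuous (inf_conv_lip j). Qed.

(** In the infimum, points at distance [del] or more from [x] cost at least [j * del >= C >= f x],
    and nearer ones have [f y >= f x - eps]. *)
Lemma inf_conv_cvg x : inf_conv j x @[j --> \oo] --> f x.
Proof.
apply/cvgrPdist_le => eps e0.
have /cvgrPdist_le/(_ _ e0)/nbhs_ballP[del /= d0 hdel] := @cf x.
have C0 : 0 <= C by exact: le_trans (f0 0) (fC 0).
near=> j.
have jC : C <= j%:R * del.
  rewrite -ler_pdivrMr//; near: j; exact: nbhs_infty_ger.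
rewrite ger0_norm ?subr_ge0 ?inf_conv_le_id// lerBlDl -lerBlDr.
apply: inf_conv_ge => y.
have [xy|xy] := ltP `|x - y| del.
  have := hdel y xy; rewrite ler_norml => /andP[_ h].
  have : 0 <= j%:R * `|x - y| by rewrite mulr_ge0.
  by move: h => /=; lra.
have : j%:R * del <= j%:R * `|x - y| by rewrite ler_wpM2l.
by have := f0 y; have := fC x; lra.
Unshelve. all: by end_near. Qed.

End inf_convolution.

Section portmanteau.
Context {R : realType} d {Omega : measurableType d} (P : probability Omega R).
Variables (K : probability (measurableTypeR R) R) (Z : nat -> Omega -> R) (H : set Omega).
Hypotheses (mZ : forall n, measurable_fun setT (Z n)) (mH : measurable H).

Let pH := fine (P H).

Hypothesis lipZ : forall (f : R -> R) (C D : R), continuous f ->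
  (forall x, 0 <= f x <= C) -> (forall x y, `|f x - f y| <= D * `|x - y|) ->
  \int[P]_(w in H) f (Z n w) @[n --> \oo] --> pH * \int[K]_x f x.

Let pH0 : 0 <= pH. Proof. by rewrite fine_ge0. Qed.

Let pH1 : pH <= 1.
Proof.
have := probability_le1 P mH; rewrite -lee_fin /pH fineK//.
exact: fin_num_measure.
Qed.

Let bdd_Z (f : R -> R) (C : R) n : continuous f -> (forall x, `|f x| <= C) ->
  bdd_meas (fun w => f (Z n w)).
Proof.
move=> cf fC; split; last by exists C.
exact: (measurableT_comp (continuous_measurable_fun cf)).
Qed.

Let bdd_K (f : R -> R) (C : R) : continuous f -> (forall x, `|f x| <= C) ->
  @bdd_meas R _ (measurableTypeR R) f.
Proof. by move=> cf fC; split; [exact: continuous_measurable_fun|exists C]. Qed.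

Let int_H (X : Omega -> R) : bdd_meas X -> P.-integrable H (EFin \o X).
Proof. by move=> /(bdd_meas_integrable P); apply: integrableS. Qed.

(** [inf_conv f j] lies below [f] and is Lipschitz, so [lipZ] applies to it; by dominated
    convergence its [K]-mean is within [eps / 2] of that of [f] for some [j]. *)
Let lower (f : R -> R) (C eps : R) : continuous f -> (forall x, 0 <= f x <= C) -> 0 < eps ->
  \forall n \near \oo, pH * \int[K]_x f x - eps <= \int[P]_(w in H) f (Z n w).
Proof.
move=> cf f0C e0.
have fN x : `|f x| <= C by have /andP[? ?] := f0C x; rewrite ger0_norm.
have gN j x : `|inf_conv f j x| <= C.
  by have /andP[? ?] := inf_conv_bounds f0C j x; rewrite ger0_norm.
have cg j := inf_conv_continuous f0C (j := j).
have : \int[K]_x inf_conv f j x @[j --> \oo] --> \int[K]_x f x.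
  have mg j : measurable_fun setT (fun x : measurableTypeR R => (inf_conv f j x)%:E).
    by apply/measurable_EFinP; apply: continuous_measurable_fun; exact: cg.
  have mf : measurable_fun setT (fun x : measurableTypeR R => (f x)%:E).
    by apply/measurable_EFinP; exact: continuous_measurable_fun.
  have iC : K.-integrable setT (cst C%:E) by exact: finite_measure_integrable_cst.
  have [||_ _ dct] := dominated_convergence measurableT mg mf _ iC _.
  - apply: aeW => x _; apply: cvg_EFin; first exact: nearW.
    exact: inf_conv_cvg.
  - by apply: aeW => x n _; rewrite lee_fin; exact: gN.
  apply: fine_cvg; rewrite fineK; first exact: dct.
  by apply: integrable_fin_num => //; apply: bdd_meas_integrable; exact: bdd_K fN.
move=> /cvgrPdist_le/(_ (eps / 2)); rewrite divr_gt0// => /(_ isT)[j _ /(_ j (leqnn j))] /= hj.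
have := lipZ (cg j) (inf_conv_bounds f0C j) (inf_conv_lip f0C j).
move=> /cvgrPdist_le/(_ (eps / 2)); rewrite divr_gt0// => /(_ isT) hn.
apply: filterS hn => n /= hn'.
apply: (@le_trans _ _ (\int[P]_(w in H) inf_conv f j (Z n w))); last first.
  apply: le_Rintegral => //.
  - by apply: int_H; exact: bdd_Z (cg j) (gN j).
  - by apply: int_H; exact: bdd_Z cf fN.
  - by move=> w _; exact: inf_conv_le_id.
have : pH * \int[K]_x f x <= pH * \int[K]_x inf_conv f j x + eps / 2.
  apply: (@le_trans _ _ (pH * (\int[K]_x inf_conv f j x + eps / 2))).
    by rewrite ler_wpM2l//; move: hj; rewrite ler_norml => /andP[_]; lra.
  by rewrite mulrDr lerD2l ler_piMl// ltW// divr_gt0.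
by move: hn'; rewrite ler_norml => /andP[_]; lra.
Qed.

(** The one-sided bound [lower], applied to the nonnegative functions [f + C] and [C - f], controls
    both sides. *)
Lemma portmanteau_bounded (f : R -> R) (C : R) : continuous f -> (forall x, `|f x| <= C) ->
  \int[P]_(w in H) f (Z n w) @[n --> \oo] --> pH * \int[K]_x f x.
Proof.
move=> cf fC; apply/cvgrPdist_le => eps e0.
have f1 x : 0 <= f x + C <= 2 * C.
  by have := fC x; rewrite ler_norml => /andP[? ?]; apply/andP; split; lra.
have f2 x : 0 <= C - f x <= 2 * C.
  by have := fC x; rewrite ler_norml => /andP[? ?]; apply/andP; split; lra.
have c1 : continuous (fun x => f x + C).
  by move=> x; apply: cvgD; [exact: cf|exact: cvg_cst].
have c2 : continuous (fun x => C - f x).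
  by move=> x; apply: cvgB; [exact: cvg_cst|exact: cf].
have pK : K setT = 1%E := probability_setT K.
have bK := bdd_K cf fC.
have K1 : \int[K]_x (f x + C) = \int[K]_x f x + C.
  rewrite (bdd_meas_intD K bK (bdd_meas_cst C)).
  by rewrite Rintegral_cst//= pK mulr1.
have K2 : \int[K]_x (C - f x) = C - \int[K]_x f x.
  transitivity (\int[K]_x (C + (-1) * f x)).
    by apply: eq_Rintegral => x _; rewrite mulN1r.
  rewrite (bdd_meas_intD K (bdd_meas_cst C)); last by apply: bdd_measM => //; exact: bdd_meas_cst.
  by rewrite bdd_meas_intZ// Rintegral_cst//= pK mulr1 mulN1r.
have iH n : P.-integrable H (EFin \o (fun w => f (Z n w))) by apply: int_H; exact: bdd_Z cf fC.
have iC : P.-integrable H (EFin \o (fun w => C)) by apply: int_H; exact: bdd_meas_cst.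
have H1 n : \int[P]_(w in H) (f (Z n w) + C) = \int[P]_(w in H) f (Z n w) + C * pH.
  by rewrite RintegralD// Rintegral_cst.
have H2 n : \int[P]_(w in H) (C - f (Z n w)) = C * pH - \int[P]_(w in H) f (Z n w).
  by rewrite RintegralB// Rintegral_cst.
have l1 := lower c1 f1 e0; have l2 := lower c2 f2 e0.
near=> n.
have : pH * \int[K]_x (f x + C) - eps <= \int[P]_(w in H) (f (Z n w) + C) by near: n.
have : pH * \int[K]_x (C - f x) - eps <= \int[P]_(w in H) (C - f (Z n w)) by near: n.
rewrite K1 K2 H1 H2 => h1 h2.
rewrite ler_norml; apply/andP; split; lra.
Unshelve. all: by end_near. Qed.

End portmanteau.

Section ae_integral.
Import HBNNSimple.
Context {R : realType} d {T : measurableType d} (mu : {measure set T -> \bar R}).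
Local Open Scope ereal_scope.

(** No measurability of [f] or [g] is assumed, as the statistic built on [Ln] is only known to agree
    almost everywhere with a measurable one. The integral is a supremum over simple functions below
    the integrand; multiplying one below [f] by the indicator of the complement of [B] puts it below
    [g] and leaves its integral unchanged. *)
Lemma ge0_ae_le_integral (E B : set T) (f g : T -> \bar R) :
  measurable E -> measurable B -> mu B = 0 ->
  (forall x, 0 <= f x) -> (forall x, 0 <= g x) -> (forall x, ~ B x -> f x = g x) ->
  \int[mu]_(x in E) f x <= \int[mu]_(x in E) g x.
Proof.
move=> mE mB muB f0 g0 fg.
rewrite [leLHS]integral_mkcond [leRHS]integral_mkcond.
have fE0 x : 0 <= (f \_ E) x by rewrite patchE; case: ifP.
have gE0 x : 0 <= (g \_ E) x by rewrite patchE; case: ifP.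
rewrite ge0_integralTE// ge0_integralTE//.
apply: ub_ereal_sup => _ [h /= hf <-].
pose mBC := measurableC mB.
pose k := mul_nnsfun h (indic_nnsfun R mBC).
apply: (@le_trans _ _ (sintegral mu k)); last first.
  apply: ereal_sup_ubound; exists k => // x /=.
  rewrite mindicE; case: (boolP (x \in ~` B)) => xB.
    rewrite mulr1; apply: (le_trans (hf x)); rewrite !patchE.
    by case: ifP => // _; rewrite fg//; exact: set_mem.
  by rewrite mulr0.
rewrite -!integralT_nnsfun le_eqVlt; apply/orP; left; apply/eqP.
apply: ae_eq_integral => //; try by apply/measurable_EFinP; exact: measurable_funPT.
exists B; split=> // x /= /not_implyP[_]; apply: contra_notP => Bx.
by rewrite /k/= mindicE mem_set//= mulr1.
Qed.

Lemma ae_eq_integral_any (E B : set T) (f g : T -> \bar R) :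
  measurable E -> measurable B -> mu B = 0 -> (forall x, ~ B x -> f x = g x) ->
  \int[mu]_(x in E) f x = \int[mu]_(x in E) g x.
Proof.
move=> mE mB muB fg; rewrite [LHS]integralE [RHS]integralE.
have p x : ~ B x -> f^\+ x = g^\+ x by move=> Bx; rewrite !funeposE fg.
have n x : ~ B x -> f^\- x = g^\- x by move=> Bx; rewrite !funenegE fg.
congr (_ - _); apply/eqP; rewrite eq_le; apply/andP; split;
  apply: (@ge0_ae_le_integral _ B) => // x Bx; by rewrite ?p ?n.
Qed.

End ae_integral.

Section stable_limit.
Context {R : realType} d {Omega : measurableType d} (P : probability Omega R).
Variables (N : nat -> Omega -> nat) (Lam : nat -> Omega -> R).
Hypotheses (mN : forall i a, measurable [set w | N i w = a])
  (mLam : forall i, measurable_fun setT (Lam i)) (Lam0 : forall i w, 0 <= Lam i w).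

Local Notation L := (partial_count N).

Hypothesis cond : forall m n v1 v2 b, (m <= n)%N ->
  P ([set w | L m w = v1] `&` [set w | L n w = v2] `&` [set w | N n w = b]) =
  (\int[P]_(w in [set w | L m w = v1] `&` [set w | L n w = v2]) (pois (Lam n w) b)%:E)%E.

Variables (sigma : R) (lam e s : nat -> R).
Hypotheses (s0 : 0 < sigma) (lam0 : forall i, 0 <= lam i)
  (he : forall i, (\int[P]_w `|Lam i w - lam i|%:E <= (e i)%:E)%E)
  (sn0 : \forall n \near \oo, 0 < s n)
  (s_cvg : (s n)^-1 @[n --> \oo] --> (0 : R))
  (e_cvg : (\sum_(0 <= k < n) e k) / s n @[n --> \oo] --> (0 : R))
  (lam_cvg : (\sum_(0 <= k < n) lam k - sigma ^+ 2 * s n ^+ 2) / s n @[n --> \oo] --> (0 : R)).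

Local Notation Z := (std_count N sigma s).

Lemma measurable_std_count n : measurable_fun setT (Z n).
Proof.
exact: (@measurable_natfun _ _ _ (L n) (fun k => (k%:R - sigma ^+ 2 * s n ^+ 2) / s n)
  (measurable_partial_count mN n)).
Qed.

(** Renyi's criterion is applied to the centred variables [f (Z n w) - c]. Their products with a
    fixed earlier term converge by [std_count_mixing], the mixing weight being a multiple of
    [f (Z m w)], which is a function of [L m w]. *)
Lemma std_count_stable (H : set Omega) (f : R -> R) (C : R) : measurable H ->
  continuous f -> (forall x, `|f x| <= C) ->
  \int[P]_(w in H) f (Z n w) @[n --> \oo] --> fine (P H) * \int[normal_prob 0 sigma]_x f x.
Proof.
move=> mH; move: f C; apply: portmanteau_bounded => //; first exact: measurable_std_count.
move=> f C D cf f0C lipf.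
have fN x : `|f x| <= C by have /andP[? ?] := f0C x; rewrite ger0_norm.
have f0 x : 0 <= f x by have /andP[] := f0C x.
have C0 : 0 <= C := le_trans (f0 0) (le_trans (ler_norm _) (fN 0)).
pose c := \int[normal_prob 0 sigma]_x f x; rewrite -/c.
have /andP[c0 cC] : 0 <= c <= C by apply: normal_mean_bounds.
have pT : P setT = 1%E := probability_setT P.
have Ecst (a : R) : \int[P]_w a = a by rewrite Rintegral_cst//= pT mulr1.
have bZ n : bdd_meas (fun w => f (Z n w)).
  split; last by exists C.
  by apply: (measurableT_comp (continuous_measurable_fun cf)); exact: measurable_std_count.
have mix m (phi : nat -> R) : (forall k, 0 <= phi k <= 1) ->
    \int[P]_w (phi (L m w) * f (Z n w)) @[n --> \oo] --> \int[P]_w (phi (L m w) * c).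
  move=> phi01; apply: fine_cvg; rewrite fineK; last first.
    apply: integrable_fin_num => //; apply: bdd_meas_integrable.
    apply: bdd_measM; last exact: bdd_meas_cst.
    split; last by exists 1 => w; have /andP[? ?] := phi01 (L m w); rewrite ger0_norm.
    by apply: measurable_natfun; exact: measurable_partial_count.
  have := @std_count_mixing _ _ _ P N Lam mN mLam Lam0 cond sigma lam e s s0 lam0 he sn0
    s_cvg e_cvg lam_cvg f C D m phi cf f0C lipf phi01.
  exact.
clearbody c.
have E1 : \int[P]_w f (Z n w) @[n --> \oo] --> c.
  have := mix 0%N (fun=> 1) (fun=> ltac:(by rewrite ler01 lexx)).
  under eq_fun do (under eq_Rintegral do rewrite mul1r).
  by under eq_Rintegral do rewrite mul1r; rewrite Ecst.
have E2 m : \int[P]_w (f (Z m w) * f (Z n w)) @[n --> \oo] --> c * \int[P]_w f (Z m w).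
  have C1 : 0 < C + 1 by rewrite ltr_wpDl.
  (* Division by [C + 1] puts the weight in the unit interval; [C] itself may be zero. *)
  have := mix m (fun k => (C + 1)^-1 * f ((k%:R - sigma ^+ 2 * s m ^+ 2) / s m)).
  rewrite -/(Z m _) => /(_ _)/wrap[].
    move=> k; have /andP[a b] := f0C ((k%:R - sigma ^+ 2 * s m ^+ 2) / s m).
    rewrite mulr_ge0 ?invr_ge0 ?(ltW C1)//= mulrC ler_pdivrMr// mul1r.
    by rewrite (le_trans b)// lerDl.
  move=> h.
  have -> : (fun n => \int[P]_w (f (Z m w) * f (Z n w))) =
    (fun n => (C + 1) * \int[P]_w ((C + 1)^-1 * f (Z m w) * f (Z n w))).
    apply/funext => n; rewrite -bdd_meas_intZ; last first.
      by bdd.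
    by apply: eq_Rintegral => w _; field; rewrite gt_eqF.
  have -> : c * \int[P]_w f (Z m w) = (C + 1) * \int[P]_w ((C + 1)^-1 * f (Z m w) * c).
    rewrite -!bdd_meas_intZ//; last by bdd.
    by apply: eq_Rintegral => w _; field; rewrite gt_eqF.
  exact: cvgMr h.
have bX n : bdd_meas (fun w => f (Z n w) + - c).
  by apply: bdd_measD => //; exact: bdd_meas_cst.
have : \int[P]_(w in H) (f (Z n w) + - c) @[n --> \oo] --> (0 : R).
  apply: (@renyi_mixing _ _ _ P (fun n w => f (Z n w) + - c) C) => //.
  - by move=> n; have [] := bX n.
  - move=> n w; have /andP[a b] := f0C (Z n w).
    by rewrite ler_norml; apply/andP; split; lra.
  move=> m.
  have -> : (fun n => \int[P]_w ((f (Z m w) + - c) * (f (Z n w) + - c))) =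
     (fun n => \int[P]_w (f (Z m w) * f (Z n w)) + (- c * \int[P]_w f (Z m w) +
         (- c * \int[P]_w f (Z n w) + c * c))).
    apply/funext => n; rewrite -[c * c]Ecst -!bdd_meas_intZ// -!bdd_meas_intD.
    - by apply: eq_Rintegral => w _; ring.
    all: bdd.
  have -> : 0 = c * \int[P]_w f (Z m w) + (- c * \int[P]_w f (Z m w) + (- c * c + c * c)) by ring.
  apply: cvgD; first exact: E2.
  apply: cvgD; first exact: cvg_cst.
  apply: cvgD; last exact: cvg_cst.
  by apply: cvgMr; exact: E1.
move=> h; have : \int[P]_(w in H) (f (Z n w) + - c) + c * fine (P H) @[n --> \oo] -->
   0 + c * fine (P H) by apply: cvgD; [exact: h|exact: cvg_cst].
rewrite add0r mulrC; apply: cvg_trans; apply: near_eq_cvg; apply: nearW => n.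
have iH (Y : Omega -> R) : bdd_meas Y -> P.-integrable H (EFin \o Y).
  by move=> /(bdd_meas_integrable P); apply: integrableS.
rewrite RintegralD//; [|exact: iH|by apply: iH; exact: bdd_meas_cst].
by rewrite Rintegral_cst//; ring.
Qed.

Lemma std_count_stable_conv (Y : nat -> Omega -> R) :
  (\forall n \near \oo, {ae P, forall w, Y n w = Z n w}) ->
  stable_conv P Y (normal_prob 0 sigma).
Proof.
move=> YZ H mH PH f cf [C fC].
have PHfin : P H \is a fin_num by exact: fin_num_measure.
have p0 : 0 < fine (P H) by rewrite fine_gt0// PH/= ltey_eq PHfin.
have bK : @bdd_meas R _ (measurableTypeR R) f.
  by split; [exact: continuous_measurable_fun|exists C].
have KE : (\int[normal_prob 0 sigma]_x (f x)%:E)%E = (\int[normal_prob 0 sigma]_x f x)%:E.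
  rewrite /Rintegral fineK//; apply: integrable_fin_num => //.
  exact: bdd_meas_integrable bK.
rewrite KE.
have -> : \int[normal_prob 0 sigma]_x f x =
    fine (P H) * \int[normal_prob 0 sigma]_x f x * (fine (P H))^-1.
  by field; rewrite gt_eqF.
have h := std_count_stable mH cf fC.
have bZ n : bdd_meas (fun w => f (Z n w)).
  split; last by exists C.
  by apply: (measurableT_comp (continuous_measurable_fun cf)); exact: measurable_std_count.
have YE : \forall n \near \oo,
    (\int[P]_(w in H) (f (Y n w))%:E * ((fine (P H))^-1)%:E)%E =
    (\int[P]_(w in H) f (Z n w) * (fine (P H))^-1)%:E.
  apply: filterS YZ => n [B [mB PB BYZ]].
  rewrite (@ae_eq_integral_any _ _ _ P H B _ (fun w => (f (Z n w))%:E))//; last first.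
    by move=> w Bw; congr (f _)%:E; apply: contrapT => YZw; apply: Bw; exact: BYZ.
  rewrite EFinM /Rintegral fineK//; apply: integrable_fin_num => //.
  by apply: integrableS (bdd_meas_integrable P (bZ n)).
apply/fine_cvgP; split; first by apply: filterS YE => n ->.
have h2 : \int[P]_(w in H) f (Z n w) * (fine (P H))^-1 @[n --> \oo] -->
    fine (P H) * \int[normal_prob 0 sigma]_x f x * (fine (P H))^-1.
  by apply: cvgMl; exact: h.
apply: cvg_trans h2; apply: near_eq_cvg.
by apply: filterS YE => n /= ->.
Qed.

End stable_limit.

(** * Gamma quotients and sums of rates *)

Section real_infinity.
Context {R : realType}.

Lemma cvgr_natS : (n.+1%:R : R) @[n --> \oo] --> +oo.
Proof.
apply/cvgryPge => A; near=> n.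
have : A <= n%:R by near: n; exact: nbhs_infty_ger.
by move=> /le_trans; apply; rewrite ler_nat.
Unshelve. all: by end_near. Qed.

Lemma cvgr_ln : @ln R x @[x --> +oo] --> +oo.
Proof.
apply/cvgryPge => A; near=> x.
have eAx : expR A <= x by near: x; exact: nbhs_pinfty_ge.
by rewrite -[A]expRK ler_ln// posrE ?(lt_le_trans (expR_gt0 A)) ?expR_gt0.
Unshelve. all: by end_near. Qed.

End real_infinity.

(** * The Gamma function and Gautschi's inequality *)

Section gamma_function.
Context {R : realType}.
Local Notation mu := (@lebesgue_measure R).
Implicit Types x t : R.

(** The exponential form is positive for every [t]. It is the Gamma integrand only for [0 < t],
    which suffices because the integrals run over the open half-line. *)
Definition gamma_fun x t : R := expR ((x - 1) * ln t - t).

Lemma gamma_fun_gt0 x t : 0 < gamma_fun x t. Proof. exact: expR_gt0. Qed.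

Lemma gamma_funE x t : 0 < t -> t `^ (x - 1) * expR (- t) = gamma_fun x t.
Proof. by move=> t0; rewrite /powR gt_eqF// -expRD. Qed.

Lemma gamma_funD x y t : 0 < t -> gamma_fun (x + y) t = t `^ y * gamma_fun x t.
Proof.
by move=> t0; rewrite /gamma_fun /powR gt_eqF// -expRD; congr expR; ring.
Qed.

Lemma measurable_gamma_fun x : measurable_fun setT (gamma_fun x).
Proof.
apply: measurableT_comp => //; apply: measurable_funB => //.
by apply: measurable_funM => //; exact: measurable_ln.
Qed.

(** Extended-real version of [Gamma]: the recursion can be proved for it before finiteness is known,
    and finiteness is in turn derived from the recursion. *)
Definition Egamma x : \bar R := (\int[mu]_(t in `]0%R, +oo[) (gamma_fun x t)%:E)%E.

Lemma GammaE x : Gamma x = fine (Egamma x).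
Proof.
rewrite /Gamma /Rintegral /Egamma -integral_itv_obnd_cbnd.
  congr fine; apply: eq_integral => t; rewrite inE/= in_itv/= andbT => t0.
  by rewrite gamma_funE.
apply/measurable_EFinP/measurable_funM.
  by apply: measurable_funTS; exact: measurable_powR.
by apply: measurable_funTS; apply: measurableT_comp => //; exact: measurable_funN.
Qed.

Lemma Egamma_ge0 x : (0 <= Egamma x)%E.
Proof. by apply: integral_ge0 => t _; rewrite lee_fin ltW ?gamma_fun_gt0. Qed.

Lemma measurable_Gamma : measurable_fun setT (@Gamma R).
Proof.
have -> : @Gamma R = fun x => fine (Egamma x) by apply/funext => x; exact: GammaE.
apply: measurableT_comp => //.
pose G (z : measurableTypeR R * measurableTypeR R) : \bar R :=
  (gamma_fun z.1 z.2 * \1_(`]0%R, +oo[%classic) z.2)%:E.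
have mG : measurable_fun setT G.
  apply/measurable_EFinP; apply: measurable_funM.
    apply: measurableT_comp => //; apply: measurable_funB => //.
    apply: measurable_funM; first exact: measurable_funB.
    by apply: measurableT_comp => //; exact: measurable_ln.
  by apply: measurableT_comp => //; exact: measurable_indic.
have G0 z : (0 <= G z)%E.
  by rewrite lee_fin mulr_ge0 ?(ltW (gamma_fun_gt0 _ _))// indicE.
have := @measurable_fun_fubini_tonelli_F _ _ (measurableTypeR R) (measurableTypeR R) R mu G mG G0.
congr measurable_fun; apply/funext => x.
rewrite /fubini_F /Egamma [RHS]integral_mkcond; apply: eq_integral => t _.
by rewrite patchE /G/= indicE; case: ifP => _; rewrite ?mulr1 ?mulr0.
Qed.

Let gmono n m : (n <= m)%N ->
  `[n.+1%:R^-1, n.+1%:R] `<=` `[m.+1%:R^-1, m.+1%:R :> R].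
Proof.
move=> nm t /=; rewrite !in_itv/= => /andP[a b]; apply/andP; split.
  by apply: le_trans a; rewrite lef_pV2 ?posrE// ler_nat.
by apply: (le_trans b); rewrite ler_nat.
Qed.

Let gcover : \bigcup_n `[n.+1%:R^-1, n.+1%:R]%classic = `]0%R, +oo[%classic :> set R.
Proof.
apply/seteqP; split=> [t [n _] /=|t /=]; rewrite !in_itv/=.
  by move=> /andP[a _]; rewrite andbT (lt_le_trans _ a).
rewrite andbT => t0.
exists (maxn (Num.truncn t) (Num.truncn t^-1)) => //=; rewrite in_itv/=; apply/andP; split.
  rewrite -[leRHS]invrK lef_pV2 ?posrE ?invr_gt0//.
  by rewrite (le_trans (ltW (truncnS_gt _)))// ler_nat ltnS leq_maxr.
by rewrite (le_trans (ltW (truncnS_gt _)))// ler_nat ltnS leq_maxl.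
Qed.

Lemma cvg_Egamma x :
  (\int[mu]_(t in `[n.+1%:R^-1%R, n.+1%:R]) (gamma_fun x t)%:E)%E @[n --> \oo] --> Egamma x.
Proof.
rewrite /Egamma -gcover; apply: ge0_nondecreasing_set_cvg_integral => //.
- by move=> n m nm; rewrite subsetEset; exact: gmono.
- by move=> n; apply/measurable_EFinP; apply: measurable_funTS; exact: measurable_gamma_fun.
- by move=> n t _; rewrite lee_fin ltW ?gamma_fun_gt0.
Qed.

Lemma is_derive_gamma_fun x t : 0 < t ->
  is_derive t 1 (gamma_fun (x + 1)) (x * gamma_fun x t - gamma_fun (x + 1) t).
Proof.
move=> t0.
have dl : is_derive t 1 (@ln R) t^-1 := is_derive1_ln t0.
have dln : is_derive t 1 (fun t => x * ln t - t) (x * t^-1 - 1).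
  have := is_deriveB (is_deriveZ x dl) (is_derive_id t 1).
  by [].
have -> : gamma_fun (x + 1) = expR \o (fun t => x * ln t - t).
  by apply/funext => u; rewrite /gamma_fun addrK.
have -> : x * gamma_fun x t - (expR \o (fun t => x * ln t - t)) t =
   expR (x * ln t - t) * (x * t^-1 - 1).
  rewrite /=.
  have -> : expR (x * ln t - t) = t * gamma_fun x t.
    rewrite (_ : t * _ = expR (ln t) * gamma_fun x t); last by rewrite lnK ?posrE.
    by rewrite /gamma_fun -expRD; congr expR; ring.
  by field; rewrite gt_eqF.
exact: is_derive1_comp.
Qed.

(** The inequality [1 + ln y <= y] at [y = t / (2 * x)], multiplied by [x], leaves half of the
    exponential decay. *)
Let gamma_fun_bound x : 0 < x ->
  exists2 C, 0 <= C & forall t, 0 < t -> gamma_fun (x + 1) t <= C * expR (- (t / 2)).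
Proof.
move=> x0; exists (expR (x * (ln (2 * x) - 1))); first exact: expR_ge0.
move=> t t0; rewrite /gamma_fun addrK -expRD ler_expR.
have x20 : 0 < 2 * x by rewrite mulr_gt0.
have := expR_ge1Dx (ln (t / (2 * x))); rewrite lnK ?posrE ?divr_gt0// ln_div ?posrE// => h.
have : x * (1 + (ln t - ln (2 * x))) <= x * (t / (2 * x)) by rewrite ler_pM2l.
have -> : x * (t / (2 * x)) = t / 2 by field; rewrite gt_eqF.
lra.
Qed.

(** Integration by parts on the intervals from [1 / (n + 1)] to [n + 1], where the integrands are
    continuous. The boundary values vanish at both ends, and monotone convergence passes to the
    half-line without finiteness. *)
Lemma Egamma_rec x : 0 < x -> (x%:E * Egamma x)%E = Egamma (x + 1).
Proof.
move=> x0.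
pose a n : R := n.+1%:R^-1; pose b n : R := n.+1%:R.
pose I y n := (\int[mu]_(t in `[a n, b n]) (gamma_fun y t)%:E)%E.
have a0 n : 0 < a n by rewrite invr_gt0.
have id n : (0 < n)%N ->
    (x%:E * I x n = I (x + 1)%R n + (gamma_fun (x + 1) (b n) - gamma_fun (x + 1) (a n))%:E)%E.
  move=> n0.
  have ab : a n < b n.
    rewrite /a /b; apply: (@lt_trans _ _ 1); last by rewrite ltr1n.
    by rewrite invf_lt1// ltr1n.
  have pos t : a n <= t -> 0 < t by exact: lt_le_trans.
  have ctn y : {within `[a n, b n], continuous (gamma_fun y)}.
    apply: derivable_within_continuous => t; rewrite in_itv/= => /andP[/pos t0 _].
    have := is_derive_gamma_fun (y - 1) t0; rewrite subrK => d.
    exact: ex_derive.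
  have ctnf : {within `[a n, b n], continuous (fun t => x * gamma_fun x t - gamma_fun (x + 1) t)}.
    move=> t; apply: cvgB; last exact: ctn.
    by apply: cvgMr; exact: ctn.
  have iy y : mu.-integrable `[a n, b n] (EFin \o gamma_fun y).
    by apply: continuous_compact_integrable; [exact: segment_compact|exact: ctn].
  have ixy : mu.-integrable `[a n, b n] (EFin \o (fun t => x * gamma_fun x t)).
    apply: continuous_compact_integrable; first exact: segment_compact.
    by move=> t; apply: cvgMr; exact: ctn.
  have dF t : 0 < t -> derivable (gamma_fun (x + 1)) t 1.
    by move=> t0; have [] := is_derive_gamma_fun x t0.
  have cF t : 0 < t -> {for t, continuous (gamma_fun (x + 1))}.
    move=> t0; apply: differentiable_continuous; apply/derivable1_diffP; exact: dF.
  have oo : derivable_oo_LRcontinuous (gamma_fun (x + 1)) (a n) (b n).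
    split.
    - by move=> t; rewrite in_itv/= => /andP[/ltW/pos t0 _]; exact: dF.
    - by apply: cvg_at_right_filter; apply: cF.
    - by apply: cvg_at_left_filter; apply: cF; apply: pos; exact: ltW.
  have dE : {in `]a n, b n[, (gamma_fun (x + 1))^`()%classic =1
      (fun t => x * gamma_fun x t - gamma_fun (x + 1) t)}.
    move=> t; rewrite in_itv/= => /andP[/ltW/pos t0 _].
    by rewrite derive1E; have [_] := is_derive_gamma_fun x t0.
  have := continuous_FTC2 ab ctnf oo dE => /(congr1 fine).
  rewrite -[fine (\int[_]_(_ in _) _)%E]/(Rintegral _ _ _) RintegralB// RintegralZl// -EFinB/=.
  move=> h.
  have IE y : I y n = (\int[mu]_(t in `[a n, b n]) gamma_fun y t)%:E.
    by rewrite /I /Rintegral fineK//; apply: integrable_fin_num => //; exact: iy.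
  by rewrite !IE -EFinM -EFinD -h; congr EFin; ring.
have Fb : gamma_fun (x + 1) (b n) @[n --> \oo] --> (0 : R).
  have [C C0 hC] := gamma_fun_bound x0.
  apply: (@squeeze_cvgr _ _ _ _ (fun=> 0) (fun n => C * expR (- (b n / 2)))).
  - by apply: nearW => n; rewrite ltW ?gamma_fun_gt0//= hC// /b ltr0n.
  - exact: cvg_cst.
  - rewrite -[X in _ --> X](mulr0 C); apply: cvgMr.
    apply: (cvg_comp b (fun t => expR (- (t / 2)))); first exact: cvgr_natS.
    apply: (cvg_comp (fun t => t / 2) (fun t => expR (- t))); last exact: cvgr_expR.
    by apply: gt0_cvgMly; [rewrite invr_gt0|exact: cvg_id].
have Fa : gamma_fun (x + 1) (a n) @[n --> \oo] --> (0 : R).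
  apply: (@squeeze_cvgr _ _ _ _ (fun=> 0) (fun n => expR (- (x * ln (b n))))).
  - apply: nearW => n; rewrite ltW ?gamma_fun_gt0//= /gamma_fun addrK ler_expR.
    have -> : ln (a n) = - ln (b n) by rewrite /a lnV// posrE ltr0n.
    by rewrite mulrN gerBl ltW.
  - exact: cvg_cst.
  - apply: (cvg_comp b (fun t => expR (- (x * ln t)))); first exact: cvgr_natS.
    apply: (cvg_comp (@ln R) (fun t => expR (- (x * t)))); first exact: cvgr_ln.
    apply: (cvg_comp (fun t => x * t) (fun t => expR (- t))); last exact: cvgr_expR.
    by apply: gt0_cvgMry => //; exact: cvg_id.
have l1 : (x%:E * I x n)%E @[n --> \oo] --> (x%:E * Egamma x)%E.
  by apply: cvgeZl => //; exact: cvg_Egamma.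
have l2 : (I (x + 1)%R n + (gamma_fun (x + 1) (b n) - gamma_fun (x + 1) (a n))%:E)%E @[n --> \oo]
    --> Egamma (x + 1).
  rewrite -[X in _ --> X]adde0; apply: cvgeD.
  - by rewrite fin_num_adde_defl.
  - exact: cvg_Egamma.
  - apply/fine_cvgP; split; first exact: nearW.
    by rewrite -(subrr (0 : R)); apply: cvgB.
have l3 : (x%:E * I x n)%E @[n --> \oo] --> Egamma (x + 1).
  apply: cvg_trans l2; apply: near_eq_cvg; near=> n; rewrite id//.
  by near: n; exact: nbhs_infty_gt.
exact: (cvg_unique _ l1 l3).
Unshelve. all: by end_near. Qed.

Lemma Egamma_one_lty : (Egamma 1 < +oo)%E.
Proof.
have c : continuous (fun t : R => expR (- t)).
  by move=> t; apply: continuous_comp; [exact: cvgN|exact: continuous_expR].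
have -> : Egamma 1 = (\int[mu]_(t in `[0%R, +oo[) (expR (- t))%:E)%E.
  rewrite -integral_itv_obnd_cbnd; last first.
    by apply/measurable_EFinP; apply: measurable_funTS; exact: continuous_measurable_fun.
  by apply: eq_integral => t _; rewrite /gamma_fun subrr mul0r sub0r.
have d (t : R) : is_derive t 1 (fun t => - expR (- t)) (expR (- t)).
  by apply: is_derive_eq; rewrite /GRing.scale/=; ring.
rewrite (@ge0_continuous_FTC2y _ _ (fun t => - expR (- t)) 0 0).
- by rewrite -EFinB ltry.
- by move=> t _; exact: expR_ge0.
- exact: continuous_subspaceT.
- by rewrite -oppr0; apply: cvgN; exact: cvgr_expR.
- by move=> t _; have [] := d t.
- by apply: cvg_at_right_filter; apply: cvgN; exact: c.
- by move=> t _; rewrite derive1E; have [_] := d t.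
Qed.

Lemma Egamma_nat_lty n : (Egamma n.+1%:R < +oo)%E.
Proof.
elim: n => [|n IH]; first exact: Egamma_one_lty.
rewrite -natr1 -Egamma_rec ?ltr0n// lte_mul_pinfty ?lee_fin//.
Qed.

(** The integrand for [x + 1] is below that for [1] when [t <= 1] and below that for a large integer
    when [t > 1]. The recursion then descends from [x + 1] to [x], whose own integrand may blow up
    at zero. *)
Lemma Egamma_lty x : 0 < x -> (Egamma x < +oo)%E.
Proof.
move=> x0.
have h : (Egamma (x + 1) < +oo)%E.
  pose N := (Num.truncn (x + 1)).+1%:R : R.
  have xN : x + 1 <= N by exact/ltW/truncnS_gt.
  apply: (@le_lt_trans _ _ (Egamma 1 + Egamma N)%E); last first.
    by rewrite lte_add_pinfty ?Egamma_one_lty ?Egamma_nat_lty.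
  rewrite /Egamma -ge0_integralD//; last 4 first.
  - by move=> t _; rewrite lee_fin ltW ?gamma_fun_gt0.
  - by apply/measurable_EFinP/measurable_funTS; exact: measurable_gamma_fun.
  - by move=> t _; rewrite lee_fin ltW ?gamma_fun_gt0.
  - by apply/measurable_EFinP/measurable_funTS; exact: measurable_gamma_fun.
  apply: ge0_le_integral => //.
  - by move=> t _; rewrite lee_fin ltW ?gamma_fun_gt0.
  - by apply/measurable_EFinP/measurable_funTS; exact: measurable_gamma_fun.
  - by apply/measurable_EFinP/measurable_funTS/measurable_funD; exact: measurable_gamma_fun.
  move=> t; rewrite /= in_itv/= andbT => t0; rewrite -EFinD lee_fin.
  have [t1|t1] := leP t 1.
    rewrite -[leLHS]addr0 lerD ?(ltW (gamma_fun_gt0 _ _))//.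
    rewrite /gamma_fun ler_expR lerD2r subrr mul0r addrK.
    by rewrite mulr_ge0_le0 ?(ltW x0)// ln_le0.
  rewrite -[leLHS]add0r lerD ?(ltW (gamma_fun_gt0 _ _))//.
  rewrite /gamma_fun ler_expR lerD2r ler_wpM2r ?lerD2r//.
  by rewrite ln_ge0// ltW.
rewrite -Egamma_rec// in h.
move: h; have := Egamma_ge0 x; move: (Egamma x) => [g| |]//.
  by move=> _ _; rewrite ltry.
by rewrite mulry gtr0_sg// mul1e => _.
Qed.

Lemma Egamma_Gamma x : 0 < x -> Egamma x = (Gamma x)%:E.
Proof. by move=> x0; rewrite GammaE fineK// ge0_fin_numE ?Egamma_ge0// Egamma_lty. Qed.

Lemma GammaS x : 0 < x -> Gamma (x + 1) = x * Gamma x.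
Proof.
move=> x0; have := Egamma_rec x0; rewrite !Egamma_Gamma ?addr_gt0// -EFinM.
by move=> -[].
Qed.

Lemma Gamma_gt0 x : 0 < x -> 0 < Gamma x.
Proof.
move=> x0; rewrite -lte_fin -Egamma_Gamma//.
pose q : R := expR (- `|x - 1| - 2).
apply: (@lt_le_trans _ _ (\int[mu]_(t in `[1%R, 2%R]) q%:E)%E).
  rewrite integral_cst//= lebesgue_measure_itv/= lte_fin ltr1n -EFinB -EFinM lte_fin.
  by rewrite mulr_gt0 ?expR_gt0// subr_gt0 ltr1n.
apply: (@le_trans _ _ (\int[mu]_(t in `[1%R, 2%R]) (gamma_fun x t)%:E)%E).
  apply: ge0_le_integral => //.
  - by move=> t _; rewrite lee_fin expR_ge0.
  - by apply/measurable_EFinP/measurable_funTS; exact: measurable_gamma_fun.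
  move=> t; rewrite /= in_itv/= => /andP[t1 t2].
  rewrite lee_fin /gamma_fun ler_expR lerB//.
  have t0 : 0 < t by exact: lt_le_trans t1.
  have ln0 : 0 <= ln t by exact: ln_ge0.
  have ln1 : ln t <= 1.
    by have := expR_ge1Dx (ln t); rewrite lnK ?posrE//; lra.
  have : - `|x - 1| <= x - 1 by have := ler_norm (- (x - 1)); rewrite normrN; lra.
  have := normr_ge0 (x - 1); nra.
apply: ge0_subset_integral => //.
- by apply/measurable_EFinP/measurable_funTS; exact: measurable_gamma_fun.
- by move=> t _; rewrite lee_fin ltW ?gamma_fun_gt0.
- by move=> t /=; rewrite !in_itv/= andbT => /andP[/(lt_le_trans ltr01)].
Qed.

(** Concavity of the power: its graph lies under the tangent at [s]. In the variable
    [y = ln (t / s)] it is the combination, with weights [b] and [1 - b], of two instances of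
    [1 + z <= expR z] in which the terms linear in [y] cancel. *)
Lemma powR_tangent (b s t : R) : 0 <= b <= 1 -> 0 < s -> 0 < t ->
  t `^ b <= s `^ b * ((1 - b) + b * (t / s)).
Proof.
move=> /andP[b0 b1] s0 t0.
have -> : t `^ b = s `^ b * (t / s) `^ b.
  by rewrite -powRM ?divr_ge0 ?(ltW s0) ?(ltW t0)// mulrC divfK ?gt_eqF.
rewrite ler_pM2l ?powR_gt0//.
have ts0 : 0 < t / s by rewrite divr_gt0.
pose y := ln (t / s).
have -> : t / s = expR y by rewrite /y lnK.
rewrite /powR gt_eqF ?expR_gt0// expRK.
have h1 : expR (b * y) * (1 + (1 - b) * y) <= expR y.
  have -> : expR y = expR (b * y) * expR ((1 - b) * y) by rewrite -expRD; congr expR; ring.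
  by rewrite ler_pM2l ?expR_gt0// expR_ge1Dx.
have h2 : expR (b * y) * (1 - b * y) <= 1.
  have e1 : expR (b * y) * expR (- (b * y)) = 1 by rewrite -expRD subrr expR0.
  by rewrite -[leRHS]e1 ler_pM2l ?expR_gt0// expR_ge1Dx.
move: (expR (b * y)) (expR y) h1 h2 => p q h1 h2.
have b1' : 0 <= 1 - b by lra.
have := ler_wpM2l b0 h1; have := ler_wpM2l b1' h2; lra.
Qed.

(** Jensen's inequality for the Gamma law with parameter [x]: the tangent to the power [b] is taken
    at the mean [x] of that law, so that its first-order term integrates to zero by [GammaS]. *)
Lemma Gamma_addl_le (b x : R) : 0 <= b <= 1 -> 0 < x ->
  Gamma (x + b) <= x `^ b * Gamma x.
Proof.
move=> b01 x0; have /andP[b0 b1] := b01.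
rewrite -lee_fin -Egamma_Gamma; last by rewrite ltr_wpDr.
have -> : x `^ b * Gamma x = x `^ b * (1 - b) * Gamma x + x `^ b * b / x * Gamma (x + 1).
  by rewrite GammaS//; field; rewrite gt_eqF.
have c1 : 0 <= x `^ b * (1 - b) by rewrite mulr_ge0 ?powR_ge0// subr_ge0.
have c2 : 0 <= x `^ b * b / x by rewrite divr_ge0 ?mulr_ge0 ?powR_ge0// ltW.
rewrite EFinD !EFinM -!Egamma_Gamma ?addr_gt0// /Egamma -!EFinM.
have m (y : R) : measurable_fun (`]0%R, +oo[%classic : set (measurableTypeR R))
    (fun t : measurableTypeR R => (gamma_fun y t)%:E).
  by apply/measurable_EFinP/measurable_funTS; exact: measurable_gamma_fun.
have g0 (y t : R) : (0 <= (gamma_fun y t)%:E)%E by rewrite lee_fin ltW ?gamma_fun_gt0.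
rewrite -!ge0_integralZl// -?ge0_integralD//; last 4 first.
- by move=> t _; apply: mule_ge0; [rewrite lee_fin|exact: g0].
- by apply: emeasurable_funM => //; exact: m.
- by move=> t _; apply: mule_ge0; [rewrite lee_fin|exact: g0].
- by apply: emeasurable_funM => //; exact: m.
apply: ge0_le_integral => //.
- by apply: emeasurable_funD; apply: emeasurable_funM => //; exact: m.
move=> t; rewrite /= in_itv/= andbT => t0.
rewrite -!EFinM -EFinD lee_fin !gamma_funD// powRr1 ?(ltW t0)//.
have := powR_tangent b01 x0 t0 => h.
apply: (le_trans (ler_wpM2r (ltW (gamma_fun_gt0 x t)) h)).
by rewrite le_eqVlt; apply/orP; left; apply/eqP; ring.
Qed.

(** The upper bound is [Gamma_addl_le] at [x]; the lower one is the same inequality with exponent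
    [1 - b] at the point [x + b], which leads to [x + 1]. *)
Lemma Gamma_ratio_bounds (b x : R) : 0 <= b <= 1 -> 0 < x ->
  (x + b) `^ (b - 1) <= Gamma (x + b) / Gamma (x + 1) <= x `^ (b - 1).
Proof.
move=> b01 x0; have /andP[b0 b1] := b01.
have xb0 : 0 < x + b by rewrite ltr_wpDr.
have G1 : 0 < Gamma (x + 1) by rewrite Gamma_gt0 ?addr_gt0.
have Gb : 0 < Gamma (x + b) by rewrite Gamma_gt0.
apply/andP; split; last first.
  rewrite ler_pdivrMr// GammaS// mulrA.
  have -> : x `^ (b - 1) * x = x `^ b.
    rewrite -{2}(powRr1 (ltW x0)) -powRD ?subrK//; by rewrite (gt_eqF x0) implybT.
  exact: Gamma_addl_le.
rewrite ler_pdivlMr//.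
have := @Gamma_addl_le (1 - b) (x + b) _ xb0.
have -> : x + b + (1 - b) = x + 1 by ring.
rewrite subr_ge0 b1 gerBl b0 => /(_ isT) h.
rewrite -opprB powRN mulrC ler_pdivrMr ?powR_gt0// mulrC//.
Qed.

End gamma_function.

(** * Sums of powers against integrals *)

Section power_sums.
Context {R : realType}.
Variable b : R.
Hypothesis b01 : 0 <= b < 1.

Let b0 : 0 <= b. Proof. by have /andP[] := b01. Qed.
Let b1 : b < 1. Proof. by have /andP[] := b01. Qed.

Lemma powR_antitone (a x y : R) : a <= 0 -> 0 < x -> x <= y -> y `^ a <= x `^ a.
Proof.
move=> a0 x0 xy; have y0 : 0 < y := lt_le_trans x0 xy.
rewrite -[a]opprK (powRN y) (powRN x) lef_pV2 ?posrE ?powR_gt0//.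
have na0 : 0 <= - a by rewrite oppr_ge0.
by apply: (@ge0_ler_powR _ _ na0 x y) => //; rewrite nnegrE ltW.
Qed.

Lemma powR_mvt (a x y : R) : 0 < x -> x <= y ->
  exists2 z, x <= z <= y & y `^ a - x `^ a = a * z `^ (a - 1) * (y - x).
Proof.
move=> x0 xy.
have d z : z \in `]x, y[ -> is_derive z 1 (fun t => t `^ a) (a * z `^ (a - 1)).
  by rewrite in_itv/= => /andP[xz _]; apply: is_derive1_powR; exact: lt_trans xz.
have c : {within `[x, y], continuous (fun t => t `^ a)}.
  apply: derivable_within_continuous => z; rewrite in_itv/= => /andP[xz _].
  by have [] := is_derive1_powR a (lt_le_trans x0 xz).
have [z zxy ->] := MVT_segment xy d c.
by exists z => //; move: zxy; rewrite in_itv.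
Qed.

Lemma powR_lip (m y z : R) : 0 < m -> m <= y -> m <= z ->
  `|y `^ (b - 1) - z `^ (b - 1)| <= m `^ (b - 2) * `|y - z|.
Proof.
move=> m0; wlog yz : y z / y <= z.
  move=> h my mz; have [yz|/ltW zy] := leP y z; first exact: h.
  by rewrite distrC (distrC y); exact: h.
move=> my mz; have [t /andP[yt _]] := @powR_mvt (b - 1) _ _ (lt_le_trans m0 my) yz.
rewrite distrC (distrC y) => ->; rewrite normrM ler_wpM2r// normrM.
have -> : b - 1 - 1 = b - 2 by ring.
rewrite (ger0_norm (powR_ge0 _ _)) -[leRHS]mul1r ler_pM ?powR_ge0//.
  by rewrite ler_norml; apply/andP; split; move: b0 b1; lra.
by apply: powR_antitone; [move: b1; lra| |exact: le_trans yt].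
Qed.

(** The exponent is below [-1]: from the second term on, each term is at most an increment of
    [- t ^ (b - 1) / (1 - b)], so the bounds telescope. *)
Lemma sum_powR_sub2 n : \sum_(1 <= k < n.+1) (k%:R : R) `^ (b - 2) <= 1 + (1 - b)^-1.
Proof.
have c0 : 0 < 1 - b by rewrite subr_gt0.
have ind m : \sum_(1 <= k < m.+2) (k%:R : R) `^ (b - 2) <= 1 + (1 - m.+1%:R `^ (b - 1)) / (1 - b).
  elim: m => [|m IH]; first by rewrite big_nat1 !powR1 subrr mul0r addr0.
  rewrite big_nat_recr//=.
  have m0 : (0 : R) < m.+1%:R by rewrite ltr0n.
  have [z /andP[mz zm]] := @powR_mvt (b - 1) m.+1%:R m.+2%:R m0 ltac:(by rewrite ler_nat).
  have -> : (m.+2%:R - m.+1%:R : R) = 1 by rewrite -(natr1 m.+1); ring.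
  have -> : b - 1 - 1 = b - 2 by ring.
  rewrite mulr1 => E.
  have z0 : 0 < z := lt_le_trans m0 mz.
  have : m.+2%:R `^ (b - 2) <= z `^ (b - 2) by apply: powR_antitone => //; move: b1; lra.
  move=> h; apply: (le_trans (lerD IH h)); rewrite -addrA lerD2l.
  rewrite -ler_pdivrMr ?invr_gt0// invrK mulrDl divfK ?gt_eqF//; lra.
case: n => [|n]; first by rewrite big_geq// addr_ge0// invr_ge0 ltW.
by apply: (le_trans (ind n)); rewrite lerD2l -[leRHS]mul1r ler_wpM2r ?invr_ge0 ?(ltW c0)// gerBl powR_ge0.
Qed.

(** A primitive of [t ^ (b - 1)] in both cases; this is why [a_n] is logarithmic for exponent zero
    and a power otherwise. *)
Definition power_primitive (t : R) := if b == 0 then ln t else t `^ b / b.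

Lemma is_derive_power_primitive (t : R) : 0 < t -> is_derive t 1 power_primitive (t `^ (b - 1)).
Proof.
move=> t0; rewrite /power_primitive; case: eqVneq => [->|bn0].
  by rewrite sub0r powR_inv1 ?ltW//; exact: is_derive1_ln.
have d := is_derive1_powR b t0.
have -> : (fun t => t `^ b / b) = (fun t => b^-1 * t `^ b) by apply/funext => x; rewrite mulrC.
have -> : t `^ (b - 1) = b^-1 *: (b * t `^ (b - 1)) by rewrite /GRing.scale/= mulKf.
exact: is_deriveZ.
Qed.

(** Integral comparison for a decreasing function: sum and integral differ by at most [1], and the
    remaining constant is the value of the primitive at the lower limit. *)
Lemma sum_powR_sub1 n : `|\sum_(1 <= k < n.+1) (k%:R : R) `^ (b - 1) - power_primitive n.+1%:R|
  <= 1 + `|power_primitive 1|.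
Proof.
have st k : (k.+2%:R : R) `^ (b - 1) <= power_primitive k.+2%:R - power_primitive k.+1%:R
    <= k.+1%:R `^ (b - 1).
  have k0 : (0 : R) < k.+1%:R by rewrite ltr0n.
  have kk : (k.+1%:R : R) <= k.+2%:R by rewrite ler_nat.
  have d z : z \in `](k.+1%:R : R), k.+2%:R[ -> is_derive z 1 power_primitive (z `^ (b - 1)).
    by rewrite in_itv/= => /andP[xz _]; apply: is_derive_power_primitive; exact: lt_trans xz.
  have c : {within `[(k.+1%:R : R), k.+2%:R], continuous power_primitive}.
    apply: derivable_within_continuous => z; rewrite in_itv/= => /andP[xz _].
    by have [] := is_derive_power_primitive (lt_le_trans k0 xz).
  have [z + ->] := MVT_segment kk d c; rewrite in_itv/= => /andP[z1 z2].
  have -> : (k.+2%:R - k.+1%:R : R) = 1 by rewrite -(natr1 k.+1); ring.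
  have z0 : 0 < z := lt_le_trans k0 z1.
  by rewrite mulr1; apply/andP; split; apply: powR_antitone => //; move: b1; lra.
have ind m : power_primitive m.+1%:R - power_primitive 1 <=
     \sum_(1 <= k < m.+1) (k%:R : R) `^ (b - 1) <=
     power_primitive m.+1%:R - power_primitive 1 + 1 - m.+1%:R `^ (b - 1).
  elim: m => [|m /andP[i1 i2]]; first by rewrite big_geq// powR1; apply/andP; split; lra.
  by rewrite big_nat_recr//=; have /andP[s1 s2] := st m; apply/andP; split; lra.
have /andP[i1 i2] := ind n.
have : 0 <= (n.+1%:R : R) `^ (b - 1) by exact: powR_ge0.
have := ler_norm (power_primitive 1); have := ler_norm (- power_primitive 1); rewrite normrN.
by move=> h1 h2 h3; rewrite ler_norml; apply/andP; split; lra.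
Qed.

End power_sums.

(** * The rate of new points and its deterministic target *)

Section rates.
Context {R : realType}.
Variables (alpha beta c u r : R).
Hypotheses (alpha0 : 0 < alpha) (beta01 : 0 <= beta < 1) (cbeta : - beta < c)
  (umax : Num.max beta 0 < u) (ur : u <= r).

Let b0 : 0 <= beta. Proof. by have /andP[] := beta01. Qed.
Let b1 : beta < 1. Proof. by have /andP[] := beta01. Qed.
Let ub : beta < u. Proof. by move: umax; rewrite gt_max => /andP[]. Qed.
Let u0 : 0 < u. Proof. by move: umax; rewrite gt_max => /andP[]. Qed.
Let r0 : 0 < r. Proof. exact: lt_le_trans ur. Qed.
Let cu0 : 0 < c + u. Proof. by move: cbeta ub; lra. Qed.

(** The leading constant: for a large sum [S] of the weights the rate of new points behaves like
    [kappa] times [S] to the power [beta - 1]. *)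
Definition kappa := alpha * Gamma (c + 1) / Gamma (c + beta).

Definition new_rate (S : R) :=
  alpha * (Gamma (c + 1) * Gamma (c + beta + S)) / (Gamma (c + beta) * Gamma (c + 1 + S)).

Let Gb0 : 0 < Gamma (c + beta). Proof. by apply: Gamma_gt0; move: cbeta; lra. Qed.
Let G10 : 0 < Gamma (c + 1). Proof. by apply: Gamma_gt0; move: cbeta b1; lra. Qed.

Lemma kappa_gt0 : 0 < kappa.
Proof. by apply: divr_gt0; [apply: mulr_gt0; [exact: alpha0|exact: G10]|exact: Gb0]. Qed.

Lemma new_rateE S : new_rate S = kappa * (Gamma ((c + S) + beta) / Gamma ((c + S) + 1)).
Proof.
rewrite /new_rate /kappa (_ : c + beta + S = c + S + beta); last by ring.
rewrite (_ : c + 1 + S = c + S + 1); last by ring.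
move: (Gamma (c + 1)) (Gamma (c + beta)) (Gamma (c + S + beta)) (Gamma (c + S + 1)) => x y z t.
by rewrite invfM; ring.
Qed.

Lemma new_rate0 : new_rate 0 = alpha.
Proof.
rewrite /new_rate !addr0; move: (Gamma (c + 1)) (Gamma (c + beta)) G10 Gb0 => x y x0 y0.
by field; rewrite !gt_eqF.
Qed.

Lemma new_rate_bounds S : u <= S -> 0 <= new_rate S <= kappa * (c + u) `^ (beta - 1).
Proof.
move=> uS; have x0 : 0 < c + S by move: cu0; lra.
have b01 : 0 <= beta <= 1 by rewrite b0 ltW.
have /andP[h1 h2] := Gamma_ratio_bounds b01 x0.
rewrite new_rateE; apply/andP; split.
  apply: mulr_ge0; first exact/ltW/kappa_gt0.
  by apply: le_trans h1; exact: powR_ge0.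
apply: ler_wpM2l; first exact/ltW/kappa_gt0.
apply: (le_trans h2).
by apply: powR_antitone => //; [move: b1; lra|lra].
Qed.

(* The value at [0] is arbitrary: it only affects the first error term. *)
Definition target_rate (k : nat) : R := if k is 0 then 0 else kappa * (k%:R * r) `^ (beta - 1).

Lemma target_rate_ge0 k : 0 <= target_rate k.
Proof. by case: k => // k; apply: mulr_ge0; [exact/ltW/kappa_gt0|exact: powR_ge0]. Qed.

(** By [Gamma_ratio_bounds] the rate lies between multiples of two powers, with bases [c + S + beta]
    and [c + S]; [powR_lip] compares each with the base [k * r]. The bases differ from it by at most
    a constant plus [k * |S / k - r|], and the constant produces the term with exponent
    [beta - 2]. *)
Lemma new_rate_diff : exists2 C, 0 <= C & forall k S, (0 < k)%N -> u * k%:R <= S ->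
  `|new_rate S - target_rate k| <=
    C * (k%:R `^ (beta - 1) * `|S / k%:R - r| + k%:R `^ (beta - 2)).
Proof.
(* With [del <= u] and [del <= c + u], both [c + S] and [k * r] stay above [del * k] whatever the
   sign of [c]; [powR_lip] needs such a common lower bound. *)
have [del del0 [delu delcu]] : exists2 del, 0 < del & del <= u /\ del <= c + u.
  by exists (Num.min u (c + u)); [rewrite lt_min u0|rewrite !ge_min !lexx orbT].
pose C := kappa * (del `^ (beta - 2) * (`|c| + 1)).
exists C.
  apply: mulr_ge0; first exact/ltW/kappa_gt0.
  by apply: mulr_ge0; [exact: powR_ge0|exact: addr_ge0].
move=> [//|k] S _; rewrite [target_rate _]/=.
have : 1 <= k.+1%:R :> R by rewrite ler1n.
move: (k.+1%:R : R) => n n1 uS.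
have n0 : 0 < n by exact: lt_le_trans n1.
have dn : del * n <= c + S.
  have [cp|cn] := leP 0 c.
    apply: (@le_trans _ _ (u * n)); first by rewrite ler_wpM2r ?(ltW n0).
    by rewrite (le_trans uS)// lerDr.
  apply: (@le_trans _ _ ((c + u) * n)); first by rewrite ler_wpM2r ?(ltW n0).
  rewrite mulrDl; apply: lerD => //.
  by rewrite -[leRHS]mulr1 ler_wnM2l// ltW.
have dr : del * n <= n * r.
  by rewrite mulrC ler_wpM2l ?(ltW n0)// (le_trans delu).
have x0 : 0 < c + S by apply: lt_le_trans dn; rewrite mulr_gt0.
have m0 : 0 < del * n by rewrite mulr_gt0.
have b01 : 0 <= beta <= 1 by rewrite b0 ltW.
have /andP[h1 h2] := Gamma_ratio_bounds b01 x0.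
set rho := _ / _ in h1 h2.
pose q := `|S / n - r|.
have q0 : 0 <= q by exact: normr_ge0.
have SE : S - n * r = n * (S / n - r) by field; rewrite gt_eqF.
have absS : `|S - n * r| = n * q by rewrite SE normrM (gtr0_norm n0).
have d1 : `|c + S - n * r| <= (`|c| + 1) * (1 + n * q).
  have : `|c + S - n * r| <= `|c| + n * q by rewrite -absS -addrA ler_normD.
  have nq0 : 0 <= n * q by rewrite mulr_ge0// ltW.
  have := mulr_ge0 (normr_ge0 c) nq0; lra.
have d2 : `|c + S + beta - n * r| <= (`|c| + 1) * (1 + n * q).
  have -> : c + S + beta - n * r = c + beta + (S - n * r) by ring.
  have : `|c + beta + (S - n * r)| <= `|c| + beta + n * q.
    rewrite -absS (le_trans (ler_normD _ _))// lerD2r (le_trans (ler_normD _ _))//.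
    by rewrite lerD2l ger0_norm.
  have nq0 : 0 <= n * q by rewrite mulr_ge0// ltW.
  have := mulr_ge0 (normr_ge0 c) nq0; move: b1; lra.
have l1 := powR_lip beta01 m0 dn dr.
have l2 := @powR_lip _ _ beta01 _ (c + S + beta) _ m0 ltac:(by apply: (le_trans dn); rewrite lerDl) dr.
have nE : (del * n) `^ (beta - 2) = del `^ (beta - 2) * n `^ (beta - 2).
  by rewrite powRM// ltW.
have n21 : n `^ (beta - 2) * n = n `^ (beta - 1).
  rewrite -{2}(powRr1 (ltW n0)) -powRD; last by rewrite (gt_eqF n0) implybT.
  by congr (_ `^ _); ring.
pose B := del `^ (beta - 2) * (`|c| + 1) * (n `^ (beta - 1) * q + n `^ (beta - 2)).
have BE t : `|t - n * r| <= (`|c| + 1) * (1 + n * q) ->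
    (del * n) `^ (beta - 2) * `|t - n * r| <= B.
  move=> h; apply: (@le_trans _ _ ((del * n) `^ (beta - 2) * ((`|c| + 1) * (1 + n * q)))).
    by rewrite ler_wpM2l ?powR_ge0.
  by rewrite nE /B -n21 le_eqVlt; apply/orP; left; apply/eqP; ring.
have rhoB : `|rho - (n * r) `^ (beta - 1)| <= B.
  move: (le_trans l1 (BE _ d1)) (le_trans l2 (BE _ d2)).
  rewrite !ler_norml => /andP[a1 a2] /andP[a3 a4].
  by apply/andP; split; lra.
rewrite new_rateE -/rho -mulrBr normrM (gtr0_norm kappa_gt0).
by rewrite /C -(mulrA kappa); apply: ler_wpM2l; [exact/ltW/kappa_gt0|exact: rhoB].
Qed.

Lemma lambda_beta_gt0 : 0 < lambda_beta alpha beta c r.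
Proof.
rewrite /lambda_beta; case: eqVneq => [be0|bn0].
  by rewrite divr_gt0// mulr_gt0//; move: cbeta; rewrite be0; lra.
by rewrite divr_gt0 ?kappa_gt0// mulr_gt0 ?powR_gt0// lt_neqAle eq_sym bn0.
Qed.

(** The two cases become one formula: for [beta = 0] the constant [kappa] equals [alpha * c],
    because [Gamma (c + 1) = c * Gamma c]. *)
Lemma lambda_beta_a_n n : (0 < n)%N -> lambda_beta alpha beta c r * a_n beta n =
  kappa * r `^ (beta - 1) * power_primitive beta n%:R.
Proof.
move=> n0; rewrite /lambda_beta /a_n /power_primitive; case: eqVneq => [be0|bn0].
  have c0 : 0 < c by move: cbeta; rewrite be0; lra.
  rewrite /kappa be0 addr0 GammaS// sub0r powR_inv1 ?ltW//.
  have := Gamma_gt0 c0; move: (Gamma c) => g g0; field.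
  by rewrite (gt_eqF r0) gt_eqF.
rewrite -opprB powRN /kappa.
move: (Gamma (c + 1)) (Gamma (c + beta)) Gb0 => x y y0; field.
by rewrite bn0 (gt_eqF y0) gt_eqF ?powR_gt0.
Qed.

End rates.

Section a_n_infinity.
Context {R : realType}.
Variables (beta : R).
Hypothesis beta01 : 0 <= beta < 1.

Lemma a_n_ge0 n : 0 <= a_n beta n.
Proof.
rewrite /a_n; case: ifP => _; last exact: powR_ge0.
by case: n => [|n]; [rewrite ln0|rewrite ln_ge0// ler1n].
Qed.

Lemma a_n_cvgy : a_n beta n @[n --> \oo] --> +oo.
Proof.
have /andP[b0 b1] := beta01.
have lnoo : (ln n%:R : R) @[n --> \oo] --> +oo.
  by apply: (cvg_comp (fun n => n%:R) (@ln R)); [exact: cvgr_idn|exact: cvgr_ln].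
rewrite /a_n; case: eqVneq => [//|bn0].
have bp : 0 < beta by rewrite lt_neqAle eq_sym bn0.
apply/cvgryPge => A; near=> n.
have n0 : (0 < n)%N by near: n; exact: nbhs_infty_gt.
have lnA : (`|A| + 1) / beta <= ln n%:R.
  by near: n; move/cvgryPge : lnoo; apply.
rewrite /powR gt_eqF ?ltr0n//.
apply: le_trans (expR_ge1Dx _).
rewrite ler_pdivrMr// mulrC in lnA.
by have := ler_norm A; lra.
Unshelve. all: by end_near. Qed.

Lemma sqrt_a_n_gt0 : \forall n \near \oo, 0 < Num.sqrt (a_n beta n).
Proof.
near=> n; rewrite sqrtr_gt0.
have : 1 <= a_n beta n by near: n; move/cvgryPge : a_n_cvgy; apply.
exact: lt_le_trans.
Unshelve. all: by end_near. Qed.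

Lemma inv_sqrt_a_n_cvg0 : (Num.sqrt (a_n beta n))^-1 @[n --> \oo] --> (0 : R).
Proof.
apply/cvgrPdist_le => eps e0; near=> n.
have h : (eps ^+ 2)^-1 <= a_n beta n by near: n; move/cvgryPge : a_n_cvgy; apply.
have e20 : 0 < (eps ^+ 2)^-1 by rewrite invr_gt0 exprn_gt0.
have an0 := lt_le_trans e20 h.
rewrite sub0r normrN ger0_norm ?invr_ge0 ?sqrtr_ge0//.
rewrite -[leRHS]invrK lef_pV2 ?posrE ?invr_gt0 ?sqrtr_gt0//.
rewrite -(ger0_norm (ltW (_ : 0 < eps^-1))) ?invr_gt0// -sqrtr_sqr ler_sqrt ?(ltW an0)//.
by rewrite exprVn.
Unshelve. all: by end_near. Qed.

End a_n_infinity.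

Section rate_sums.
Context {R : realType}.

Lemma nat_sum_decomp (f : nat -> R) n : (0 < n)%N ->
  \sum_(0 <= k < n) f k = f 0%N + \sum_(1 <= k < n) f k.
Proof. by move=> n0; rewrite big_ltn. Qed.

(** Convergence to zero in the extended reals makes the sums finite from some rank on, hence every
    positively weighted term as well; from then on the hypothesis can be used with real numbers. *)
Lemma esum_div_cvg0 (I : nat -> \bar R) (w s : nat -> R) :
  (forall j, (0 <= I j)%E) -> (forall j, (0 < j)%N -> 0 < w j) ->
  (\forall n \near \oo, 0 < s n) ->
  ((\sum_(1 <= j < n.+1) ((w j)%:E * I j)) * ((s n)^-1)%:E)%E @[n --> \oo] --> 0%E ->
  (forall j, (0 < j)%N -> I j \is a fin_num) /\
  (\sum_(1 <= j < n.+1) w j * fine (I j)) / s n @[n --> \oo] --> (0 : R).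
Proof.
move=> I0 w0 s0 cvg0.
have t0 j : (0 < j)%N -> (0 <= (w j)%:E * I j)%E.
  by move=> j0; rewrite mule_ge0// lee_fin ltW// w0.
have fin j : (0 < j)%N -> I j \is a fin_num.
  move=> j0; rewrite ge0_fin_numE// ltey; apply/eqP => Ij.
  have /fine_cvgP[fn _] := cvg0.
  near \oo => n.
  have jn : (j < n.+1)%N by near: n; exact: nbhs_infty_ge.
  have sn : 0 < s n by near: n.
  have : ((\sum_(1 <= j < n.+1) ((w j)%:E * I j)) * ((s n)^-1)%:E)%E \is a fin_num.
    by near: n; exact: fn.
  rewrite (bigD1_seq j)/= ?mem_index_iota ?iota_uniq ?j0//.
  rewrite Ij gt0_muley ?lte_fin ?w0// addye.
    by rewrite gt0_mulye ?lte_fin ?invr_gt0.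
  rewrite -ltNye; apply: (@lt_le_trans _ _ 0%E); first exact: ltNy0.
  rewrite big_seq_cond; apply: sume_ge0 => i /andP[].
  by rewrite mem_index_iota => /andP[i0 _] _; exact: t0.
split=> //; move: cvg0 => /fine_cvg; apply: cvg_trans; apply: near_eq_cvg; apply: nearW => n /=.
rewrite -[RHS]/(fine (_)%:E) EFinM -sumEFin; congr (fine (_ * _)%E).
rewrite !big_nat; apply: eq_bigr => j /andP[j0 _].
by rewrite EFinM fineK// fin.
Unshelve. all: by end_near. Qed.

Variables (alpha beta c u r : R).
Hypotheses (alpha0 : 0 < alpha) (beta01 : 0 <= beta < 1) (cbeta : - beta < c)
  (umax : Num.max beta 0 < u) (ur : u <= r).

Local Notation s n := (Num.sqrt (a_n beta n)).

Lemma target_rate_sum_cvg (sigma : R) : sigma ^+ 2 = lambda_beta alpha beta c r ->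
  (\sum_(0 <= k < n) target_rate alpha beta c r k - sigma ^+ 2 * s n ^+ 2) / s n
    @[n --> \oo] --> (0 : R).
Proof.
move=> sE.
pose K := kappa alpha beta c * r `^ (beta - 1).
pose B := `|K| * (1 + `|power_primitive beta 1|).
apply: norm_cvg0.
apply: (@squeeze_cvgr _ _ _ _ (fun=> 0) (fun n => B * (s n)^-1)); last 2 first.
- exact: cvg_cst.
- rewrite -[X in _ --> X](mulr0 B); apply: cvgMr; exact: inv_sqrt_a_n_cvg0.
near=> n; rewrite normr_ge0/=.
have s0 : 0 < s n by near: n; exact: sqrt_a_n_gt0.
have n0 : (0 < n)%N by near: n; exact: nbhs_infty_gt.
rewrite normrM (ger0_norm (_ : 0 <= (s n)^-1)) ?invr_ge0 ?(ltW s0)//.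
rewrite ler_wpM2r ?invr_ge0 ?(ltW s0)// sqr_sqrtr ?a_n_ge0// sE.
rewrite (lambda_beta_a_n alpha cbeta umax ur n0) nat_sum_decomp// add0r.
have -> : \sum_(1 <= k < n) target_rate alpha beta c r k = K * \sum_(1 <= k < n) k%:R `^ (beta - 1).
  rewrite mulr_sumr !big_nat; apply: eq_bigr => -[//|k] _ /=.
  rewrite powRM ?ler0n//; last by move: umax; rewrite gt_max => /andP[_ /ltW u0]; exact: le_trans ur.
  by rewrite /K; ring.
rewrite -/K -mulrBr normrM ler_wpM2l//.
have -> : n = n.-1.+1 by rewrite prednK.
exact: sum_powR_sub1.
Unshelve. all: by end_near. Qed.

(** The terms with exponent [beta - 2] have bounded sums and the first term is constant, so both
    vanish against the normalisation; the rest is the rate hypothesis. The term [k = 0] is the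
    initial rate [alpha] compared with the target [0]. *)
Lemma error_sum_cvg (C : R) (q : nat -> R) : 0 <= C -> (forall j, 0 <= q j) ->
  (\sum_(1 <= j < n.+1) j%:R `^ (beta - 1) * q j) / s n @[n --> \oo] --> (0 : R) ->
  (\sum_(0 <= k < n) (if k is 0 then alpha
     else C * (k%:R `^ (beta - 1) * q k + k%:R `^ (beta - 2)))) / s n @[n --> \oo] --> (0 : R).
Proof.
move=> C0 q0 hq.
pose D := alpha + C * (1 + (1 - beta)^-1).
apply: (@squeeze_cvgr _ _ _ _ (fun=> 0) (fun n => D * (s n)^-1 +
  C * ((\sum_(1 <= j < n.+1) j%:R `^ (beta - 1) * q j) / s n))); last 2 first.
- exact: cvg_cst.
- rewrite -[X in _ --> X]addr0; apply: cvgD.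
    by rewrite -[X in _ --> X](mulr0 D); apply: cvgMr; exact: inv_sqrt_a_n_cvg0.
  by rewrite -[X in _ --> X](mulr0 C); apply: cvgMr.
near=> n.
have s0 : 0 < s n by near: n; exact: sqrt_a_n_gt0.
have n0 : (0 < n)%N by near: n; exact: nbhs_infty_gt.
have pw (k : nat) a : 0 <= (k%:R : R) `^ a by exact: powR_ge0.
apply/andP; split.
  rewrite divr_ge0 ?(ltW s0)//; apply: sumr_ge0 => -[|k] _; first exact: ltW.
  by rewrite mulr_ge0// addr_ge0// mulr_ge0.
rewrite mulrA -mulrDl ler_wpM2r ?invr_ge0 ?(ltW s0)//.
rewrite nat_sum_decomp// /D -addrA lerD2l.
pose N := n.-1; have -> : n = N.+1 by rewrite prednK.
apply: (@le_trans _ _ (\sum_(1 <= k < N.+1) (C * (k%:R `^ (beta - 1) * q k) + C * k%:R `^ (beta - 2)))).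
  by rewrite !big_nat; apply: ler_sum => -[//|k] _; rewrite mulrDr.
rewrite big_split/= -!mulr_sumr addrC; apply: lerD.
  by rewrite ler_wpM2l// sum_powR_sub2.
by rewrite ler_wpM2l// [leRHS]big_nat_recr//= lerDl mulr_ge0.
Unshelve. all: by end_near. Qed.

End rate_sums.

(** * Finite Borel measures on a separable metric space *)

Section measure_fibers.
Context {R : realType} d {T : measurableType d} (mu : {measure set T -> \bar R}).

Lemma measure_fin_fibers (F : finType) (g : T -> F) (phi : pred F) (V : set T) :
  measurable V -> (forall s, measurable [set x | g x = s]) ->
  mu (V `&` [set x | phi (g x)]) = (\sum_(s | phi s) mu (V `&` [set x | g x = s]))%E.
Proof.
move=> mV mg.
have mVg s : measurable (V `&` [set x | g x = s]) by exact: measurableI.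
have key (r : seq F) : uniq r -> measurable (V `&` [set x | g x \in r]) /\
    mu (V `&` [set x | g x \in r]) = (\sum_(s <- r) mu (V `&` [set x | g x = s]))%E.
  elim: r => [_|s r IH /= /andP[sr /IH[mr rE]]].
    rewrite (_ : _ `&` _ = set0) ?measure0 ?big_nil//.
    by apply/seteqP; split=> // x [].
  have E : V `&` [set x | g x \in s :: r] =
      (V `&` [set x | g x = s]) `|` (V `&` [set x | g x \in r]).
    apply/seteqP; split=> x /=; rewrite inE.
      by move=> [Vx /predU1P[->|xr]]; [left|right].
    by move=> [[Vx ->]|[Vx ->]]; split=> //; rewrite ?eqxx ?orbT.
  have dis : (V `&` [set x | g x = s]) `&` (V `&` [set x | g x \in r]) = set0.
    by apply/seteqP; split=> // x [[_ /= xs] [_ /=]]; rewrite xs (negbTE sr).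
  by rewrite E big_cons; split; [exact: measurableU|rewrite measureU//; congr (_ + _)%E; exact: rE].
have [] := key (enum phi) (enum_uniq _).
rewrite big_enum => _ /= <-; congr (mu (_ `&` _)).
by apply/seteqP; split=> x /=; rewrite mem_enum.
Qed.

End measure_fibers.

(* Library measures require a pointed carrier. *)
Definition pointed_at {T : Type} (x0 : T) : Type := T.

HB.instance Definition _ (T : choiceType) (x0 : T) := Choice.on (pointed_at x0).
HB.instance Definition _ (T : choiceType) (x0 : T) := isPointed.Build (pointed_at x0) x0.

Section borel_measure.
Context {R : realType} (X : pseudoMetricType R) (x0 : X).
Implicit Types mu : set X -> \bar R.
Local Open Scope ereal_scope.

Local Notation T := (g_sigma_algebraType ([set U | open U] : set (set (pointed_at x0)))).

(* [mu] may be anything outside the Borel sets, but a library measure is nonnegative everywhere. *)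
Definition ext_measure mu (h : finite_measure_on (borel_sets X) mu) (A : set T) : \bar R :=
  if `[< borel_sets X A >] then mu A else 0.

Section ext_measure_is_measure.
Variables (mu : set X -> \bar R) (h : finite_measure_on (borel_sets X) mu).

Let ext0 : ext_measure h set0 = 0.
Proof. by rewrite /ext_measure; case: asboolP => // _; have [] := h. Qed.

Let ext_ge0 A : 0 <= ext_measure h A.
Proof. by rewrite /ext_measure; case: asboolP => // BA; have [_ + _ _] := h; exact. Qed.

Let ext_sigma_additive : semi_sigma_additive (ext_measure h).
Proof.
move=> F mF tF mUF.
have BF i : borel_sets X (F i) by exact: mF.
have -> : ext_measure h (\bigcup_n F n) = mu (\bigcup_n F n).
  by rewrite /ext_measure; case: asboolP.
have -> : (fun n => \sum_(0 <= i < n) ext_measure h (F i)) =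
    (fun n => \sum_(0 <= i < n) mu (F i)).
  apply/funext => n; apply: eq_bigr => i _.
  by rewrite /ext_measure; case: asboolP.
by have [_ _ + _] := h; exact.
Qed.

HB.instance Definition _ := isMeasure.Build _ T R (ext_measure h)
  ext0 ext_ge0 ext_sigma_additive.

Lemma ext_measureE (A : set X) : borel_sets X A -> ext_measure h A = mu A.
Proof. by move=> BA; rewrite /ext_measure; case: asboolP. Qed.

End ext_measure_is_measure.

Local Notation B := (borel_sets X).

Lemma borel_open U : open U -> B U. Proof. by move=> oU; exact: sub_sigma_algebra. Qed.

Lemma borelC A : B A -> B (~` A). Proof. exact: (@measurableC _ T). Qed.

Lemma borelI A1 A2 : B A1 -> B A2 -> B (A1 `&` A2). Proof. exact: (@measurableI _ T). Qed.

Lemma borelD A1 A2 : B A1 -> B A2 -> B (A1 `\` A2). Proof. exact: (@measurableD _ T). Qed.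

Lemma borelU A1 A2 : B A1 -> B A2 -> B (A1 `|` A2). Proof. exact: (@measurableU _ T). Qed.

Lemma borelT : B setT. Proof. exact: (@measurableT _ T). Qed.

Lemma borel0 : B set0. Proof. exact: (@measurable0 _ T). Qed.

Lemma borel_bigcup (D : set nat) (F : nat -> set X) : (forall i, D i -> B (F i)) ->
  B (\bigcup_(i in D) F i).
Proof. exact: (@bigcup_measurable _ T). Qed.

Lemma borel_bigcap (F : nat -> set X) : (forall i, B (F i)) -> B (\bigcap_i F i).
Proof. exact: (@bigcapT_measurable _ T). Qed.

Section finite_borel_measure.
Variables (mu : set X -> \bar R) (h : finite_measure_on B mu).

Lemma fmeas_ge0 A : B A -> 0 <= mu A. Proof. by have [_ + _ _] := h; exact. Qed.

Lemma fmeas0 : mu set0 = 0. Proof. by have [] := h. Qed.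

Lemma fmeas_le A1 A2 : B A1 -> B A2 -> A1 `<=` A2 -> mu A1 <= mu A2.
Proof.
move=> B1 B2 A12; rewrite -(ext_measureE h B1) -(ext_measureE h B2).
exact: (@le_measure _ _ T (ext_measure h) A1 A2 (mem_set B1) (mem_set B2) A12).
Qed.

Lemma fmeas_lty A : B A -> mu A < +oo.
Proof.
move=> BA; have [_ _ _] := h; apply: le_lt_trans.
exact: fmeas_le BA borelT (@subsetT _ _).
Qed.

Lemma fmeas_fin A : B A -> mu A \is a fin_num.
Proof. by move=> BA; rewrite ge0_fin_numE ?fmeas_ge0// fmeas_lty. Qed.

Lemma fmeasU A1 A2 : B A1 -> B A2 -> A1 `&` A2 = set0 -> mu (A1 `|` A2) = mu A1 + mu A2.
Proof.
move=> B1 B2 A12; rewrite -(ext_measureE h B1) -(ext_measureE h B2).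
rewrite -(ext_measureE h (borelU B1 B2)).
exact: (@measureU _ _ T (ext_measure h) A1 A2 B1 B2 A12).
Qed.

Lemma fmeas_split A1 A2 : B A1 -> B A2 -> mu A1 = mu (A1 `&` A2) + mu (A1 `\` A2).
Proof.
move=> B1 B2; rewrite -fmeasU ?setUIDK//; [exact: borelI|exact: borelD|].
by apply/seteqP; split=> // x [[_ ?] []].
Qed.

Lemma fmeas_null A1 A2 : B A1 -> B A2 -> A1 `<=` A2 -> mu A2 = 0 -> mu A1 = 0.
Proof.
move=> B1 B2 A12 A20; apply/eqP; rewrite eq_le fmeas_ge0// andbT -A20.
exact: fmeas_le.
Qed.

Lemma fmeas_bigcup_null (F : nat -> set X) : (forall i, B (F i)) ->
  (forall i, mu (F i) = 0) -> mu (\bigcup_i F i) = 0.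
Proof.
move=> BF F0; have BU : B (\bigcup_i F i) by apply: borel_bigcup.
rewrite -(ext_measureE h BU); apply/eqP; rewrite eq_le measure_ge0 andbT.
apply: le_trans (_ : \sum_(0 <= i <oo) ext_measure h (F i) <= 0).
  exact: (@measure_sigma_subadditive _ _ T (ext_measure h)).
rewrite eseries0// => i _ _; rewrite ext_measureE//; exact: F0.
Qed.

Lemma fmeas_fin_fibers (F : finType) (g : X -> F) (phi : pred F) (V : set X) :
  B V -> (forall s, B [set x | g x = s]) ->
  mu (V `&` [set x | phi (g x)]) = \sum_(s | phi s) mu (V `&` [set x | g x = s]).
Proof.
move=> BV Bg.
have Bphi : B [set x | phi (g x)].
  rewrite (_ : [set _ | _] = \bigcup_(s in [set s | phi s]) [set x | g x = s]).
    by apply: (@fin_bigcup_measurable _ T) => [|s _]; [exact: finite_finset|exact: Bg].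
  by apply/seteqP; split=> [x /= px|x [s /= ps /= ->]//]; exists (g x).
rewrite -(ext_measureE h (borelI BV Bphi)).
apply: etrans (@measure_fin_fibers _ _ T (ext_measure h) F g phi V BV Bg) _.
by apply: eq_bigr => s _; exact: ext_measureE (borelI _ _).
Qed.

Lemma fmeas_cvg (F : nat -> set X) : (forall i, B (F i)) ->
  {homo F : n m / (n <= m)%N >-> n `<=` m} ->
  mu (F n) @[n --> \oo] --> mu (\bigcup_n F n).
Proof.
move=> BF ndF; have BU : B (\bigcup_i F i) by apply: borel_bigcup.
rewrite -(ext_measureE h BU).
have := @nondecreasing_cvg_mu _ T _ (ext_measure h) F BF BU.
have -> : ext_measure h \o F = (fun n => mu (F n)).
  by apply/funext => n /=; exact: ext_measureE.
by apply => n m nm; rewrite subsetEset; exact: ndF.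
Qed.

Lemma fmeas_cvg_cap (F : nat -> set X) : (forall i, B (F i)) ->
  {homo F : n m / (n <= m)%N >-> m `<=` n} ->
  mu (F n) @[n --> \oo] --> mu (\bigcap_n F n).
Proof.
move=> BF ndF; have BU : B (\bigcap_i F i) by apply: borel_bigcap.
rewrite -(ext_measureE h BU).
have F0 : ext_measure h (F 0%N) < +oo by rewrite ext_measureE//; exact: fmeas_lty.
have := @nonincreasing_cvg_mu _ T _ (ext_measure h) F F0 BF BU.
have -> : ext_measure h \o F = (fun n => mu (F n)).
  by apply/funext => n /=; exact: ext_measureE.
by apply => n m nm; rewrite subsetEset; exact: ndF.
Qed.

End finite_borel_measure.

End borel_measure.

(** * Countable base and partition into small cells *)

Section countable_base.
Context {R : realType} (X : pseudoMetricType R).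

Definition open_base (G : nat -> set X) := (forall i, open (G i)) /\
  forall x U, open U -> U x -> exists i, G i x /\ G i `<=` U.

Lemma separable_open_base : separable_space X -> exists G, open_base G.
Proof.
move=> [D [cD clD]].
have [e einj] : exists e : X -> nat, {in D &, injective e}.
  by move/countable_injP : cD => [e einj]; exists e.
(* Interiors of balls of radius [1 / (k + 1)] around dense points, indexed by the code of the centre
   and by [k]. The union over the centres with a given code has at most one member and spares an
   inverse of [e]. *)
pose Gp (p : nat * nat) := \bigcup_(x in D `&` [set x | e x = p.1]) (ball x (p.2.+1%:R^-1 : R))^°.
exists (fun n => if unpickle n is Some p then Gp p else set0); split.
  move=> i; case: unpickle => [p|]; last exact: open0.
  by apply: bigcup_open => x _; exact: open_interior.
move=> x U oU Ux.
have /nbhs_ballP[eps /= e0 xU] : nbhs x U by exact: open_nbhs_nbhs.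
pose k := Num.truncn (2 / eps).
have k0 : (0 : R) < k.+1%:R^-1 by rewrite invr_gt0 ltr0n.
have k2 : 2 * (k.+1%:R^-1 : R) <= eps.
  rewrite ler_pdivrMr ?ltr0n// mulrC -ler_pdivrMr//.
  exact/ltW/truncnS_gt.
have kh0 : (0 : R) < k.+1%:R^-1 / 2 by rewrite divr_gt0.
have : closure D x by rewrite clD.
move=> /(_ _ (nbhsx_ballx x _ kh0))[y [Dy xy]].
exists (pickle (e y, k)); rewrite pickleK; split.
  exists y => //; apply/nbhs_ballP; exists (k.+1%:R^-1 / 2) => //= z xz.
  have := ball_triangle (ball_sym xy) xz.
  by rewrite -splitr.
move=> z [y' [Dy' /= ey']] /interior_subset y'z; apply: xU.
have yy' : y' = y by apply: einj => //; exact: mem_set.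
rewrite yy' in y'z.
have := ball_triangle xy y'z; apply: le_ball.
by move: k0 k2; move: (k.+1%:R^-1 : R) => z0; lra.
Qed.

End countable_base.

(** Its fibres are the cells of the partition generated by the first [l] sets. It serves twice: on
    points of the space with the base sets, and on outcomes with events of the past. *)
Definition signature (T : Type) (G : nat -> set T) l (x : T) : {ffun 'I_l -> bool} :=
  [ffun i : 'I_l => `[< G i x >]].

Section signature_measurability.
Context d {Omega : measurableType d} (H : nat -> set Omega).
Hypothesis mH : forall i, measurable (H i).

Lemma measurable_signature k s : measurable [set w | signature H k w = s].
Proof.
pose F (i : nat) : set Omega := if insub i is Some j then
  (if s j then H (j : 'I_k) else ~` H j) else setT.
rewrite (_ : [set _ | _] = \bigcap_i F i).
  apply: bigcapT_measurable => i; rewrite /F; case: insub => [j|//].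
  by case: (s j); [|apply: measurableC]; exact: mH.
apply/seteqP; split=> [x /= xs i _|x Fx /=].
  rewrite /F; case: insub => [j|]//; rewrite -xs ffunE.
  by case: asboolP.
apply/ffunP => j; rewrite ffunE.
have := Fx (j : nat) I; rewrite /F valK.
by case: (s j) => [/asboolT|/asboolF].
Qed.

End signature_measurability.

Section cells.
Context {R : realType} (X : pseudoMetricType R) (x0 : X).
Variable G : nat -> set X.
Hypothesis hX : hausdorff_space X.
Hypothesis hG : open_base G.
Local Open Scope ereal_scope.
Local Notation B := (borel_sets X).

Lemma borel_set1 (x : X) : B [set x].
Proof.
rewrite -[X in B X]setCK; apply: (borelC x0); apply: borel_open.
by rewrite openC; exact/accessible_closed_set1/hausdorff_accessible.
Qed.

Lemma borel_finite (A : set X) : finite_set A -> B A.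
Proof.
move=> fA; rewrite -[X in B X]setCK; apply: (borelC x0); apply: borel_open.
rewrite openC; exact: (accessible_finite_set_closed.1 (hausdorff_accessible hX)).
Qed.

Lemma open_base_sep (x y : X) : (forall i, G i x -> G i y) -> x = y.
Proof.
move=> xy; apply/eqP; apply: contrapT => /negP nxy.
have oU : open (~` [set y]).
  by rewrite openC; exact/accessible_closed_set1/hausdorff_accessible.
have nxy' : (~` [set y]) x by move=> /= e; rewrite e eqxx in nxy.
have [i [Gx GU]] := hG.2 x _ oU nxy'.
exact: (GU _ (xy _ Gx)).
Qed.

Lemma borel_base i : B (G i). Proof. exact: (borel_open (hG.1 i)). Qed.

Lemma borel_cell l s : B [set x | signature G l x = s].
Proof.
exact: (@measurable_signature _ (g_sigma_algebraType ([set U | open U] : set (set (pointed_at x0))))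
  G borel_base l s).
Qed.

(** Every point lies in a base set of mass at most [eps], because neighbourhoods of [x] shrink to
    the null set [[set x]]. The part not covered by such light sets among the first [l] decreases to
    the empty set, hence is eventually light; a cell of level [l] lies either in a light base set or
    in this part. *)
Lemma cells_small (m : set X -> \bar R) : finite_measure_on B m -> diffuse m ->
  forall eps : R, (0 < eps)%R -> exists l0, forall l, (l0 <= l)%N ->
  forall s : {ffun 'I_l -> bool}, m [set x | signature G l x = s] <= eps%:E.
Proof.
move=> hm dm eps e0.
have BI i : B (if `[< m (G i) <= eps%:E >] then G i else set0).
  by case: ifP => _; [exact: borel_base|exact: (borel0 x0)].
pose A i : set X := if `[< m (G i) <= eps%:E >] then G i else set0.
have cov x : exists i, A i x.
  (* The base sets around [x] are not nested, but their finite intersections are; being open, each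
     of these contains a base set around [x]. *)
  pose F k := \bigcap_j (if ((j <= k)%N && `[< G j x >]) then G j else setT).
  have BF k : B (F k).
    apply: (borel_bigcap x0) => j; case: ifP => _; [exact: borel_base|exact: (borelT x0)].
  have oF k : open (F k).
    rewrite (_ : F k = \bigcap_(j in `I_k.+1) (if `[< G j x >] then G j else setT)).
      rewrite bigcap_mkord; apply: (big_ind open); [exact: openT|exact: openI|].
      by move=> i _; case: ifP => _; [exact: hG.1|exact: openT].
    apply/seteqP; split=> y Fy j.
      by move=> /= jk; have := Fy j I; move: jk; rewrite ltnS => ->.
    move=> _; case: ifP => // /andP[jk Gj]; have := Fy j; rewrite /= ltnS => /(_ jk).
    by rewrite Gj.
  have capF : \bigcap_k F k = [set x].
    apply/seteqP; split=> [y Fy /=|y /= -> k _ j _].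
      apply/esym; apply: open_base_sep => i Gix; have := Fy i I i I.
      by rewrite leqnn/=; case: asboolP.
    by case: ifP => // /andP[_ /asboolP].
  have hF : {homo F : n k / (n <= k)%N >-> k `<=` n}.
    move=> n k nk y Fy j _; have := Fy j I; case: ifP => //; case: ifP => // /andP[jn Gj].
    by rewrite (leq_trans jn nk) Gj.
  have cF := fmeas_cvg_cap x0 hm BF hF; rewrite capF dm in cF.
  have : \forall k \near \oo, m (F k) < eps%:E.
    by apply: (cF [set z | z < eps%:E]); apply: open_ereal_lt'; rewrite lte_fin.
  move=> [k _ /(_ k (leqnn k)) /= mFk].
  have Fkx : F k x by move=> j _; case: ifP => // /andP[_ /asboolP].
  have [i [Gx GF]] := hG.2 x _ (oF k) Fkx.
  exists i; rewrite /A; case: asboolP => // -[].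
  by apply: le_trans (ltW mFk); exact: (fmeas_le x0 hm (borel_base i) (BF k)).
pose C k := \bigcap_i (if (i < k)%N then ~` A i else setT).
have BC k : B (C k).
  apply: (borel_bigcap x0) => j; case: ifP => _; [apply: (borelC x0); exact: BI|exact: (borelT x0)].
have hC : {homo C : n k / (n <= k)%N >-> k `<=` n}.
  move=> n k nk y Fy j _; have := Fy j I; case: ifP => //; case: ifP => // jn.
  by rewrite (leq_trans jn nk).
have cC := fmeas_cvg_cap x0 hm BC hC; move: cC.
have -> : \bigcap_k C k = set0.
  apply/seteqP; split=> // y Cy; have [i Ai] := cov y.
  by have := Cy i.+1 I i I; rewrite ltnSn.
rewrite (fmeas0 hm) => cC.
have : \forall k \near \oo, m (C k) < eps%:E.
  by apply: (cC [set z | z < eps%:E]); apply: open_ereal_lt'; rewrite lte_fin.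
move=> [l0 _ mC]; exists l0 => l ll0 s.
have [[j [sj mj]]|ns] := pselect (exists j : 'I_l, s j /\ m (G j) <= eps%:E).
  apply: le_trans mj; apply: (fmeas_le x0 hm); [exact: borel_cell|exact: borel_base|].
  by move=> x /= xs; move: sj; rewrite -xs ffunE => /asboolP.
apply: le_trans (ltW (mC l ll0)).
apply: (fmeas_le x0 hm); [exact: borel_cell|exact: BC|].
move=> x /= xs i _; case: ifP => // il; rewrite /A; case: asboolP => [mi Gx|_ []].
apply: ns; exists (Ordinal il); split=> //; rewrite -xs ffunE.
exact/asboolP.
Qed.

End cells.

(** * Atomicity of measures with cell masses zero or one *)

Section zero_one.
Context {R : realType} (X : pseudoMetricType R) (x0 : X).
Variable G : nat -> set X.
Hypothesis hX : hausdorff_space X.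
Hypothesis hG : open_base G.
Local Open Scope ereal_scope.
Local Notation B := (borel_sets X).
Variables (mu : set X -> \bar R) (hmu : finite_measure_on B mu).

Lemma finite_unit_atoms : finite_set [set x | mu [set x] = 1].
Proof.
apply: contrapT => /infiniteP/(@pcard_leP _ (pointed_at x0) _ _)/unsquash f.
have [_ _ + muy] := hmu.
pose F (i : nat) : set X := [set (f i : X)]; have BF i : B (F i) by exact: (borel_set1 x0 hX).
have tF : trivIset setT F.
  apply/trivIsetP => i j _ _ ij; apply/seteqP; split=> // x [/= -> /= fij].
  by move/eqP: ij; apply; apply: (@inj _ _ _ f); rewrite ?inE.
move=> /(_ F BF tF).
have sE n : \sum_(0 <= i < n) mu (F i) = n%:R%:E.
  elim: n => [|n IH]; first by rewrite big_geq.
  have fn : mu [set f n] = 1 by have := @funS _ _ _ _ f n I.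
  by rewrite big_nat_recr//= IH /F fn -EFinD natr1.
under eq_fun do rewrite sE.
have BU : B (\bigcup_i F i) by exact: (borel_bigcup x0).
have := fmeas_fin x0 hmu BU; case: (mu _) => // z _ cz.
have /cvgryPge : (n%:R : R)%R @[n --> \oo] --> +oo%R by exact: cvgr_idn.
move=> /(_ (z + 1)%R) h1.
have h2 : \forall n \near \oo, (n%:R%:E : \bar R) < (z + 1)%:E.
  by apply: (cz [set t | t < (z + 1)%:E]); apply: open_ereal_lt'; rewrite lte_fin ltrDl.
have [n []] : exists n : nat, (z + 1 <= n%:R)%R /\ ((n%:R : R)%:E < (z + 1)%:E).
  by near \oo => n; exists n; split; near: n.
by rewrite lte_fin => a /(le_lt_trans a); rewrite ltxx.
Unshelve. all: by end_near. Qed.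

Lemma sum_zero_one (F : finType) (phi : pred F) (f : F -> \bar R) :
  (forall s, f s = 0 \/ f s = 1) ->
  exists k : nat, \sum_(s | phi s) f s = k%:R%:E.
Proof.
move=> f01; apply: (big_ind (fun z : \bar R => exists k : nat, z = k%:R%:E)).
- by exists 0%N.
- by move=> _ _ [a ->] [b ->]; exists (a + b)%N; rewrite natrD.
- by move=> s _; have [->|->] := f01 s; [exists 0%N|exists 1%N].
Qed.

(** For each base set, the half of [W] of mass zero is discarded. What is left still has mass one,
    hence is nonempty, and any two of its points belong to the same base sets, which separate
    points. *)
Lemma unit_mass_atom (W : set X) : B W -> mu W = 1 ->
  (forall i, mu (W `&` G i) = 0 \/ mu (W `&` G i) = 1) ->
  exists x, [/\ W x, mu [set x] = 1 & mu (W `\` [set x]) = 0].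
Proof.
move=> BW W1 WG.
pose F i := if `[< mu (W `&` G i) = 0 >] then W `&` G i else W `\` G i.
have BG i : B (G i) by exact: (borel_base hG).
have BF i : B (F i).
  by rewrite /F; case: ifP => _; [exact: (borelI x0)|exact: (borelD x0)].
have F0 i : mu (F i) = 0.
  rewrite /F; case: asboolP => // n0; have [//|e1] := WG i.
  have := fmeas_split x0 hmu BW (BG i); rewrite W1 e1.
  have := fmeas_fin x0 hmu (borelD x0 BW (BG i)); case: (mu _) => // z _ [].
  by move=> /eqP; rewrite -subr_eq0 opprD addrA subrr add0r oppr_eq0 => /eqP ->.
have N0 := fmeas_bigcup_null x0 hmu BF F0; set N := \bigcup_i _ in N0.
have BN : B N by exact: (borel_bigcup x0).
have WN : mu (W `\` N) = 1.
  have := fmeas_split x0 hmu BW BN; rewrite W1 (fmeas_null x0 hmu _ _ _ N0) ?add0e//.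
  exact: (borelI x0).
have [x [Wx Nx]] : W `\` N !=set0.
  apply/set0P/eqP => e; move: WN; rewrite e (fmeas0 hmu) => /eqP.
  by rewrite eq_sym onee_eq0.
have WNx : W `\` N = [set x].
  apply/seteqP; split=> [y [Wy Ny] /=|_ -> //].
  apply/esym; apply: (open_base_sep hX hG) => i Gix; apply: contrapT => Giy.
  have [e|e] := pselect (mu (W `&` G i) = 0).
    by apply: Nx; exists i => //; rewrite /F asboolT.
  by apply: Ny; exists i => //; rewrite /F asboolF.
exists x; split=> //; first by rewrite -WNx.
apply: (fmeas_null x0 hmu) N0 => //; first by apply: (borelD x0) => //; exact: (borel_set1 x0 hX).
rewrite -WNx => y [Wy /not_andP[//|]]; by move=> /contrapT.
Qed.

(** A cell of mass one is a unit atom up to a null set: at a finer good level its intersection with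
    a given base set is a finite union of cells of mass zero or one, so this intersection has
    integer mass at most one, and [unit_mass_atom] applies. *)
Lemma zero_one_cells_atomic (V : set X) : B V ->
  (forall l0, exists2 l, (l0 <= l)%N & forall s : {ffun 'I_l -> bool},
     mu (V `&` [set x | signature G _ x = s]) = 0 \/
     mu (V `&` [set x | signature G _ x = s]) = 1) ->
  mu (V `\` [set x | mu [set x] = 1]) = 0.
Proof.
move=> BV good; set T1 := [set x | _].
have BT : B T1 := borel_finite x0 hX finite_unit_atoms.
have BC l s : B [set x | signature G _ x = s :> {ffun 'I_l -> bool}] by exact: (borel_cell x0 hG).
have [l _ gl] := good 0%N.
have key s : mu ((V `\` T1) `&` [set x | signature G _ x = s :> {ffun 'I_l -> bool}]) = 0.
  set C := [set x | _]; have BVC : B (V `&` C) := borelI x0 BV (BC l s).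
  have BL : B ((V `\` T1) `&` C) by exact: (borelI x0 (borelD x0 BV BT) (BC l s)).
  have [e0|e1] := gl s.
    by apply: (fmeas_null x0 hmu) e0 => // x [[]].
  have [i|x [_ x1 xn]] := unit_mass_atom BVC e1.
    have [l' il' gl'] := good (maxn i.+1 l).
    have il : (i < l')%N by apply: leq_trans il'; rewrite leq_max leqnn.
    have ll : (l <= l')%N by apply: leq_trans il'; rewrite leq_max leqnn orbT.
    (* The finer cells that lie inside both the given cell and [G i]. *)
    pose phi (s' : {ffun 'I_l' -> bool}) :=
      [forall j : 'I_l, s' (widen_ord ll j) == s j] && s' (Ordinal il).
    have E : V `&` C `&` G i = V `&` [set x | phi (signature G _ x)].
      rewrite -setIA; congr (_ `&` _); apply/seteqP; split=> x /=.
        move=> [/= xs Gx]; apply/andP; split; last by rewrite ffunE; exact/asboolP.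
        by apply/forallP => j; rewrite -xs !ffunE.
      move=> /andP[/forallP xs]; rewrite ffunE => /asboolP Gx; split=> //=.
      by apply/ffunP => j; rewrite -(eqP (xs j)) !ffunE.
    have [k kE] := sum_zero_one phi gl'.
    have : mu (V `&` C `&` G i) = k%:R%:E.
      by rewrite E; apply: etrans (fmeas_fin_fibers x0 hmu phi BV (BC l')) kE.
    have : mu (V `&` C `&` G i) <= 1.
      rewrite -e1; apply: (fmeas_le x0 hmu (borelI x0 BVC (borel_base hG i)) BVC).
      by move=> ? [].
    move=> /[swap] ->; rewrite lee_fin lern1.
    case: k {kE} => [|[|//]] _; first by left.
    by right.
  apply: (fmeas_null x0 hmu) xn => //.
    by apply: (borelD x0) => //; exact: (borel_set1 x0 hX).
  move=> y [[Vy T1y] Cy]; split=> // /= yx; apply: T1y; by rewrite yx.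
have := fmeas_fin_fibers x0 hmu predT (borelD x0 BV BT) (BC l).
rewrite (_ : [set x | _] = setT) ?setIT; last by apply/seteqP; split.
by move=> ->; rewrite big1.
Qed.

Lemma unit_atoms_mass (A : set X) : finite_set A -> (forall x, A x -> mu [set x] = 1) ->
  mu A = \esum_(x in A) 1.
Proof.
move=> fA A1; have BA : B A by exact: (borel_finite x0 hX).
have -> : \esum_(x in A) (1 : \bar R) = \esum_(x in A) mu [set x].
  by apply: eq_esum => x Ax; rewrite A1.
rewrite esum_fset//; last by move=> x /[!inE] Ax; rewrite A1.
rewrite -(ext_measureE x0 hmu BA).
transitivity (\sum_(x \in A) ext_measure (x0 := x0) hmu [set x]); last first.
  by apply: eq_fsbigr => x _; rewrite ext_measureE//; exact: (borel_set1 x0 hX).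
rewrite -[in LHS](image_id A) -(bigcup_imset1 A id).
apply: (@measure_fin_bigcup _ _ _ (ext_measure (x0 := x0) hmu) (pointed_at x0) A (fun x => [set x]) fA).
  by apply/trivIsetP => i j _ _ ij; apply/seteqP; split=> // x [/= -> /eqP]; apply/negP.
by move=> i _; exact: (borel_set1 x0 hX).
Qed.

End zero_one.

Section free_part.
Context {R : realType} (X : pseudoMetricType R) (x0 : X).
Variable G : nat -> set X.
Hypothesis hG : open_base G.
Local Open Scope ereal_scope.
Local Notation B := (borel_sets X).

Definition pattern_union k (s : {ffun 'I_k -> bool}) : set X :=
  \bigcup_(i in [set i : 'I_k | s i]) G i.

Lemma borel_pattern_union k (s : {ffun 'I_k -> bool}) : B (pattern_union s).
Proof.
apply: borel_open; apply: bigcup_open => i _; exact: hG.1.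
Qed.

(** The intended [H i] says that [G i] holds no old point. The union takes finitely many values,
    each on an event of the past, so that statements on fixed Borel sets apply to it piecewise. *)
Definition free_part {Omega : Type} (H : nat -> set Omega) k (w : Omega) : set X :=
  pattern_union (signature H k w).

(* The sets [free_part H k w] increase with [k] and, for the intended [H], exhaust the complement of
   the old points, so their masses are eventually the number of new points. *)
Definition new_count {Omega : Type} (H : nat -> set Omega) (mu : Omega -> set X -> \bar R)
    (w : Omega) : nat :=
  xget 0%N [set b | exists k0, forall k, (k0 <= k)%N -> mu w (free_part H k w) = b%:R%:E].

Lemma new_countE {Omega : Type} (H : nat -> set Omega) (mu : Omega -> set X -> \bar R) w b k0 :
  (forall k, (k0 <= k)%N -> mu w (free_part H k w) = b%:R%:E) -> new_count H mu w = b.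
Proof.
move=> hb; apply: xget_unique; first by exists k0.
move=> y [k1 hy]; have := hb _ (leq_maxl k0 k1); rewrite (hy _ (leq_maxr k0 k1)).
by move=> -[/eqP]; rewrite eqr_nat => /eqP.
Qed.

Section measurability.
Context d {Omega : measurableType d} (H : nat -> set Omega) (mu : Omega -> set X -> \bar R).
Hypothesis mH : forall i, measurable (H i).
Hypothesis mmu : forall A, B A -> measurable_fun setT (fun w => mu w A).

Lemma measurable_free_part_eq k (b : nat) : measurable [set w | mu w (free_part H k w) = b%:R%:E].
Proof.
rewrite (_ : [set _ | _] = \bigcup_(s in [set: {ffun 'I_k -> bool}])
    ([set w | signature H k w = s] `&` [set w | mu w (pattern_union s) = b%:R%:E])).
  apply: fin_bigcup_measurable => [|s _]; first exact: finite_finset.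
  apply: measurableI; first exact: measurable_signature.
  rewrite -[X in measurable X]setTI.
  exact: (mmu (borel_pattern_union s) measurableT (emeasurable_set1 (b%:R%:E))).

apply/seteqP; split=> [w /= wb|w [s _ [/= <-]]//].
by exists (signature H k w).
Qed.

Lemma measurable_new_count b : measurable [set w | new_count H mu w = b].
Proof.
pose W c := \bigcup_k0 \bigcap_(k in [set k | (k0 <= k)%N])
  [set w | mu w (free_part H k w) = c%:R%:E].
have mW c : measurable (W c).
  apply: bigcup_measurable => k0 _; apply: bigcap_measurable => [|k _]; last exact: measurable_free_part_eq.
  by exists k0; rewrite /=.
have WE c w : W c w -> new_count H mu w = c.
  by move=> [k0 _ hk]; apply: (new_countE (k0 := k0)) => k k0k; exact: hk.
have NW w c : new_count H mu w = c.+1 -> W c.+1 w.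
  rewrite /new_count; case: xgetP => // y _ [k0 hk] yc; exists k0 => // k kk.
  by rewrite /= hk// yc.
(* The value [0] is also the default of [xget], so its fibre is obtained as the complement of all
   the others. *)
case: b => [|b]; last first.
  rewrite (_ : [set _ | _] = W b.+1); first exact: mW.
  by apply/seteqP; split=> w; [exact: NW|exact: WE].
rewrite (_ : [set _ | _] = ~` \bigcup_b W b.+1).
  by apply: measurableC; apply: bigcup_measurable => c _; exact: mW.
apply/seteqP; split=> [w /= w0 [c _ /WE]|w /= nW]; first by rewrite w0.
case e: (new_count H mu w) => [//|c].
by exfalso; apply: nW; exists c => //; exact: NW.
Qed.

End measurability.
End free_part.

(** * Counting the new dishes *)

Lemma continuous_pois (R : realType) j : continuous (fun l : R => pois l j).
Proof.
move=> x; rewrite /pois; apply: cvgM; last exact: cvg_cst.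
apply: cvgM; last exact: (@exprn_continuous R j x).
apply: (@cvg_comp _ _ _ (fun l : R => - l) expR _ (nbhs (- x))); last exact: continuous_expR.
exact: (@cvgN _ _ _ _ _ (fun l : R => l)).
Qed.

(** * The number of new points in one step *)

Section one_step.
Context {R : realType} (X : pseudoMetricType R) (x0 : X).
Variable G : nat -> set X.
Hypothesis hX : hausdorff_space X.
Hypothesis hG : open_base G.
Local Open Scope ereal_scope.
Local Notation B := (borel_sets X).
Variables (m : set X -> \bar R) (hm : finite_measure_on B m).
Hypotheses (m1 : m setT = 1) (dm : diffuse m).
Context d {Omega : measurableType d} (P : probability Omega R).
Variable gen : set (set Omega).
Local Notation F := (<<s gen>>).
Hypothesis Fmeas : F `<=` measurable.
Variables (mu : Omega -> set X -> \bar R) (S : Omega -> set X) (H : nat -> set Omega).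
Hypothesis rmu : random_measure B P mu.
Hypothesis FH : forall i, F (H i).
Hypothesis HS : forall i w, H i w -> S w `&` G i = set0.
Variables (Lam : Omega -> R) (D : R).
Hypothesis mLam : measurable_fun setT Lam.
Hypothesis LamD : forall w, (0 <= Lam w <= D)%R.
(** The form in which the Bernoulli random measure enters the step: laws of masses of fixed sets, on
    events of the past that keep these sets free of old points. *)
Hypothesis poisson_counts : forall V A, B V -> F A -> (forall w, A w -> S w `&` V = set0) ->
  forall j : nat, P (A `&` [set w | mu w V = j%:R%:E]) =
    \int[P]_(w in A) (pois (Lam w * fine (m V)) j)%:E.

Let D0 : (0 <= D)%R.
Proof. by have /andP[a b] := LamD point; exact: le_trans b. Qed.

Let mmuE V (j : nat) : B V -> measurable [set w | mu w V = j%:R%:E].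
Proof.
move=> BV; rewrite -[X in measurable X]setTI.
exact: (rmu.2 V BV measurableT _ (emeasurable_set1 _)).
Qed.

(** From [1 - a <= expR (- a)] one gets [(1 + a) * expR (- a) >= 1 - a ^+ 2], so two or more points
    are a second-order event. *)
Lemma pois01_ge (a : R) : (0 <= a)%R -> (1 <= pois a 0 + pois a 1 + a ^+ 2)%R.
Proof.
move=> a0; rewrite /pois !fact0 expr0 expr1 divr1 mulr1 /= divr1.
have := expR_ge1Dx (- a); set e := expR _ => ae.
have : ((1 - a) * (1 + a) <= e * (1 + a))%R by rewrite ler_wpM2r// addr_ge0.
by lra.
Qed.

(** The exceptional event is the complement of the masses [0] and [1], so that it also contains the
    non-integer masses; its probability follows from the two point probabilities alone. *)
Lemma multiple_points_bound V A : B V -> F A -> (forall w, A w -> S w `&` V = set0) ->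
  P (A `\` ([set w | mu w V = 0] `|` [set w | mu w V = 1])) <= ((D * fine (m V)) ^+ 2)%:E.
Proof.
move=> BV FA AV; have mA := Fmeas FA.
set E0 := [set w | mu w V = 0]; set E1 := [set w | mu w V = 1].
have mE0 : measurable E0 by exact: (mmuE 0 BV).
have mE1 : measurable E1 by exact: (mmuE 1 BV).
have mV0 : (0 <= fine (m V))%R by apply: fine_ge0; exact: (fmeas_ge0 hm).
have PE0 := poisson_counts BV FA AV 0%N; have PE1 := poisson_counts BV FA AV 1%N.
rewrite -/E0 in PE0; rewrite -/E1 in PE1.
have mpois j : measurable_fun setT (fun w => (pois (Lam w * fine (m V)) j)%:E).
  apply/measurable_EFinP; apply: (measurableT_comp (measurable_pois j)).
  by apply: measurable_funM.
have pge0 j w : 0 <= (pois (Lam w * fine (m V)) j)%:E.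
  by rewrite lee_fin pois_ge0// mulr_ge0//; have /andP[] := LamD w.
set K := ((D * fine (m V)) ^+ 2)%R.
have PA : P A <= P (A `&` E0) + P (A `&` E1) + K%:E.
  have -> : P A = \int[P]_(w in A) cst 1 w by rewrite integral_cst// mul1e.
  rewrite PE0 PE1 -ge0_integralD//; try exact: measurable_funTS.
  have KE : K%:E * P A <= K%:E.
    by rewrite -[leRHS]mule1 lee_wpmul2l ?probability_le1// lee_fin sqr_ge0.
  apply: le_trans (leeD2l _ KE).
  rewrite -integral_cst// -ge0_integralD//; last 3 first.
  - by move=> w _; rewrite adde_ge0.
  - by apply: measurable_funTS; exact: emeasurable_funD.
  - by move=> w _; rewrite lee_fin sqr_ge0.
  apply: ge0_le_integral => //.
    by apply: measurable_funTS; apply: emeasurable_funD => //; exact: emeasurable_funD.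
  move=> w _; rewrite -!EFinD lee_fin.
  have /andP[l0 lD] := LamD w.
  apply: le_trans (pois01_ge (mulr_ge0 l0 mV0)) _.
  rewrite lerD2l /K ler_sqr ?nnegrE ?mulr_ge0//.
  exact: ler_wpM2r.
have m01 : P (A `&` (E0 `|` E1)) = P (A `&` E0) + P (A `&` E1).
  rewrite setIUr; apply: measureU; [exact: measurableI|exact: measurableI|].
  apply/seteqP; split=> // w [[_ /= e0] [_ /=]]; rewrite /E1 /= e0 => /eqP.
  by rewrite eq_sym onee_eq0.
have AE : P A = P (A `\` (E0 `|` E1)) + P (A `&` (E0 `|` E1)).
  exact: measureDI mA (measurableU _ _ mE0 mE1).
move: PA; rewrite AE m01 addeC.
by rewrite leeD2lE// fin_numD !fin_num_measure//; exact: measurableI.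
Qed.

(* On [H i] nothing of the past lies in [G i]; refining the cells makes the probability that
   some cell receives two new points arbitrarily small. *)
Lemma ae_zero_one_cells : {ae P, forall w, forall i, H i w -> forall l0,
  exists2 l, (l0 <= l)%N & forall s : {ffun 'I_l -> bool},
     mu w (G i `&` [set x | signature G l x = s]) = 0 \/
     mu w (G i `&` [set x | signature G l x = s]) = 1}.
Proof.
apply/ae_foralln => i.
have BV l s : B (G i `&` [set x | signature G l x = s]).
  exact: (borelI x0 (borel_base hG i) (borel_cell x0 hG _)).
pose E l s := H i `\` ([set w | mu w (G i `&` [set x | signature G l x = s]) = 0] `|`
                       [set w | mu w (G i `&` [set x | signature G l x = s]) = 1]).
have mE l s : measurable (E l s).
  apply: measurableD; first exact: Fmeas.
  by apply: measurableU; [exact: (mmuE 0)|exact: (mmuE 1)].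
pose N l0 := \bigcap_(l in [set l | (l0 <= l)%N]) \bigcup_(s in [set: {ffun 'I_l -> bool}]) E l s.
have mU l : measurable (\bigcup_(s in [set: {ffun 'I_l -> bool}]) E l s).
  by apply: fin_bigcup_measurable => //; exact: finite_finset.
have mN l0 : measurable (N l0).
  by apply: bigcap_measurable => [|l _]; [exists l0 => /=|exact: mU].
have N0 l0 : P (N l0) = 0.
  apply/eqP; rewrite eq_le measure_ge0 andbT; apply/lee_addgt0Pr => eps e0; rewrite add0e.
  (* Summed over the cells, the quadratic bounds give at most [D ^+ 2] times the largest cell mass
     times the total mass [1]; adding [1] keeps the denominator positive. *)
  have e1 : (0 < eps / (D ^+ 2 + 1))%R by rewrite divr_gt0// ltr_wpDl// sqr_ge0.
  have [l1 hl1] := cells_small x0 hX hG hm dm e1.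
  pose l := maxn l0 l1.
  pose c (s : {ffun 'I_l -> bool}) := m [set x | signature G l x = s].
  have BC s : B [set x | signature G l x = s :> {ffun 'I_l -> bool}] by exact: (borel_cell x0 hG).
  have cf s : c s \is a fin_num by exact: (fmeas_fin x0 hm (BC s)).
  have c0 s : (0 <= fine (c s))%R by apply: fine_ge0; exact: (fmeas_ge0 hm (BC s)).
  have ce s : (fine (c s) <= eps / (D ^+ 2 + 1))%R.
    by rewrite -lee_fin fineK//; apply: hl1; rewrite leq_maxr.
  have Ebound s : P (E l s) <= ((D ^+ 2 * (eps / (D ^+ 2 + 1))) * fine (c s))%:E.
    apply: le_trans (multiple_points_bound (BV l s) (FH i) _) _.
      by move=> w Hw; rewrite setIA (HS Hw) set0I.
    rewrite lee_fin exprMn -mulrA ler_wpM2l ?sqr_ge0//.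
    have mle : (fine (m (G i `&` [set x | signature G l x = s])) <= fine (c s))%R.
      apply: fine_le; [exact: (fmeas_fin x0 hm)|exact: cf|].
      by apply: (fmeas_le x0 hm (BV l s) (BC s)) => ? [].
    rewrite expr2; apply: ler_pM => //; try by apply: fine_ge0; exact: (fmeas_ge0 hm).
    exact: le_trans (ce s).
  have csum : (\sum_s fine (c s) = 1)%R.
    apply: EFin_inj; rewrite -sumEFin -m1.
    have := fmeas_fin_fibers x0 hm predT (borelT x0) BC.
    rewrite (_ : [set x | _] = setT) ?setIT; last by apply/seteqP; split.
    move=> ->; apply: eq_bigr => s _; rewrite fineK// setTI//.
  apply: (@le_trans _ _ (\sum_s P (E l s))).
    have := @content_sub_fsum _ _ _ P _ [set: {ffun 'I_l -> bool}] (N l0) (E l)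
      finite_finset (fun s _ => mE l s) (mN l0).
    rewrite (_ : [set: {ffun 'I_l -> bool}] = [set` enum {ffun 'I_l -> bool}]); last first.
      by apply/seteqP; split=> // s _; rewrite /= mem_enum.
    rewrite -fsbig_seq ?enum_uniq// big_enum/=.
    apply => w /(_ l)[|s _ Es]; first by rewrite /= leq_maxl.
    by exists s => //=; rewrite mem_enum.
  apply: (@le_trans _ _ (\sum_s ((D ^+ 2 * (eps / (D ^+ 2 + 1))) * fine (c s))%:E)).
    by apply: lee_sum => s _; exact: Ebound.
  rewrite sumEFin lee_fin -mulr_sumr csum mulr1 mulrA ler_pdivrMr ?ltr_wpDl ?sqr_ge0//.
  by rewrite mulrC ler_wpM2l ?(ltW e0)// lerDl.
apply: (@negligibleS _ _ _ P (\bigcup_l0 N l0)); last first.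
  by apply: negligible_bigcup => l0; apply/negligibleP => //; exact: N0.
move=> w /= nw; apply: contrapT => nN; apply: nw => Hw l0.
apply: contrapT => nl; apply: nN; exists l0 => // l /= ll.
apply: contrapT => nU; apply: nl; exists l => // s.
apply: contrapT => n01; apply: nU; exists s => //; split=> //=.
Qed.

Hypothesis Scov : {ae P, forall w, finite_set (S w) /\
  forall x, ~ S w x -> exists i, G i x /\ H i w}.

Definition new_atoms (w : Omega) : set X := [set x | ~ S w x /\ mu w [set x] = 1].

Let free_partP k w x : free_part G H k w x <-> exists i, [/\ (i < k)%N, H i w & G i x].
Proof.
split=> [[i /=]|[i [ik Hi Gi]]].
  by rewrite ffunE => /asboolP Hi Gi; exists i.
by exists (Ordinal ik) => //=; rewrite ffunE; exact/asboolP.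
Qed.

Let free_part_out k w : free_part G H k w `<=` ~` S w.
Proof.
move=> x /free_partP[i [_ Hi Gi]] Sx.
by have : (S w `&` G i) x; [split|rewrite HS].
Qed.

Let free_part_nd w : {homo (fun k => free_part G H k w) : n k / (n <= k)%N >-> n `<=` k}.
Proof.
move=> n k nk x /free_partP[i [ik Hi Gi]]; apply/free_partP; exists i; split=> //.
exact: leq_trans nk.
Qed.

(** Base sets free of old points cover the complement of the finite set [S w], and on each of them
    [mu w] reduces to its unit atoms. These are finitely many, so one free part contains all of
    them, and from there on the masses equal their number. *)
Lemma ae_new_atoms : {ae P, forall w, [/\ finite_set (S w), finite_set (new_atoms w),
  mu w (~` S w `\` new_atoms w) = 0,
  (exists k0, forall k, (k0 <= k)%N ->
     mu w (free_part G H k w) = (new_count G H mu w)%:R%:E) &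
  \esum_(x in new_atoms w) (1 : \bar R) = (new_count G H mu w)%:R%:E]}.
Proof.
move: ae_zero_one_cells Scov; apply: filterS2 => w cells [fS cov].
have hmu := rmu.1 w.
have fT : finite_set (new_atoms w).
  by apply: sub_finite_set (finite_unit_atoms x0 hX hmu) => x [].
have BT : B (new_atoms w) := borel_finite x0 hX fT.
have BS : B (~` S w) := borelC x0 (borel_finite x0 hX fS).
have BT1 : B [set x | mu w [set x] = 1] := borel_finite x0 hX (finite_unit_atoms x0 hX hmu).
have nullT : mu w (~` S w `\` new_atoms w) = 0.
  pose N i := if `[< H i w >] then G i `\` [set x | mu w [set x] = 1] else set0.
  have BN i : B (N i).
    rewrite /N; case: ifP => _; last exact: (borel0 x0).
    exact: (borelD x0 (borel_base hG i) BT1).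
  have N0 i : mu w (N i) = 0.
    rewrite /N; case: asboolP => Hi; last exact: (fmeas0 hmu).
    exact: (zero_one_cells_atomic x0 hX hG hmu (borel_base hG i) (cells i Hi)).
  apply: (fmeas_null x0 hmu (borelD x0 BS BT) _ _ (fmeas_bigcup_null x0 hmu BN N0)).
    exact: (borel_bigcup x0).
  move=> x [Sx Tx]; have [i [Gi Hi]] := cov x Sx.
  by exists i => //; rewrite /N asboolT//; split=> // x1; exact: Tx.
have [k0 hk0] : exists k0, forall k, (k0 <= k)%N -> new_atoms w `<=` free_part G H k w.
  have /finite_seqP[s sT] := fT.
  have : forall x, x \in s -> ~ S w x by move=> x xs; have : [set` s] x by []; rewrite -sT => -[].
  rewrite sT; elim: s {sT} => [_|y s IH sS]; first by exists 0%N => k _ x.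
  have [x xs|k1 hk1] := IH; first by apply: sS; rewrite inE xs orbT.
  have [i [Gy Hi]] := cov y (sS y (mem_head _ _)).
  exists (maxn k1 i.+1) => k; rewrite geq_max => /andP[k1k ik] x /=.
  rewrite inE => /predU1P[->|xs]; last exact: (hk1 k k1k).
  by apply/free_partP; exists i.
have muf k : (k0 <= k)%N -> mu w (free_part G H k w) = \esum_(x in new_atoms w) 1.
  move=> kk; have Bf : B (free_part G H k w) := borel_pattern_union hG _.
  rewrite -(unit_atoms_mass x0 hX hmu fT); last by move=> x [].
  rewrite (fmeas_split x0 hmu Bf BT) setIC (setIidl (hk0 k kk)).
  rewrite (fmeas_null x0 hmu (borelD x0 Bf BT) (borelD x0 BS BT) _ nullT) ?adde0//.
  exact: setSD (@free_part_out _ _).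
have [b bE] : exists b : nat, \esum_(x in new_atoms w) (1 : \bar R) = b%:R%:E.
  have /finite_seqP[s sT] := fT; exists (size (undup s)).
  rewrite esum_fset// (_ : new_atoms w = [set` undup s]).
    by rewrite -fsbig_seq ?undup_uniq// big_const_seq count_predT; elim: (size _) => //= n ->; rewrite -EFinD -natr1 addrC.
  by rewrite sT; apply/seteqP; split=> x /=; rewrite mem_undup.
have cE : new_count G H mu w = b.
  by apply: (new_countE (k0 := k0)) => k kk; rewrite muf.
by split=> //; rewrite cE //; exists k0 => k kk; rewrite muf.
Qed.

Let finite_null (A : set X) : finite_set A -> m A = 0.
Proof.
move=> fA; have /finite_seqP[s sA] := fA.
pose N i := if (i < size s)%N then [set nth x0 s i] else set0.
have BN i : B (N i).
  by rewrite /N; case: ifP => _; [exact: (borel_set1 x0 hX)|exact: (borel0 x0)].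
have N0 i : m (N i) = 0.
  by rewrite /N; case: ifP => _; [exact: dm|exact: (fmeas0 hm)].
apply: (fmeas_null x0 hm (borel_finite x0 hX fA) _ _ (fmeas_bigcup_null x0 hm BN N0)).
  exact: (borel_bigcup x0).
rewrite sA => x /= xs; exists (index x s) => //.
by rewrite /N index_mem xs /= nth_index.
Qed.

Let mass_cvg : {ae P, forall w, fine (m (free_part G H k w)) @[k --> \oo] --> (1%R : R)}.
Proof.
move: Scov; apply: filterS => w [fS cov].
have BS : B (S w) := borel_finite x0 hX fS.
have U1 : m (\bigcup_k free_part G H k w) = 1.
  have -> : \bigcup_k free_part G H k w = ~` S w.
    apply/seteqP; split=> [x [k _]|x Sx]; first exact: free_part_out.
    have [i [Gi Hi]] := cov x Sx.
    by exists i.+1 => //; apply/free_partP; exists i.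
  have := fmeas_split x0 hm (borelT x0) BS.
  by rewrite m1 setTI setTD finite_null// add0e.
have Bf k : B (free_part G H k w) := borel_pattern_union hG _.
have := fmeas_cvg x0 hm Bf (@free_part_nd w).
by rewrite U1 => /fine_cvg.
Qed.

Let prob_ae_cvg (A_ : nat -> set Omega) (A : set Omega) :
  (forall k, measurable (A_ k)) -> measurable A ->
  {ae P, forall w, exists k0, forall k, (k0 <= k)%N -> A_ k w <-> A w} ->
  P (A_ k) @[k --> \oo] --> P A.
Proof.
move=> mA_ mA eqA.
have PE C : measurable C -> P C = \int[P]_w (\1_C w)%:E.
  by move=> mC; rewrite integral_indic// setIT.
rewrite PE//; under eq_fun do rewrite PE//.
have mI C : measurable C -> measurable_fun setT (fun w : Omega => (\1_C w : R)%:E).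
  by move=> mC; apply/measurable_EFinP; exact: measurable_indic.
have iC : P.-integrable setT (cst 1) by exact: (finite_measure_integrable_cst P 1%R).
have [||_ _] := dominated_convergence measurableT (fun k => mI _ (mA_ k)) (mI _ mA) _ iC _; last exact.
  move: eqA; apply: filterS => w [k0 hk] _.
  apply: cvg_near_cst; exists k0 => // k /= kk; rewrite !indicE.
  by rewrite (_ : (w \in A_ k) = (w \in A))//; apply/idP/idP; rewrite !inE => /(hk k kk).
by apply: aeW => w k _; rewrite lee_fin indicE; case: (_ \in _); rewrite ?normr1 ?normr0.
Qed.

(** On each event fixing the signature, the free part is a fixed Borel set, so [poisson_counts]
    gives the law of its mass. As [k] grows the counts stabilise almost surely, and
    [m (free_part G H k w)] tends to [1] because the finite set [S w] is [m]-null; dominated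
    convergence passes to the limit on both sides. *)
Lemma new_count_law A b : F A ->
  P (A `&` [set w | new_count G H mu w = b]) = \int[P]_(w in A) (pois (Lam w) b)%:E.
Proof.
move=> FA; have mA := Fmeas FA.
have mH i : measurable (H i) by exact: Fmeas.
have mS k s : measurable [set w | signature H k w = s] by exact: measurable_signature.
have FS k s : F [set w | signature H k w = s].
  exact: (@measurable_signature _ (g_sigma_algebraType gen) H FH).
pose c k (a : nat) : set X :=
  if unpickle a is Some s then pattern_union G (s : {ffun 'I_k -> bool}) else set0.
pose sg k w := pickle (signature H k w).
have Fsg k a : F [set w | sg k w = a].
  rewrite (_ : [set _ | _] = \bigcup_(s in [set s | pickle s = a])
      [set w | signature H k w = s]).
    apply: (@fin_bigcup_measurable _ (g_sigma_algebraType gen)) => [|s _].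
      exact: finite_finset.
    exact: FS.
  apply/seteqP; split=> [w /= <-|w [s /= <- /= e]]; last by rewrite /sg e.
  by exists (signature H k w).
have msg k a : measurable [set w | sg k w = a] by exact: Fmeas.
have csg k w : c k (sg k w) = free_part G H k w by rewrite /c /sg pickleK.
have Bc k a : B (c k a).
  by rewrite /c; case: unpickle => [s|]; [exact: borel_pattern_union|exact: (borel0 x0)].
have mc0 k a : (0 <= fine (m (c k a)))%R by apply: fine_ge0; exact: (fmeas_ge0 hm).
pose f k w := (pois (Lam w * fine (m (free_part G H k w))) b)%:E.
have mp k a : measurable_fun setT (fun w => (pois (Lam w * fine (m (c k a))) b)%:E).
  apply/measurable_EFinP; apply: (measurableT_comp (measurable_pois b)).
  by apply: measurable_funM.
have pge0 k a w : 0 <= (pois (Lam w * fine (m (c k a))) b)%:E.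
  by rewrite lee_fin pois_ge0// mulr_ge0//; have /andP[] := LamD w.
have step k : P (A `&` [set w | mu w (free_part G H k w) = b%:R%:E]) = \int[P]_(w in A) f k w.
  have mEa a : measurable [set w | mu w (c k a) = b%:R%:E] by exact: mmuE.
  transitivity (\int[P]_(w in A) (\1_[set w | mu w (c k (sg k w)) = b%:R%:E] w)%:E).
    rewrite integral_indic//; last first.
      under eq_set do rewrite csg.
      by apply: measurable_free_part_eq => //; exact: rmu.2.
    by rewrite setIC; congr (P (_ `&` _)); apply/seteqP; split=> w /=; rewrite csg.
  rewrite (@integral_fibers _ _ _ P A (sg k)
     (fun a w => (\1_[set w' | mu w' (c k a) = b%:R%:E] w)%:E))//; last first.
    by move=> a; apply/measurable_EFinP; exact: measurable_indic.
  transitivity (\int[P]_(w in A) (pois (Lam w * fine (m (c k (sg k w)))) b)%:E); last first.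
    by apply: eq_integral => w _; rewrite csg.
  rewrite (@integral_fibers _ _ _ P A (sg k)
     (fun a w => (pois (Lam w * fine (m (c k a))) b)%:E))//.
  apply: eq_eseriesr => a _; rewrite integral_indic//; last exact: measurableI.
  rewrite setIC; apply: poisson_counts => //.
    exact: (@measurableI _ (g_sigma_algebraType gen) _ _ FA (Fsg k a)).
  move=> w [_ /= <-]; rewrite csg; apply/seteqP; split=> // x [Sx fx].
  exact: free_part_out fx Sx.
have cvgL : P (A `&` [set w | mu w (free_part G H k w) = b%:R%:E]) @[k --> \oo] -->
    P (A `&` [set w | new_count G H mu w = b]).
  apply: prob_ae_cvg => [k||].
  - by apply: measurableI => //; apply: measurable_free_part_eq => //; exact: rmu.2.
  - by apply: measurableI => //; apply: measurable_new_count => //; exact: rmu.2.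
  move: ae_new_atoms; apply: filterS => w [_ _ _ [k0 hk] _].
  exists k0 => k kk; have hkk := hk k kk; split=> -[Aw /= e]; split=> //=.
    by move: e; rewrite hkk => -[/eqP]; rewrite eqr_nat => /eqP.
  by rewrite hkk e.
have fE k : f k = (fun w => (pois (Lam w * fine (m (c k (sg k w)))) b)%:E).
  by apply/funext => w; rewrite csg.
have mf k : measurable_fun setT (f k).
  rewrite fE => _ U mU; rewrite setTI.
  rewrite (_ : _ @^-1` _ = \bigcup_a ([set w | sg k w = a] `&`
      ((fun w => (pois (Lam w * fine (m (c k a))) b)%:E) @^-1` U))).
    apply: bigcup_measurable => a _; apply: measurableI => //.
    by rewrite -[X in measurable X]setTI; exact: mp.
  apply/seteqP; split=> [w /= UF|w [a _ [/= <-]]//]; by exists (sg k w).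
have cvgR : \int[P]_(w in A) f k w @[k --> \oo] --> \int[P]_(w in A) (pois (Lam w) b)%:E.
  have iC : P.-integrable A (cst 1).
    by apply: (integrableS measurableT) => //; exact: (finite_measure_integrable_cst P 1%R).
  have mlim : measurable_fun A (fun w => (pois (Lam w) b)%:E).
    apply/measurable_funTS/measurable_EFinP.
    exact: (measurableT_comp (measurable_pois b)).
  have mfA k : measurable_fun A (f k) by exact: measurable_funTS.
  have [||_ _] := dominated_convergence mA mfA mlim _ iC _; last exact.
    move: mass_cvg; apply: filterS => w cw _.
    apply: cvg_EFin; first exact: nearW.
    have cl : (Lam w * fine (m (free_part G H k w)) @[k --> \oo] --> Lam w)%R.
      by rewrite -[X in _ --> X]mulr1; apply: cvgMr.
    exact: (cvg_comp _ _ cl (@continuous_pois R b (Lam w))).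
  apply: aeW => w k _; rewrite fE lee_fin ger0_norm; last first.
    by rewrite pois_ge0// mulr_ge0//; have /andP[] := LamD w.
  have p0 j : (0 <= pois (Lam w * fine (m (c k (sg k w)))) j)%R.
    by rewrite pois_ge0// mulr_ge0//; have /andP[] := LamD w.
  have l0 : (0 <= Lam w * fine (m (c k (sg k w))))%R.
    by rewrite mulr_ge0//; have /andP[] := LamD w.
  apply: le_trans (pois_sum_le1 b.+1 l0).
  by rewrite big_nat_recr//= lerDr sumr_ge0.
move: cvgL; under eq_fun do rewrite step.
by move=> cvgL; exact: (cvg_unique (@ereal_hausdorff R) cvgL cvgR).
Qed.

End one_step.

(** * The buffet process *)

Section buffet_model.
Context {R : realType} (X : pseudoMetricType R) (x0 : X).
Variables (m : set X -> \bar R) (alpha beta c u : R).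
Context d {Omega : measurableType d} (P : probability Omega R).
Variables (M : nat -> Omega -> set X -> \bar R) (Rv : nat -> Omega -> R).
Local Open Scope ereal_scope.
Local Notation B := (borel_sets X).
Hypotheses (hX : hausdorff_space X) (hm : finite_measure_on B m) (m1 : m setT = 1)
  (dm : diffuse m).
Hypotheses (alpha0 : (0 < alpha)%R) (beta01 : (0 <= beta < 1)%R) (cbeta : (- beta < c)%R)
  (umax : (Num.max beta 0 < u)%R).
Hypothesis rM : forall n, (1 <= n)%N -> random_measure B P (M n).
Hypothesis rRv : forall n, (1 <= n)%N -> measurable_fun setT (Rv n) /\ forall w, (u <= Rv n w)%R.
Hypothesis BeP : forall n : nat, exists K : Omega -> set (set X -> \bar R) -> \bar R,
  [/\ (forall A, ev_sigma B A -> forall U : set (\bar R), measurable U ->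
         Fn B M Rv n ((fun w => K w A) @^-1` U)),
      (forall H, Fn B M Rv n H -> forall A, ev_sigma B A ->
         P (H `&` (M n.+1 @^-1` A)) = \int[P]_(w in H) K w A) &
      {ae P, forall w, BeP_law B (nu_n M Rv m alpha beta c n w) (K w)}].

Local Notation Lam n w := (new_rate alpha beta c (sumR Rv n w)).
Let D : R := Num.max alpha (kappa alpha beta c * (c + u) `^ (beta - 1))%R.

Lemma sumR_ge n w : (u * n%:R <= sumR Rv n w)%R.
Proof.
elim: n => [|n IH]; first by rewrite mulr0 /sumR big_geq.
rewrite /sumR big_nat_recr//= -natr1 mulrDr mulr1; apply: lerD; first exact: IH.
by have [_] := @rRv n.+1 isT; exact.
Qed.

Lemma measurable_sumR n : measurable_fun setT (sumR Rv n).
Proof.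
elim: n => [|n IH].
  by rewrite (_ : sumR Rv 0 = cst 0%R)//; apply/funext => w; rewrite /sumR big_geq.
rewrite (_ : sumR Rv n.+1 = fun w => (sumR Rv n w + Rv n.+1 w)%R).
  by apply: measurable_funD => //; have [] := @rRv n.+1 isT.
by apply/funext => w; rewrite /sumR big_nat_recr.
Qed.

Lemma measurable_buffet_rate n : measurable_fun setT (fun w => Lam n w).
Proof.
have S0 w : (0 <= sumR Rv n w)%R.
  apply: le_trans (sumR_ge n w); rewrite mulr_ge0//.
  by apply: le_trans (ltW umax); rewrite le_max lexx orbT.
have G0 w : (0 < Gamma (c + 1 + sumR Rv n w))%R.
  apply: Gamma_gt0; apply: ltr_wpDr => //.
  by have /andP[_ b1] := beta01; move: cbeta b1; lra.
(* The denominator containing the random sum becomes a power [-1], equal to the inverse as the base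
   is positive, so that measurability of powers applies. *)
rewrite (_ : (fun w => _) = fun w => (alpha * (Gamma (c + 1) * Gamma (c + beta + sumR Rv n w)) /
    Gamma (c + beta) * Gamma (c + 1 + sumR Rv n w) `^ (-1))%R); last first.
  apply/funext => w; rewrite /new_rate (powR_inv1 (ltW (G0 w))) invfM.
  exact: mulrA.
have mG a : measurable_fun setT (fun w => Gamma (a + sumR Rv n w)%R).
  by apply: (measurableT_comp measurable_Gamma); apply: measurable_funD => //; exact: measurable_sumR.
apply: measurable_funM; last exact: (measurableT_comp (measurable_powR _) (mG (c + 1)%R)).
apply: measurable_funM => //; apply: measurable_funM => //; exact: measurable_funM.
Qed.

Lemma buffet_rate_bounds n w : (0 <= Lam n w <= D)%R.
Proof.
case: n => [|n].
  rewrite (_ : sumR Rv 0 w = 0%R); last by rewrite /sumR big_geq.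
  by rewrite new_rate0// (ltW alpha0) le_max lexx.
have uS : (u <= sumR Rv n.+1 w)%R.
  apply: le_trans (sumR_ge _ _); rewrite ler_peMr ?ler1n//.
  by apply: le_trans (ltW umax); rewrite le_max lexx orbT.
have /andP[-> h] := new_rate_bounds alpha0 beta01 cbeta umax uS.
by rewrite le_max h orbT.
Qed.

Definition history_gen n : set (set Omega) :=
  [set E | exists i, (1 <= i <= n)%N /\ exists A (U : set (\bar R)),
     [/\ B A, measurable U & E = (fun w => M i w A) @^-1` U]] `|`
  [set E | exists i, (1 <= i <= n)%N /\ exists U : set R, measurable U /\ E = Rv i @^-1` U].

Local Notation history n := (g_sigma_algebraType (history_gen n)).

Lemma Fn_measurable n : Fn B M Rv n `<=` measurable.
Proof.
apply: smallest_sub; first exact: sigma_algebra_measurable.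
move=> E [[i [/andP[i1 _] [A [U [BA mU ->]]]]]|[i [/andP[i1 _] [U [mU ->]]]]].
  by rewrite -[X in measurable X]setTI; apply: ((rM i1).2 A BA).
by rewrite -[X in measurable X]setTI; apply: (rRv i1).1.
Qed.

Lemma Fn_mono n : Fn B M Rv n `<=` Fn B M Rv n.+1.
Proof.
apply: sub_sigma_algebra2 => E [[i [/andP[i1 ni] h]]|[i [/andP[i1 ni] h]]].
  by left; exists i; rewrite i1 (leq_trans ni).
by right; exists i; rewrite i1 (leq_trans ni).
Qed.

Lemma Fn_M n i A (U : set (\bar R)) : (1 <= i <= n)%N -> B A -> measurable U ->
  Fn B M Rv n ((fun w => M i w A) @^-1` U).
Proof. by move=> hi BA mU; apply: sub_sigma_algebra; left; exists i; split=> //; exists A, U. Qed.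

Lemma atoms_nu_n n w : atoms (nu_n M Rv m alpha beta c n w) `<=` Sn M n w.
Proof.
move=> x /=; rewrite /atoms /= /nu_n dm mule0 adde0 => h.
apply: contrapT => nx; move: h; rewrite (_ : _ `&` _ = set0) ?esum_set0 ?ltxx//.
by apply/seteqP; split=> // y [/= Sy yx]; apply: nx; rewrite -yx.
Qed.

(** Off the old points the hazard measure has no atoms, so the Bernoulli part vanishes on [V] and
    the diffuse part is [Lam n w] times [m]; the conditional law of the mass is then the one
    prescribed by [poisson_rm]. *)
Lemma buffet_poisson_counts n V A : B V -> Fn B M Rv n A ->
  (forall w, A w -> Sn M n w `&` V = set0) -> forall j : nat,
  P (A `&` [set w | M n.+1 w V = j%:R%:E]) =
    \int[P]_(w in A) (pois (Lam n w * fine (m V)) j)%:E.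
Proof.
move=> BV FA AV j; have [K [_ KP aeK]] := BeP n.
pose E := [set mu : set X -> \bar R | mu V = j%:R%:E].
have evE : ev_sigma B E.
  apply: sub_sigma_algebra; by exists V, [set j%:R%:E]; split=> //; exact: emeasurable_set1.
have -> : A `&` [set w | M n.+1 w V = j%:R%:E] = A `&` (M n.+1 @^-1` E) by [].
rewrite KP//; move: aeK => [N [mN N0 subN]].
pose g w := (pois (Lam n w * fine (m V)) j)%:E.
(* Off [A] the Poisson formula may fail; the modified integrand agrees with the target everywhere
   outside the null set. *)
transitivity (\int[P]_(w in A) (if w \in A then K w E else g w)).
  by apply: eq_integral => w ->.
apply: (@ae_eq_integral_any _ _ _ P A N) => //; first exact: Fn_measurable FA.
move=> w Nw; case: ifPn => //; rewrite inE => Aw.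
have [hnu [dd [QO [Q [M1 [V1 [[p1 p2 p3 p4 p5] KE]]]]]]] : BeP_law B (nu_n M Rv m alpha beta c n w) (K w).
  by apply: contrapT => nb; apply: Nw; exact: subN.
rewrite KE//.
set nu := nu_n _ _ _ _ _ _ _ _ in p1 KE *.
have aV : atoms nu `&` V = set0.
  apply/seteqP; split=> // x [ax Vx].
  by have := AV w Aw; move=> /seteqP[+ _]; apply; split; [exact: atoms_nu_n ax|].
transitivity (Q [set w' | M1 w' V = j%:R%:E]).
  congr (Q _); apply/seteqP; split=> w' /=; rewrite /E /= aV esum_set0 adde0//.
have nuV : nu_c nu V = (Lam n w)%:E * m V.
  by rewrite /nu_c /nu_d aV esum_set0 sube0 /nu /nu_n (AV w Aw) esum_set0 add0e.
have [_ [_ ->//]] := p1.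
by rewrite nuV /g /pois fineM //; exact: (fmeas_fin x0 hm BV).
Qed.

Variable G : nat -> set X.
Hypothesis hG : open_base G.

(** Stated through masses of a single base set, this is an event of the past; disjointness of
    [Sn M n w] from [G i] involves all points of [G i] at once. *)
Definition untouched n i : set Omega :=
  [set w | forall j, (1 <= j <= n)%N -> M j w (G i) = 0].

Lemma Fn_untouched n i : Fn B M Rv n (untouched n i).
Proof.
rewrite (_ : untouched n i = \bigcap_j (if (1 <= j <= n)%N
    then (fun w => M j w (G i)) @^-1` [set 0] else setT)).
  apply: (@bigcapT_measurable _ (history n)) => j; case: ifPn => hj; last exact: (@measurableT _ (history n)).
  exact: (Fn_M hj (borel_base hG i) (emeasurable_set1 0)).
apply/seteqP; split=> [w uw j _|w uw j hj]; first by case: ifPn => // /uw.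
by have := uw j I; rewrite hj.
Qed.

Lemma untouched_out n i w : untouched n i w -> Sn M n w `&` G i = set0.
Proof.
move=> uw; apply/seteqP; split=> // x [[j [hj Mx]] Gx].
have /andP[j1 _] := hj; have h := (rM j1).1 w.
have sub : [set x] `<=` G i by move=> y /= ->.
have := fmeas_le x0 h (borel_set1 x0 hX x) (borel_base hG i) sub.
by rewrite Mx (uw j hj) lee_fin ler10.
Qed.

Definition new_dishes n (w : Omega) : nat := new_count G (untouched n) (M n.+1) w.

(** A finite, hence closed, [Sn] has an open complement, and the second clause makes every base set
    inside it untouched, which is what the next step requires. The third clause ties the cardinal to
    the partial count. *)
Definition dishes_invariant n (w : Omega) := [/\ finite_set (Sn M n w),
  (forall j, (1 <= j <= n)%N -> M j w (~` Sn M n w) = 0) &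
  \esum_(x in Sn M n w) (1 : \bar R) = (partial_count new_dishes n w)%:R%:E].

Lemma ae_invariant_cover n : {ae P, forall w, dishes_invariant n w} ->
  {ae P, forall w, finite_set (Sn M n w) /\
     forall x, ~ Sn M n w x -> exists i, G i x /\ untouched n i w}.
Proof.
apply: filterS => w [fS MS _]; split=> // x Sx.
have oS : open (~` Sn M n w).
  by rewrite openC; exact: (accessible_finite_set_closed.1 (hausdorff_accessible hX)).
have [i [Gx GS]] := hG.2 x _ oS Sx; exists i; split=> // j hj.
have /andP[j1 _] := hj; have h := (rM j1).1 w.
apply: (fmeas_null x0 h (borel_base hG i) _ GS (MS j hj)).
exact: (borelC x0 (borel_finite x0 hX fS)).
Qed.

Lemma Sn_succ n w : Sn M n.+1 w = Sn M n w `|` new_atoms (M n.+1) (Sn M n) w.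
Proof.
apply/seteqP; split=> [x [i [/andP[i1]]]|x [[i [/andP[i1 ni] Mx]]|[_ Mx]]].
- rewrite leq_eqVlt => /predU1P[->|ni] Mx; last by left; exists i; rewrite i1.
  by have [?|?] := pselect (Sn M n w x); [left|right].
- by exists i; rewrite i1 (leq_trans ni).
- by exists n.+1; rewrite /= leqnn.
Qed.

(** Each step adds to [Sn] the finite set of new atoms. Outside the enlarged set [M n.+1] has no
    mass by [ae_new_atoms], and the earlier measures had none there already. *)
Lemma ae_dishes_invariant n : {ae P, forall w, dishes_invariant n w}.
Proof.
elim: n => [|n IH].
  apply: aeW => w; have S0 : Sn M 0 w = set0.
    by apply/seteqP; split=> // x [i [/andP[i1]]]; rewrite leqn0 => /eqP i0; rewrite i0 in i1.
  split; [by rewrite S0; exact: finite_set0|by case|].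
  by rewrite S0 esum_set0 /partial_count big_ord0.
have cov := ae_invariant_cover IH.
have := ae_new_atoms x0 hX hG hm m1 dm (@Fn_measurable n) (rM (n := n.+1) isT) (@Fn_untouched n)
  (@untouched_out n) (measurable_buffet_rate n) (buffet_rate_bounds n)
  (@buffet_poisson_counts n) cov.
move: IH; apply: filterS2 => w [fS MS SE] [_ fT nullT _ TE].
have fST : finite_set (Sn M n.+1 w) by rewrite Sn_succ finite_setU.
have BST : B (~` Sn M n.+1 w) := borelC x0 (borel_finite x0 hX fST).
split=> //.
  move=> j /andP[j1]; rewrite leq_eqVlt => /predU1P[->|nj].
    apply: etrans nullT; congr (M n.+1 w _); rewrite Sn_succ setCU.
    by rewrite setDE.
  have h := (rM j1).1 w.
  apply: (fmeas_null x0 h BST _ _ (MS j _)).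
  - exact: (borelC x0 (borel_finite x0 hX fS)).
  - by rewrite Sn_succ setCU => x [].
  - by rewrite j1.
have dis : Sn M n w `&` new_atoms (M n.+1) (Sn M n) w `<=` set0 by move=> x [? []].
rewrite Sn_succ partial_countS natrD EFinD -SE -TE.
rewrite !esum_fset// ?finite_setU// fsbigU// => x xx; have [] := dis _ xx.
Qed.

Lemma Fn_new_dishes n b : Fn B M Rv n.+1 [set w | new_dishes n w = b].
Proof.
apply: (@measurable_new_count _ _ _ hG _ (history n.+1) (untouched n) (M n.+1)).
  by move=> i; exact: Fn_mono (@Fn_untouched n i).
move=> A BA _ U mU; rewrite setTI; apply: (@Fn_M n.+1 n.+1 A U) => //.
by rewrite /= leqnn.
Qed.

Lemma Fn_partial_count n v : Fn B M Rv n [set w | partial_count new_dishes n w = v].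
Proof.
elim: n v => [|n IH] v.
  have [v0|v0] := eqVneq v 0%N.
    rewrite (_ : [set _ | _] = setT); first exact: (@measurableT _ (history 0)).
    by apply/seteqP; split=> // w _ /=; rewrite /partial_count big_ord0.
  rewrite (_ : [set _ | _] = set0); first exact: (@measurable0 _ (history 0)).
  apply/seteqP; split=> // w /=; rewrite /partial_count big_ord0 => e.
  by rewrite e eqxx in v0.
rewrite (_ : [set _ | _] = \bigcup_a ([set w | partial_count new_dishes n w = a] `&`
    \bigcup_(b in [set b | (a + b)%N = v]) [set w | new_dishes n w = b])).
  apply: (@bigcup_measurable _ (history n.+1)) => a _; apply: (@measurableI _ (history n.+1)).
    exact: Fn_mono (IH a).
  by apply: (@bigcup_measurable _ (history n.+1)) => b _; exact: Fn_new_dishes.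
apply/seteqP; split=> [w /=|w [a _ [/= <- [b /= <- <-]]]]; rewrite partial_countS// => <-.
exists (partial_count new_dishes n w) => //; split=> //.
by exists (new_dishes n w).
Qed.

Lemma Fn_le p q : (p <= q)%N -> Fn B M Rv p `<=` Fn B M Rv q.
Proof.
move/subnK => <-; elim: (q - p)%N => // k IH; rewrite addSn.
by apply: subset_trans IH _; exact: Fn_mono.
Qed.

Lemma new_dishes_cond p n v1 v2 b : (p <= n)%N ->
  P ([set w | partial_count new_dishes p w = v1] `&`
     [set w | partial_count new_dishes n w = v2] `&` [set w | new_dishes n w = b]) =
  \int[P]_(w in [set w | partial_count new_dishes p w = v1] `&`
     [set w | partial_count new_dishes n w = v2]) (pois (Lam n w) b)%:E.
Proof.
move=> pn.
have cov := ae_invariant_cover (ae_dishes_invariant n).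
have FI := @measurableI _ (history n)
  _ _
  (Fn_le pn (@Fn_partial_count p v1)) (@Fn_partial_count n v2).
exact: (new_count_law x0 hX hG hm m1 dm (@Fn_measurable n) (rM (n := n.+1) isT) (@Fn_untouched n)
  (@untouched_out n) (measurable_buffet_rate n) (buffet_rate_bounds n)
  (@buffet_poisson_counts n) cov b FI).
Qed.

Lemma ae_Ln n : {ae P, forall w, Ln M n w = (partial_count new_dishes n w)%:R%R}.
Proof.
move: (ae_dishes_invariant n); apply: filterS => w [_ _ SE].
by rewrite /Ln SE.
Qed.

Variable r : R.
Hypothesis Rbar_r : {ae P, forall w, (fun n => Rbar Rv n w) @ \oo --> r}.
Hypothesis Rbar_rate : (fun n : nat => (\sum_(1 <= j < n.+1)
        ((j%:R `^ (beta - 1))%:E * \int[P]_w (`|Rbar Rv j w - r|)%:E)) *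
        ((Num.sqrt (a_n beta n))^-1)%:E) @ \oo --> 0.

Lemma Rbar_limit_ge : (u <= r)%R.
Proof.
have [w cw] : exists w, (fun n => Rbar Rv n w) @ \oo --> r.
  apply: contrapT => nw; move: Rbar_r => [N [mN N0 sub]].
  have NT : N = setT by apply/seteqP; split=> // w _; apply: sub => /= h; apply: nw; exists w.
  have pT : P setT = 1 := probability_setT P.
  by move: N0; rewrite NT pT => /eqP; rewrite onee_eq0.
rewrite -(cvg_lim _ cw)//; apply: limr_ge; first by apply/cvg_ex; exists r.
near=> n; have n0 : (0 < n)%N by near: n; exact: nbhs_infty_gt.
by rewrite /Rbar ler_pdivlMr ?ltr0n//; exact: sumR_ge.
Unshelve. all: by end_near. Qed.

Lemma buffet_count_stable : stable_conv P
    (fun n w => Num.sqrt (a_n beta n) *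
       (Ln M n w / a_n beta n - lambda_beta alpha beta c r))%R
    (normal_prob 0 (Num.sqrt (lambda_beta alpha beta c r))).
Proof.
have ur := Rbar_limit_ge.
have lb0 : (0 < lambda_beta alpha beta c r)%R.
  exact: (lambda_beta_gt0 alpha0 beta01 cbeta umax ur).
set sigma := Num.sqrt _.
have s0 : (0 < sigma)%R by rewrite sqrtr_gt0.
have sE : (sigma ^+ 2 = lambda_beta alpha beta c r)%R by rewrite sqr_sqrtr// ltW.
have [C C0 hC] := new_rate_diff alpha0 beta01 cbeta umax ur.
pose I j := \int[P]_w (`|Rbar Rv j w - r|)%:E.
have I0 j : 0 <= I j by apply: integral_ge0 => w _; rewrite lee_fin.
have pw0 j : (0 < j)%N -> (0 < j%:R `^ (beta - 1) :> R)%R by move=> j0; rewrite powR_gt0 ?ltr0n.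
have [If qcvg] := esum_div_cvg0 I0 pw0 (sqrt_a_n_gt0 beta01) Rbar_rate.
pose q j := fine (I j).
have q0 j : (0 <= q j)%R by exact: fine_ge0.
(* At [k = 0] the rate is [alpha] and the target [0], whence the error [alpha]. *)
pose e k := (if k is 0%N then alpha
     else C * (k%:R `^ (beta - 1) * q k + k%:R `^ (beta - 2)))%R.
apply: (@std_count_stable_conv _ _ _ P new_dishes (fun n w => Lam n w) _ _ _ _ sigma
  (target_rate alpha beta c r) e (fun n => Num.sqrt (a_n beta n)) s0).
- by move=> i a; apply: (@Fn_measurable i.+1); exact: Fn_new_dishes.
- exact: measurable_buffet_rate.
- by move=> i w; have /andP[] := buffet_rate_bounds i w.
- by move=> *; exact: new_dishes_cond.
- by move=> i; exact: (target_rate_ge0 _ alpha0 beta01 cbeta).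
- case=> [|i].
    rewrite (eq_integral (cst alpha%:E)); last first.
      move=> w _; rewrite (_ : sumR Rv 0 w = 0%R); last by rewrite /sumR big_geq.
      by rewrite new_rate0// subr0 gtr0_norm.
    have pT : P setT = 1 := probability_setT P.
    by rewrite integral_cst//= pT mule1.
  pose k := i.+1; rewrite -[i.+1]/k; have k0 : (0 < k)%N by [].
  have mR : measurable_fun setT (fun w => `|Rbar Rv k w - r|%R).
    apply: measurableT_comp => //; apply: measurable_funD => //.
    by apply: measurable_funM => //; exact: measurable_sumR.
  apply: (@le_trans _ _ (\int[P]_w (C%:E * ((k%:R `^ (beta - 1))%:E * `|Rbar Rv k w - r|%:E +
      (k%:R `^ (beta - 2))%:E)))).
    apply: ge0_le_integral => //.
    - apply/measurable_EFinP; apply: measurableT_comp => //; apply: measurable_funB => //.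
      exact: measurable_buffet_rate.
    - apply/measurable_EFinP; apply: measurable_funM => //; apply: measurable_funD => //.
      exact: measurable_funM.
    by move=> w _; have := hC k _ k0 (sumR_ge k w); rewrite -lee_fin; exact.
  rewrite ge0_integralZl_EFin//; last 2 first.
  - by move=> w _; rewrite adde_ge0 ?mule_ge0// lee_fin powR_ge0.
  - by apply: emeasurable_funD => //; apply: emeasurable_funM => //; exact/measurable_EFinP.
  rewrite ge0_integralD//; last by apply: emeasurable_funM => //; exact/measurable_EFinP.
  rewrite ge0_integralZl_EFin ?powR_ge0//; last exact/measurable_EFinP.
  have pT : P setT = 1 := probability_setT P.
  by rewrite integral_cst//= pT mule1 /e /k -/(I k) EFinM EFinD EFinM /q fineK//; exact: If.
- exact: sqrt_a_n_gt0.
- exact: inv_sqrt_a_n_cvg0.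
- exact: (error_sum_cvg alpha0 beta01 C0 q0 qcvg).
- exact: (target_rate_sum_cvg beta01 cbeta umax ur sE).
- move: (sqrt_a_n_gt0 beta01); apply: filterS => n sn0.
  move: (ae_Ln n); apply: filterS => w ->.
  rewrite /std_count sE.
  have {2}-> : (a_n beta n = Num.sqrt (a_n beta n) ^+ 2)%R by rewrite sqr_sqrtr ?a_n_ge0.
  move: sn0; move: (Num.sqrt _) => z z0; move: (lambda_beta _ _ _ _) => l.
  by field; rewrite gt_eqF.
Qed.

End buffet_model.

Unset Implicit Arguments.

Theorem theorem5 (R : realType) (X : pseudoMetricType R)
  (m : set X -> \bar R) (alpha beta c u r : R)
  (d : measure_display) (Omega : measurableType d) (P : probability Omega R)
  (M : nat -> Omega -> set X -> \bar R) (Rv : nat -> Omega -> R) :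
  (* X is a separable metric space with its Borel sigma-field *)
  hausdorff_space X -> separable_space X ->
  (* m is a diffuse probability measure on the Borel sets *)
  finite_measure_on (borel_sets X) m -> m setT = 1%E -> diffuse m ->
  (* parameters *)
  0 < alpha -> 0 <= beta < 1 -> - beta < c -> Num.max beta 0 < u ->
  (* the M_n are random measures, the R_n real random variables, R_n >= u *)
  (forall n, (1 <= n)%N -> random_measure (borel_sets X) P (M n)) ->
  (forall n, (1 <= n)%N -> measurable_fun setT (Rv n) /\ forall w, u <= Rv n w) ->
  (* R_n independent of (M_1, ..., M_n, R_1, ..., R_{n-1}) *)
  (forall n, (1 <= n)%N ->
     indep2 P (<<s [set E | exists U : set R, measurable U /\ E = Rv n @^-1` U] >>)
              (Fgen (borel_sets X) M Rv n n.-1)) ->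
  (* M_{n+1} | F_n ~ BeP(nu_n), for all n >= 0 *)
  (forall n : nat, exists K : Omega -> set (set X -> \bar R) -> \bar R,
     [/\ (forall A, ev_sigma (borel_sets X) A -> forall U : set (\bar R), measurable U ->
            Fn (borel_sets X) M Rv n ((fun w => K w A) @^-1` U)),
         (forall H, Fn (borel_sets X) M Rv n H -> forall A, ev_sigma (borel_sets X) A ->
            P (H `&` (M n.+1 @^-1` A)) = (\int[P]_(w in H) K w A)%E) &
         {ae P, forall w, BeP_law (borel_sets X)
                  (nu_n M Rv m alpha beta c n w) (K w)}]) ->
  (* Rbar_n -> r a.s. *)
  {ae P, forall w, (fun n => Rbar Rv n w) @ \oo --> r} ->
  (* (sum_{j<=n} j^(beta-1) E|Rbar_j - r|) / sqrt(a_n(beta)) -> 0 *)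
  ((fun n : nat => (\sum_(1 <= j < n.+1)
        ((j%:R `^ (beta - 1))%:E * \int[P]_w (`|Rbar Rv j w - r|)%:E)) *
        ((Num.sqrt (a_n beta n))^-1)%:E)%E @ \oo --> 0%E) ->
  stable_conv P
    (fun n w => Num.sqrt (a_n beta n) *
       (Ln M n w / a_n beta n - lambda_beta alpha beta c r))
    (normal_prob 0 (Num.sqrt (lambda_beta alpha beta c r))).
Proof.
move=> hX sepX hm m1 dm alpha0 beta01 cbeta umax rM rRv _ BeP Rbar_r Rbar_rate.
have [G hG] := separable_open_base sepX.
(* A base point is needed to view Borel measures on a pointed carrier; it exists because
   [m setT = 1] excludes an empty space. *)
have [x0 _] : [set: X] !=set0.
  apply/set0P/eqP => X0; move: m1; rewrite X0 => mX; have [m0 _ _ _] := hm.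
  by move: mX; rewrite m0 => /eqP; rewrite eq_sym onee_eq0.
exact: (buffet_count_stable x0 hX hm m1 dm alpha0 beta01 cbeta umax rM rRv BeP hG Rbar_r Rbar_rate).
Qed.
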